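(* Let $c,\gamma_1,\gamma_2>0$ be such that $\gamma:=\left(\frac1{\gamma_1}+\frac2{\gamma_2}\right)^{-1}<1$. There exist constants $C_1,C_2>0$ depending only on $\gamma_1,\gamma_2,c$ such that the following holds. Let $(X_t,Y_t)_t$, with $X_t\in\mathbb{R}^p$, $Y_t\in\mathbb{R}^q$, be a strictly stationary, mean-zero process whose $\beta$-mixing coefficients satisfy $\beta(n)\le2\exp(-c\,n^{\gamma_1})$ for all $n\in\mathbb{N}$, and suppose that for all $t$ the vectors $X_t$ and $Y_t$ are subweibull($\gamma_2$) with $\|X_t\|_{\psi_{\gamma_2}}\le K_X$ and $\|Y_t\|_{\psi_{\gamma_2}}\le K_Y$. Suppose $\Theta^\star$ is $s$-sparse. Let $K:=2^{2/\gamma_2}K_X^2$. Then for sample size $$T\ge\max\left\{\frac{54K\,(2C_1\log(p))^{1/\gamma}}{\lambda_{\min}(\Sigma_X)},\ \left(\frac{54K}{\lambda_{\min}(\Sigma_X)}\right)^{\frac{2-\gamma}{1-\gamma}}\left(\frac{C_2}{C_1}\right)^{\frac1{1-\gamma}}\right\},$$ with probability at least $$1-2T\exp\{-\tilde cT^\gamma\},\qquad\text{where }\ \tilde c=\frac{(\lambda_{\min}(\Sigma_X))^\gamma}{(54K)^\gamma\,2C_1},$$ we have for all $v\in\mathbb{R}^p$, $$\frac1T\|\mathbf{X}v\|_2^2\ge\alpha_{\mathrm{RE}}\|v\|_2^2-\tau\|v\|_1^2,$$ where $\alpha_{\mathrm{RE}}=\frac12\lambda_{\min}(\Sigma_X)$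 and $\tau=\frac{\alpha_{\mathrm{RE}}}{2\tilde c}\cdot\frac{\log(p)}{T^\gamma}$.
   Context: $\mathbf{X}=(X_1,\dots,X_T)'\in\mathbb{R}^{T\times p}$; prime denotes transpose. $\Theta^\star=\arg\min_{\Theta\in\mathbb{R}^{p\times q}}\mathbb{E}\|Y_t-\Theta'X_t\|_2^2$; it is $s$-sparse if it has exactly $s$ nonzero entries. $\Sigma_X=\mathbb{E}[X_tX_t']$ is positive definite so that the displayed quantities are well defined; $\lambda_{\min}$ is the smallest eigenvalue. Subweibull: for a real random variable $U$ and $\gamma>0$, $\|U\|_{\psi_\gamma}=\sup_{r\ge1}(\mathbb{E}|U|^r)^{1/r}r^{-1/\gamma}$, and $U$ is subweibull($\gamma$) if this is finite. For a random vector $V\in\mathbb{R}^m$, $\|V\|_{\psi_\gamma}=\sup_{\|v\|_2=1}\|v'V\|_{\psi_\gamma}$; $V$ is subweibull($\gamma$) if all its one-dimensional projections are. $\beta$-mixing: for random elements $U,V$, $\beta(U,V)=\sup\frac12\sum_{i=1}^I\sum_{j=1}^J|P(A_i\cap B_j)-P(A_i)P(B_j)|$, the supremum over pairs of finite partitions $\{A_i\}$, $\{B_j\}$ of the sample space with $A_i\in\sigma(U)$, $B_j\in\sigma(V)$. For a stationary process $(Z_t)$ (extended to index set $\mathbb{Z}$), $\beta(l)=\beta(Z_{-\infty:t},Z_{t+l:\infty})$, $l\ge1$. Here $Z_t=(X_t,Y_t)$. *)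

(* Defs.v *)
(* MathComp / MathComp-Analysis. *)
From HB Require Import structures.
From mathcomp Require Import all_boot all_order all_algebra.
From mathcomp Require Import all_classical all_reals all_analysis.

Set Implicit Arguments.
Unset Strict Implicit.
Unset Printing Implicit Defensive.

Import Order.TTheory GRing.Theory Num.Theory.
Import numFieldNormedType.Exports.

Local Open Scope classical_set_scope.
Local Open Scope ring_scope.

Section Vectors.
Context {R : realType}.

(* The library's norm on matrices is the sup norm. *)
Definition l2norm n (v : 'cV[R]_n) : R := Num.sqrt (\sum_i v i 0 ^+ 2).

Definition l1norm n (v : 'cV[R]_n) : R := \sum_i `|v i 0|.

(* Random vectors are modelled as random variables in n.-tuple R, which carries
   the product of the Borel sigma-algebras (matrices carry no measurable
   structure in the library); tvec gives the column vector. *)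
Definition tvec n (x : n.-tuple R) : 'cV[R]_n := \col_i tnth x i.

Definition nnz p q (A : 'M[R]_(p, q)) : nat :=
  #|[set ij : 'I_p * 'I_q | A ij.1 ij.2 != 0]|.

Definition posdef n (A : 'M[R]_n) : Prop :=
  A^T = A /\ forall v : 'cV[R]_n, v != 0 -> 0 < (v^T *m A *m v) 0 0.

(* The eigenvalues form a finite set, nonempty if A is symmetric and 0 < n, so
   this infimum is then a minimum. *)
Definition lambda_min n (A : 'M[R]_n) : R := inf [set a : R | eigenvalue A a].

End Vectors.

Section Moments.
Context {d} {Omega : measurableType d} {R : realType}.
Variable P : probability Omega R.

Definition second_moment n (X : Omega -> n.-tuple R) : 'M[R]_n :=
  \matrix_(i, j) fine 'E_P[fun w => tnth (X w) i * tnth (X w) j].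

Definition risk p q (X : Omega -> p.-tuple R) (Y : Omega -> q.-tuple R)
    (Theta : 'M[R]_(p, q)) : \bar R :=
  'E_P[fun w => l2norm (tvec (Y w) - Theta^T *m tvec (X w)) ^+ 2].

Definition psi_norm (g : R) (U : Omega -> R) : \bar R :=
  ereal_sup [set ('N[P]_r%:E [EFin \o U] * (r `^ (- g^-1))%:E)%E
            | r in [set r : R | 1 <= r]].

Definition subweibull (g : R) (U : Omega -> R) : Prop :=
  (psi_norm g U < +oo)%E.

Definition proj n (v : 'cV[R]_n) (V : Omega -> n.-tuple R) : Omega -> R :=
  fun w => (v^T *m tvec (V w)) 0 0.

Definition psi_norm_vec n (g : R) (V : Omega -> n.-tuple R) : \bar R :=
  ereal_sup [set psi_norm g (proj v V)
            | v in [set v : 'cV[R]_n | l2norm v = 1]].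

Definition subweibull_vec n (g : R) (V : Omega -> n.-tuple R) : Prop :=
  forall v : 'cV[R]_n, subweibull g (proj v V).

End Moments.

Section Processes.
Context {d} {Omega : measurableType d} {R : realType}.
Variable P : probability Omega R.

(* Empty blocks are allowed; they contribute nothing to beta_coef. *)
Definition fin_partition (F : set (set Omega)) n (A : 'I_n -> set Omega) :
    Prop :=
  [/\ forall i, F (A i), trivIset setT A & \bigcup_i A i = setT].

(* The coefficient of two random elements, through the sigma-algebras that they
   generate. *)
Definition beta_coef (F G : set (set Omega)) : \bar R :=
  ereal_sup [set b | exists I J (A : 'I_I -> set Omega) (B : 'I_J -> set Omega),
    [/\ fin_partition F A, fin_partition G B &
     b = ((2^-1)%:E * \sum_(i < I) \sum_(j < J)
            `|P (A i `&` B j) - P (A i) * P (B j)|)%E]].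

Context {d'} {S : measurableType d'}.
Implicit Type Z : int -> Omega -> S.

Definition sigma_process Z (I : set int) : set (set Omega) :=
  <<s \bigcup_(s in I) preimage_set_system setT (Z s) measurable >>.

(* For a stationary process the value does not depend on the time t. *)
Definition beta_mixing Z (t : int) (l : nat) : \bar R :=
  beta_coef (sigma_process Z [set s | s <= t])
            (sigma_process Z [set s | t + l%:Z <= s]).

Definition strictly_stationary Z : Prop :=
  forall n (t : 'I_n -> int) (h : int) (B : set (n.-tuple S)),
    measurable B ->
    P [set w | B [tuple Z (t i) w | i < n]] =
    P [set w | B [tuple Z (t i + h) w | i < n]].

End Processes.

(* Row t (counted from 0) is the transpose of X_{t+1}. *)
Definition design {Omega : Type} {R : realType} p
    (X : int -> Omega -> p.-tuple R) (T : nat) (w : Omega) : 'M[R]_(T, p) :=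
  \matrix_(t, j) tnth (X t.+1%:Z w) j.

(* Main.v *)
Require Import Defs.
From HB Require Import structures.
From mathcomp Require Import all_boot all_order all_algebra.
From mathcomp Require Import all_classical all_reals all_analysis.
From mathcomp Require Import measurable_realfun.
From mathcomp Require Import zify ring lra.

Import Order.TTheory GRing.Theory Num.Theory.
Import numFieldNormedType.Exports.

Local Open Scope classical_set_scope.
Local Open Scope ring_scope.

(** Write [lam] for the smallest eigenvalue of [Sigma_X]. As
[lam * l2norm v ^+ 2] is a lower bound of the form of [Sigma_X]
([lambda_min_rayleigh]), it suffices to bound from below the form of the
difference [A] between the sample second moment matrix and [Sigma_X]. This
rests on three facts.

Sparsification ([sparse_to_all]). By Maurey's empirical method, a lower bound
[- de * l2norm z ^+ 2] of the form of [A] on all sums [z] of [d] signed basis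
vectors and an upper bound [de] of the diagonal entries yield a lower bound at
every [v], at the price of [2 * de / (d - 1) * l1norm v ^+ 2]. With
[de = lam / 54] and, for [p >= 2], [d] of order [ctilde * T `^ gamma / ln p],
this price is at most [tau * l1norm v ^+ 2], while there are only [(2 * p) ^ d] sums, a number
bounded by [expR (6 * ctilde * T `^ gamma)] ([count_le_exp]). So a union bound
over finitely many directions is enough.

One direction ([direction_tail]). For a unit vector [u], the squares of
[u' X_t], divided by [K], form a stationary process with tails
[2 * expR (- b * y `^ (gamma2 / 2))], a fourth moment bounded in terms of
[gamma2] alone, and mixing coefficients at most those of [(X_t, Y_t)]. Their
centred sum exceeds [x = T * lam / (54 * K)] in absolute value with probability
of order [T * expR (- (x / 2) `^ gamma / G)], where [G] depends on [c],
[gamma1] and [gamma2]. A constant [C1] proportional to [G] makes this small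
enough to survive the union bound ([sample_size_constants]).

The stretched exponential tail ([stretched_exponential_tail]), in the spirit of
Merlevede, Peligrad and Rio, is the substance of the proof. It is proved for
processes on finite probability spaces, where all expectations are finite sums;
rounding and truncating a process reduces the general case to this one
([process_tail]). Dependence enters only through the cost [4 * expR (- c l^g1)]
of replacing the future after a gap [l] by an independent copy. The proof is a
strong induction on the number [n] of summands. While [y `^ g] is at most [G],
Chebyshev's inequality suffices, since the variance is at most linear in [n]
([sm_variance]). For larger [y] the summands are cut into blocks of length [A],
blocks of equal parity being separated by gaps [A]; a Chernoff bound truncated
at one ([decoupled_tail]) turns a sub-Gaussian Laplace transform of one block
into a tail bound for the sum, up to errors [n * expR (- c A^g1)] from mixing
and [n * expR (- b M^th)] from a truncation at [M]. Both must be of order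
[expR (- l)] with [l] slightly larger than [y `^ g / G], which determines [A],
[M] and a Laplace parameter [t] of order [l / y].

It remains to bound the Laplace transform of one block at [t] ([mgf_of_tail]).
The exponential is expanded over the deviations of the block. Those above
[A `^ (2 - g)^-1] are controlled by the induction hypothesis, as [A < n]. The
smaller ones are estimated by cutting the block into still shorter blocks, with
a smaller cap and a slightly larger Laplace parameter ([subgauss_step]). After
a number of steps that depends only on [g1] and [th] the threshold is at most
the inverse of the parameter, no smaller deviations remain ([subgauss_base]),
and the recursion ends. *)

Set Implicit Arguments.
Unset Strict Implicit.

(** * Expectations on a finite probability space *)

Section FiniteExpectation.
Context {R : realType} {W : finType}.
Variable mu : W -> R.
Implicit Types f g : W -> R.

Definition Ex f : R := \sum_w mu w * f w.
Definition Pr (A : W -> bool) : R := Ex (fun w => (A w)%:R).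

Lemma eq_Ex f g : f =1 g -> Ex f = Ex g.
Proof. by move=> fg; apply: eq_bigr => w _; rewrite fg. Qed.

Lemma ExD f g : Ex (fun w => f w + g w) = Ex f + Ex g.
Proof. by rewrite /Ex -big_split; apply: eq_bigr => w _; rewrite mulrDr. Qed.

Lemma ExN f : Ex (fun w => - f w) = - Ex f.
Proof. by rewrite /Ex -sumrN; apply: eq_bigr => w _; rewrite mulrN. Qed.

Lemma ExB f g : Ex (fun w => f w - g w) = Ex f - Ex g.
Proof. by rewrite ExD ExN. Qed.

Lemma ExZ a f : Ex (fun w => a * f w) = a * Ex f.
Proof. by rewrite /Ex mulr_sumr; apply: eq_bigr => w _; rewrite mulrCA. Qed.

Lemma ExZr a f : Ex (fun w => f w * a) = Ex f * a.
Proof. by rewrite mulrC -ExZ; apply: eq_Ex => w; rewrite mulrC. Qed.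

Lemma Ex_sum I (r : seq I) (F : I -> W -> R) :
  Ex (fun w => \sum_(i <- r) F i w) = \sum_(i <- r) Ex (F i).
Proof.
by rewrite /Ex exchange_big; apply: eq_bigr => w _; rewrite mulr_sumr.
Qed.

Lemma Ex0 : Ex (fun=> 0) = 0.
Proof. by rewrite /Ex big1 // => w _; rewrite mulr0. Qed.

Hypothesis mu_ge0 : forall w, 0 <= mu w.

Lemma le_Ex f g : (forall w, f w <= g w) -> Ex f <= Ex g.
Proof. by move=> fg; apply: ler_sum => w _; apply: ler_wpM2l. Qed.

Lemma Ex_ge0 f : (forall w, 0 <= f w) -> 0 <= Ex f.
Proof. by move=> f0; apply: sumr_ge0 => w _; apply: mulr_ge0. Qed.

Lemma normr_Ex f : `|Ex f| <= Ex (fun w => `|f w|).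
Proof.
by apply: le_trans (ler_norm_sum _ _ _) _; apply: ler_sum => w _;
  rewrite normrM (ger0_norm (mu_ge0 w)).
Qed.

Lemma le_Pr (A B : W -> bool) : (forall w, A w -> B w) -> Pr A <= Pr B.
Proof.
move=> AB; apply: le_Ex => w; case: (boolP (A w)) => [/AB ->//|_].
exact: ler0n.
Qed.

Lemma le_PrU (A B C : W -> bool) : (forall w, A w -> B w || C w) ->
  Pr A <= Pr B + Pr C.
Proof.
move=> ABC; rewrite -ExD; apply: le_Ex => w; have := ABC w.
by case: (A w); case: (B w); case: (C w) => //=;
  rewrite -?natrD ?ler_nat // => /(_ isT).
Qed.

Lemma le_Pr_has n (A : nat -> W -> bool) :
  Pr (fun w => has (A ^~ w) (iota 0 n)) <= \sum_(0 <= s < n) Pr (A s).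
Proof.
rewrite /Pr -Ex_sum; apply: le_Ex => w; rewrite /index_iota subn0.
elim: (iota 0 n) => [|s r IH] /=; first by rewrite big_nil.
rewrite big_cons; apply: le_trans (lerD (lexx _) IH).
by rewrite -natrD ler_nat; case: (A s w) => //=; case: has.
Qed.

Lemma finite_markov (f : W -> R) a : 0 < a -> (forall w, 0 <= f w) ->
  Pr (fun w => a <= f w) <= Ex f / a.
Proof.
move=> a0 f0; rewrite ler_pdivlMr // -ExZr; apply: le_Ex => w.
by case: (leP a (f w)); rewrite ?mul1r ?mul0r.
Qed.

Hypothesis mu1 : \sum_w mu w = 1.

Lemma Ex_cst a : Ex (fun=> a) = a.
Proof. by rewrite /Ex -mulr_suml mu1 mul1r. Qed.

(** Two functions with values in [-M, M] become a function with values in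
[0, 1] after the affine change that turns their covariance into a difference
of expectations of a product. *)
Lemma cov_le (M be : R) f g : 0 < M ->
  (forall w, `|f w| <= M) -> (forall w, `|g w| <= M) ->
  (forall F : W -> W -> R, (forall w w', 0 <= F w w' <= 1) ->
     (forall w1 w2 w', f w1 = f w2 -> F w1 w' = F w2 w') ->
     (forall w w1 w2, g w1 = g w2 -> F w w1 = F w w2) ->
     `|Ex (fun w => F w w) - Ex (fun w => Ex (F w))| <= be) ->
  `|Ex (fun w => f w * g w) - Ex f * Ex g| <= 4 * M ^+ 2 * be.
Proof.
move=> M0 fM gM H.
pose F w w' := (f w + M) * (g w' + M) / (4 * M ^+ 2).
have M2 : 0 < 4 * M ^+ 2 by rewrite mulr_gt0 // exprn_gt0.
have h w : 0 <= f w + M <= 2 * M.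
  by have := fM w; rewrite ler_norml => /andP[? ?]; apply/andP; split; lra.
have k w : 0 <= g w + M <= 2 * M.
  by have := gM w; rewrite ler_norml => /andP[? ?]; apply/andP; split; lra.
have F01 w w' : 0 <= F w w' <= 1.
  have /andP[h0 h1] := h w; have /andP[k0 k1] := k w'.
  rewrite /F; apply/andP; split; first by rewrite divr_ge0 ?mulr_ge0 // ltW.
  rewrite ler_pdivrMr // mul1r.
  apply: (le_trans (ler_pM h0 k0 h1 k1)).
  by rewrite le_eqVlt; apply/orP; left; apply/eqP; ring.
have Fl w1 w2 w' : f w1 = f w2 -> F w1 w' = F w2 w' by rewrite /F => ->.
have Fr w w1 w2 : g w1 = g w2 -> F w w1 = F w w2 by rewrite /F => ->.
have := H F F01 Fl Fr.
have -> : Ex (fun w => F w w) - Ex (fun w => Ex (F w)) =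
   (Ex (fun w => f w * g w) - Ex f * Ex g) / (4 * M ^+ 2).
  have -> : Ex (fun w => F w w) =
      (Ex (fun w => f w * g w) + M * Ex f + M * Ex g + M ^+ 2) / (4 * M ^+ 2).
    rewrite /F ExZr; congr (_ / _).
    rewrite -(Ex_cst (M ^+ 2)) -2!ExZ -!ExD.
    by apply: eq_Ex => w; ring.
  have -> : Ex (fun w => Ex (F w)) =
      ((Ex f + M) * (Ex g + M)) / (4 * M ^+ 2).
    under eq_Ex do rewrite /F ExZr ExZ ExD Ex_cst.
    by rewrite ExZr ExZr ExD Ex_cst.
  by rewrite -mulrBl; congr (_ / _); ring.
rewrite normrM normfV (ger0_norm (ltW M2)) ler_pdivrMr // => /le_trans; apply.
by rewrite mulrC.
Qed.

End FiniteExpectation.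

(** * Subweibull mixing processes on a finite probability space *)

Section MixingProcess.
Context {R : realType}.
Variables (c g1 b th m : R).

(** Mixing bounds the cost of replacing the future by an independent copy,
for test functions [F] of two sample points with values in [0, 1]. In this form
it passes to coordinatewise images of the process, and a truncated exponential
is a test function. *)
Record subweibull_mixing (W : finType) (mu : W -> R) (D : nat -> W -> R) := SubweibullMixing {
  sm_tail : forall s y, 0 <= y ->
    Pr mu (fun w => y < `|D s w|) <= 2 * expR (- (b * y `^ th));
  sm_moment4 : forall s, Ex mu (fun w => D s w ^+ 4) <= m;
  sm_mixing : forall (k l : nat) (F : W -> W -> R), (0 < l)%N ->
    (forall w w', 0 <= F w w' <= 1) ->
    (forall w1 w2 w', (forall s, (s <= k)%N -> D s w1 = D s w2) ->
       F w1 w' = F w2 w') ->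
    (forall w w1 w2, (forall s, (k + l <= s)%N -> D s w1 = D s w2) ->
       F w w1 = F w w2) ->
    `|Ex mu (fun w => F w w) - Ex mu (fun w => Ex mu (F w))|
      <= 4 * expR (- (c * l%:R `^ g1)) }.

Definition csum (W : finType) (mu : W -> R) (D : nat -> W -> R) n (w : W) : R :=
  \sum_(0 <= s < n) (D s w - Ex mu (D s)).

Section Closure.
Context {W : finType} {mu : W -> R}.
Hypothesis mu_ge0 : forall w, 0 <= mu w.
Hypothesis mu1 : \sum_w mu w = 1.

Lemma sm_shift D a : subweibull_mixing mu D ->
  subweibull_mixing mu (fun s => D (a + s)%N).
Proof.
case=> ta mo mi; split; [by move=> s; apply: ta | by move=> s; apply: mo |].
move=> k l F l0 F01 Fl Fr.
apply: (mi (a + k)%N l) => //.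
- by move=> w1 w2 w' h; apply: Fl => s sk; apply: h; rewrite leq_add2l.
- by move=> w w1 w2 h; apply: Fr => s sk; apply: h; rewrite -addnA leq_add2l.
Qed.

(** Caps, restrictions to the first indices and changes of sign are all of this
form, so that none of the constants degrades when they are combined. *)
Lemma sm_contraction D (phi : nat -> R -> R) : subweibull_mixing mu D ->
  (forall s x, `|phi s x| <= `|x|) ->
  subweibull_mixing mu (fun s w => phi s (D s w)).
Proof.
case=> ta mo mi ph; split.
- move=> s y y0; apply: le_trans (ta s y y0); apply: le_Pr => // w h.
  exact: lt_le_trans h (ph _ _).
- move=> s; apply: le_trans (mo s); apply: le_Ex => // w.
  rewrite -(ger0_norm (exprn_even_ge0 _ (isT : ~~ odd 4))).
  rewrite -[leRHS](ger0_norm (exprn_even_ge0 _ (isT : ~~ odd 4))).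
  by rewrite !normrX lerXn2r ?nnegrE.
- move=> k l F l0 F01 Fl Fr; apply: (mi k l) => //.
  + by move=> w1 w2 w' h; apply: Fl => s sk; rewrite h.
  + by move=> w w1 w2 h; apply: Fr => s sk; rewrite h.
Qed.

Lemma sm_opp D : subweibull_mixing mu D ->
  subweibull_mixing mu (fun s w => - D s w).
Proof.
by move=> h; apply: (sm_contraction (phi := fun _ x => - x) h) => s x; rewrite normrN.
Qed.

(** The cap is one-sided because only upper deviations are estimated
with it, and lowering values only lowers the mean. Setting the process to zero
from [n] on lets the last block run past [n]. *)
Definition cap_kill (D : nat -> W -> R) (M : R) (n : nat) s w :=
  if (s < n)%N then Num.min (D s w) M else 0.

Lemma sm_cap_kill D M n : 0 <= M -> subweibull_mixing mu D ->
  subweibull_mixing mu (cap_kill D M n).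
Proof.
move=> M0 h.
apply: (sm_contraction (phi := fun s x => if (s < n)%N then Num.min x M else 0) h).
move=> s x; case: ifP => _; last by rewrite normr0.
by case: (leP x M) => // Mx; rewrite !ger0_norm // ?ltW // (le_lt_trans M0).
Qed.

Lemma csumE D n w : csum mu D n.+1 w = csum mu D n w + (D n w - Ex mu (D n)).
Proof. by rewrite /csum big_nat_recr. Qed.

Lemma csum_opp D n w : csum mu (fun s w => - D s w) n w = - csum mu D n w.
Proof.
rewrite /csum -sumrN; apply: eq_bigr => s _.
by rewrite ExN; ring.
Qed.

Lemma Ex_csum D n : Ex mu (csum mu D n) = 0.
Proof.
rewrite /csum Ex_sum big1 // => s _.
by rewrite ExB Ex_cst // subrr.
Qed.

Lemma normr_le_1X4 (x : R) : `|x| <= 1 + x ^+ 4.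
Proof.
have -> : x ^+ 4 = `|x| ^+ 4 by rewrite -normrX ger0_norm // exprn_even_ge0.
have := normr_ge0 x; move: `|x| => y y0.
case: (leP y 1) => y1; first by rewrite (le_trans y1) // lerDl exprn_ge0.
have : y <= y ^+ 4 by rewrite -[leLHS]expr1 ler_eXn2l.
by lra.
Qed.

Lemma sqr_le_1X4 (x : R) : x ^+ 2 <= 1 + x ^+ 4.
Proof. have := sqr_ge0 (x ^+ 2 - 2^-1); rewrite sqrrB -!exprM /=; nra. Qed.

Lemma sm_mean D s : subweibull_mixing mu D -> Ex mu (fun w => `|D s w|) <= 1 + m.
Proof.
move=> h; apply: le_trans (_ : Ex mu (fun w => 1 + D s w ^+ 4) <= _).
  by apply: le_Ex => // w; apply: normr_le_1X4.
by rewrite ExD Ex_cst // lerD2l; apply: sm_moment4 h _.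
Qed.

Lemma csum_le_cap D M n : 0 <= M -> subweibull_mixing mu D ->
  (forall s w, D s w <= M) -> forall w, csum mu D n w <= n%:R * (M + (1 + m)).
Proof.
move=> M0 h DM w.
apply: le_trans (_ : \sum_(0 <= s < n) (M + (1 + m)) <= _); last first.
  by rewrite big_const_nat subn0 iter_addr_0 mulr_natl.
apply: ler_sum => s _; apply: lerD => //.
rewrite lerNl; apply: le_trans (_ : - Ex mu (fun w => `|D s w|) <= _).
  by rewrite lerN2; apply: sm_mean.
by rewrite -ExN; apply: le_Ex => // w'; rewrite lerNl -normrN ler_norm.
Qed.

End Closure.

(** ** Variance of a sum *)

(** Four powers of the lag: in [sm_cov] two of them pay for the squared
truncation level, and the other two make the covariances summable. *)
Lemma expR_weibull_decay : 0 < c -> 0 < g1 -> exists2 K : R, 0 < K &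
  forall l, (0 < l)%N -> expR (- (c * l%:R `^ g1)) <= K / l%:R ^+ 4.
Proof.
move=> c0 g0; exists (expR (- ((4 / g1) * (1 + ln (c * g1 / 4))))).
  exact: expR_gt0.
move=> l l0.
have lp : 0 < l%:R :> R by rewrite ltr0n.
rewrite ler_pdivlMr ?exprn_gt0 //.
have -> : l%:R ^+ 4 = expR (ln l%:R *+ 4) :> R.
  by rewrite -lnXn // lnK // posrE exprn_gt0.
rewrite -expRD ler_expR.
have d0 : 0 < c * g1 / 4 by rewrite divr_gt0 ?mulr_gt0.
have u0 : 0 < c * g1 / 4 * l%:R `^ g1 by rewrite mulr_gt0 ?powR_gt0.
have : ln (c * g1 / 4 * l%:R `^ g1) <= c * g1 / 4 * l%:R `^ g1 - 1.
  rewrite -{1}[X in ln X](subrK 1) [X in ln X]addrC.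
  by apply: le_ln1Dx; lra.
rewrite lnM ?posrE ?powR_gt0 // ln_powR.
set A := ln (c * _ / _); set B := _ `^ _; set L := ln _ => H.
have H2 := ler_wpM2l (ltW (divr_gt0 (ltr0n _ 4 : 0 < 4) g0)) H.
have E1 : 4 / g1 * (A + g1 * L) = 4 / g1 * A + L *+ 4.
  by rewrite -mulr_natr; field; rewrite gt_eqF.
have E2 : 4 / g1 * (c * g1 / 4 * B - 1) = c * B - 4 / g1.
  by field; rewrite gt_eqF.
move: H2; rewrite E1 E2; lra.
Qed.

Lemma sum_inv_sqr n : \sum_(0 <= l < n) (l.+1%:R ^+ 2)^-1 <= 2 :> R.
Proof.
suff H k : \sum_(0 <= l < k.+1) (l.+1%:R ^+ 2)^-1 <= 2 - k.+1%:R^-1 :> R.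
  case: n => [|n]; first by rewrite big_geq.
  by apply: le_trans (H n) _; rewrite lerBlDr lerDl invr_ge0.
elim: k => [|k IH]; first by rewrite big_nat1 expr1n invr1; lra.
rewrite big_nat_recr //=; apply: le_trans (lerD IH (lexx _)) _.
have p1 : 0 < k.+1%:R :> R by rewrite ltr0n.
have p2 : 0 < k.+2%:R :> R by rewrite ltr0n.
have e : k.+2%:R = k.+1%:R + 1 :> R by rewrite -natr1.
have key : (k.+2%:R ^+ 2)^-1 <= k.+1%:R^-1 - k.+2%:R^-1 :> R.
  have -> : k.+1%:R^-1 - k.+2%:R^-1 = (k.+1%:R * k.+2%:R)^-1 :> R.
    move: p2; rewrite e; move: (k.+1%:R : R) p1 => x x0 x1.
    by field; rewrite !gt_eqF.
  by rewrite lef_pV2 ?posrE ?mulr_gt0 ?exprn_gt0 // expr2 ler_pM2r // e lerDl.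
move: key; move: (_^-1) (_^-1) (_^-1) => x y z; lra.
Qed.

Section Covariance.
Context {W : finType} {mu : W -> R}.
Hypothesis mu_ge0 : forall w, 0 <= mu w.
Hypothesis mu1 : \sum_w mu w = 1.
Hypothesis m0 : 0 <= m.

(** Truncation at the level of the lag: the truncated covariance is controlled
by the mixing rate, and the remainder by fourth moments over the squared lag. *)
Lemma sm_cov D s l (K : R) : (0 < l)%N -> subweibull_mixing mu D ->
  expR (- (c * l%:R `^ g1)) <= K / l%:R ^+ 4 ->
  `|Ex mu (fun w => D s w * D (s + l)%N w) - Ex mu (D s) * Ex mu (D (s + l)%N)|
    <= (16 * K + 4 * m + 2 * m ^+ 2) / l%:R ^+ 2.
Proof.
move=> l0 h hK.
set M : R := l%:R.
have M1 : 1 <= M by rewrite ler1n.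
have Mp : 0 < M by rewrite ltr0n.
pose phi x := if `|x| <= M then x else 0 : R.
have phiM x : `|phi x| <= M.
  by rewrite /phi; case: ifP => // _; rewrite normr0 ltW.
have phix x : `|phi x| <= `|x|.
  by rewrite /phi; case: ifP => // _; rewrite normr0.
set f := D s; set g := D (s + l)%N.
have h4f : Ex mu (fun w => f w ^+ 4) <= m by apply: sm_moment4 h _.
have h4g : Ex mu (fun w => g w ^+ 4) <= m by apply: sm_moment4 h _.
have C1 : `|Ex mu (fun w => phi (f w) * phi (g w)) -
    Ex mu (fun w => phi (f w)) * Ex mu (fun w => phi (g w))|
    <= 16 * K / M ^+ 2.
  apply: le_trans (cov_le (M := M) (be := 4 * expR (- (c * l%:R `^ g1)))
     mu1 Mp _ _ _) _ => //.
  - move=> F F01 Fl Fr; apply: (sm_mixing h (k := s)) => //.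
    + by move=> w1 w2 w' e; apply: Fl; rewrite /f e.
    + by move=> w w1 w2 e; apply: Fr; rewrite /g e.
  - rewrite ler_pdivlMr ?exprn_gt0 //.
    have := ler_wpM2l (exprn_ge0 4 (ltW Mp)) hK.
    by rewrite -/M mulrCA divff ?gt_eqF ?exprn_gt0 // mulr1; lra.
have rem1 x : `|x - phi x| <= x ^+ 4 / M ^+ 2.
  rewrite /phi; case: (leP `|x| M) => xM.
    by rewrite subrr normr0 divr_ge0 ?exprn_even_ge0.
  rewrite subr0 ler_pdivlMr ?exprn_gt0 //.
  have -> : x ^+ 4 = `|x| ^+ 4 by rewrite -normrX ger0_norm // exprn_even_ge0.
  have x1 : 1 <= `|x| by apply: ltW; apply: le_lt_trans M1 xM.
  rewrite (_ : `|x| ^+ 4 = `|x| * (`|x| * `|x| ^+ 2)); last by ring.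
  rewrite ler_wpM2l //; apply: le_trans (_ : `|x| ^+ 2 <= _).
    by rewrite lerXn2r ?nnegrE // ltW.
  by rewrite -[leLHS]mul1r ler_wpM2r // exprn_ge0.
have rem2 x y : `|x * y - phi x * phi y| <= (x ^+ 4 + y ^+ 4) / M ^+ 2.
  have -> : x ^+ 4 = `|x| ^+ 4 by rewrite -normrX ger0_norm // exprn_even_ge0.
  have -> : y ^+ 4 = `|y| ^+ 4 by rewrite -normrX ger0_norm // exprn_even_ge0.
  have big u v : 0 <= u -> 0 <= v -> M < u -> u * v <= (u ^+ 4 + v ^+ 4) / M ^+ 2.
    move=> u0 v0 Mu; rewrite ler_pdivlMr ?exprn_gt0 //.
    apply: le_trans (_ : u * v * u ^+ 2 <= _).
      by rewrite ler_wpM2l ?mulr_ge0 // lerXn2r ?nnegrE // ltW.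
    have : 2 * (u * v * u ^+ 2) <= u ^+ 4 + u ^+ 2 * v ^+ 2.
      by have := sqr_ge0 (u ^+ 2 - u * v); nra.
    have := sqr_ge0 (u ^+ 2 - v ^+ 2).
    have := exprn_ge0 4 u0; have := exprn_ge0 4 v0.
    nra.
  have pos : 0 <= (`|x| ^+ 4 + `|y| ^+ 4) / M ^+ 2.
    by rewrite divr_ge0 ?addr_ge0 ?exprn_ge0 // ltW.
  rewrite /phi; case: (leP `|x| M) => xM; last first.
    by rewrite mul0r subr0 normrM; apply: big.
  case: (leP `|y| M) => yM; first by rewrite subrr normr0.
  by rewrite mulr0 subr0 normrM mulrC [X in _ <= X / _]addrC; apply: big.
have Dfg : `|Ex mu (fun w => f w * g w) - Ex mu (fun w => phi (f w) * phi (g w))|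
     <= 2 * m / M ^+ 2.
  rewrite -ExB; apply: le_trans (normr_Ex mu_ge0 _) _.
  apply: le_trans (_ : Ex mu (fun w => (f w ^+ 4 + g w ^+ 4) / M ^+ 2) <= _).
    by apply: le_Ex => // w; apply: rem2.
  rewrite ExZr ExD ler_wpM2r ?invr_ge0 ?exprn_ge0 ?(ltW Mp) //.
  by rewrite mulr_natl mulr2n; apply: lerD.
have D1 (u : W -> R) : Ex mu (fun w => u w ^+ 4) <= m ->
    `|Ex mu u - Ex mu (fun w => phi (u w))| <= m / M ^+ 2.
  move=> hu; rewrite -ExB; apply: le_trans (normr_Ex mu_ge0 _) _.
  apply: le_trans (_ : Ex mu (fun w => u w ^+ 4 / M ^+ 2) <= _).
    by apply: le_Ex => // w; apply: rem1.
  by rewrite ExZr ler_wpM2r // invr_ge0 exprn_ge0 // ltW.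
have B1 : `|Ex mu g| <= 1 + m.
  by apply: le_trans (normr_Ex mu_ge0 _) (sm_mean mu_ge0 mu1 _ h).
have B2 : `|Ex mu (fun w => phi (f w))| <= 1 + m.
  apply: le_trans (normr_Ex mu_ge0 _) _.
  apply: le_trans (sm_mean mu_ge0 mu1 s h).
  by apply: le_Ex => // w; apply: phix.
have Df := D1 _ h4f; have Dg := D1 _ h4g.
set a := Ex mu (fun w => f w * g w) in Dfg *.
set a' := Ex mu (fun w => phi (f w) * phi (g w)) in Dfg C1 *.
set x := Ex mu f in Df *; set x' := Ex mu (fun w => phi (f w)) in Df B2 C1 *.
set y := Ex mu g in Dg B1 *; set y' := Ex mu (fun w => phi (g w)) in Dg C1 *.
have -> : a - x * y = (a - a') + (a' - x' * y') - ((x - x') * y + x' * (y - y')).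
  by ring.
apply: le_trans (ler_normB _ _) _.
have T1 := ler_normD (a - a') (a' - x' * y').
have T2 := ler_normD ((x - x') * y) (x' * (y - y')).
rewrite !normrM in T2.
have mM : 0 <= m / M ^+ 2 by rewrite divr_ge0 ?exprn_ge0 // ltW.
have T3 := ler_pM (normr_ge0 _) (normr_ge0 _) Df B1.
have T4 := ler_pM (normr_ge0 _) (normr_ge0 _) B2 Dg.
have -> : (16 * K + 4 * m + 2 * m ^+ 2) / M ^+ 2 =
   2 * m / M ^+ 2 + 16 * K / M ^+ 2 + (m / M ^+ 2 * (1 + m) + (1 + m) * (m / M ^+ 2)).
  by field; rewrite gt_eqF.
lra.
Qed.

Lemma sm_variance_step (K : R) D n : (forall l, (0 < l)%N ->
    expR (- (c * l%:R `^ g1)) <= K / l%:R ^+ 4) -> 0 < K ->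
  subweibull_mixing mu D ->
  Ex mu (fun w => csum mu D n w ^+ 2)
    <= (1 + m + 4 * (16 * K + 4 * m + 2 * m ^+ 2)) * n%:R.
Proof.
move=> hK K0 h; set C := 16 * K + _ + _.
elim: n => [|n IH].
  by rewrite mulr0 /Ex big1 // => w _; rewrite /csum big_geq // expr0n mulr0.
pose d s w := D s w - Ex mu (D s).
have -> : Ex mu (fun w => csum mu D n.+1 w ^+ 2) =
    Ex mu (fun w => csum mu D n w ^+ 2) +
    (2 * \sum_(0 <= s < n) Ex mu (fun w => d s w * d n w) +
     Ex mu (fun w => d n w ^+ 2)).
  rewrite -Ex_sum -ExZ -!ExD; apply: eq_Ex => w.
  rewrite csumE -/(d n w) -mulr_suml -/(csum mu D n w).
  by ring.
rewrite -(natr1 n) mulrDr mulr1; apply: lerD => //.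
have covE s t : Ex mu (fun w => d s w * d t w) =
    Ex mu (fun w => D s w * D t w) - Ex mu (D s) * Ex mu (D t).
  rewrite /d; set x := Ex mu (D s); set y := Ex mu (D t).
  transitivity (Ex mu (fun w => (D s w * D t w - y * D s w) - (x * D t w - x * y))).
    by apply: eq_Ex => w; ring.
  by rewrite !ExB !ExZ Ex_cst // -/x -/y; ring.
have V : Ex mu (fun w => d n w ^+ 2) <= 1 + m.
  have -> : Ex mu (fun w => d n w ^+ 2) = Ex mu (fun w => D n w ^+ 2) - Ex mu (D n) ^+ 2.
    by rewrite (eq_Ex _ (g := fun w => d n w * d n w)) ?covE // => w.
  apply: le_trans (_ : Ex mu (fun w => D n w ^+ 2) <= _).
    by rewrite lerBlDr lerDl sqr_ge0.
  apply: le_trans (_ : Ex mu (fun w => 1 + D n w ^+ 4) <= _).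
    by apply: le_Ex => // w; apply: sqr_le_1X4.
  by rewrite ExD Ex_cst // lerD2l; apply: sm_moment4 h _.
have C0 : 0 <= C by rewrite !addr_ge0 ?mulr_ge0 ?exprn_ge0 // ltW.
have S : \sum_(0 <= s < n) Ex mu (fun w => d s w * d n w) <= C * 2.
  apply: le_trans (_ : \sum_(0 <= l < n) C / l.+1%:R ^+ 2 <= _); last first.
    by rewrite -mulr_sumr ler_wpM2l // sum_inv_sqr.
  rewrite [leRHS]big_nat_rev /=.
  apply: ler_sum_nat => s /andP[_ sn].
  rewrite covE; apply: le_trans (ler_norm _) _.
  have e : n = (s + (0 + n - s.+1).+1)%N.
    by rewrite add0n subnSK // subnKC // ltnW.
  rewrite {1 2}e; apply: sm_cov => //; exact: hK.
lra.
Qed.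

End Covariance.

Lemma sm_variance : 0 < c -> 0 < g1 -> 0 <= m -> exists2 v : R, 0 < v &
  forall (W : finType) (mu : W -> R), (forall w, 0 <= mu w) ->
  \sum_w mu w = 1 -> forall D n, subweibull_mixing mu D ->
  Ex mu (fun w => csum mu D n w ^+ 2) <= v * n%:R.
Proof.
move=> c0 g0 m0; have [K K0 hK] := expR_weibull_decay c0 g0.
exists (1 + m + 4 * (16 * K + 4 * m + 2 * m ^+ 2)).
  have : 0 <= m ^+ 2 by exact: exprn_ge0.
  by lra.
by move=> W mu mu0 mu1 D n h; apply: sm_variance_step.
Qed.

End MixingProcess.

(** * Sums of separated blocks *)

Section Blocks.
Context {R : realType}.
Variables (c g1 b th m : R).
Context {W : finType} {mu : W -> R}.
Hypothesis mu_ge0 : forall w, 0 <= mu w.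
Hypothesis mu1 : \sum_w mu w = 1.
Notation ok := (subweibull_mixing c g1 b th m mu).

(** Induction on the number of blocks: the last block is replaced by an
independent copy and integrated, which produces one more factor [Lam]. The
exponent [r] counts the factors already produced, and the minimum with one
keeps the integrand a test function with values in [0, 1]. *)
Lemma decoupled_mgf D (X : nat -> W -> R) (lo hi : nat -> nat) A t u Lam n r :
  ok D -> (0 < A)%N -> 0 < t -> 0 <= Lam ->
  (forall j w1 w2, (forall s, (lo j <= s < hi j)%N -> D s w1 = D s w2) ->
     X j w1 = X j w2) ->
  (forall j, hi j + A <= lo j.+1)%N -> (forall j, lo j <= hi j)%N ->
  (forall j, Ex mu (fun w => expR (t * X j w)) <= Lam) ->
  Ex mu (fun w => Num.min 1
      (expR (t * (\sum_(0 <= j < n) X j w - u)) * Lam ^+ r))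
    <= expR (- (t * u)) * Lam ^+ (n + r) + n%:R * (4 * expR (- (c * A%:R `^ g1))).
Proof.
move=> h A0 t0 L0 dep sep lohi mgf; elim: n r => [|n IH] r.
  rewrite mul0r addr0 add0n; rewrite -[leRHS](Ex_cst mu1); apply: le_Ex => // w.
  by rewrite big_geq // sub0r mulrN ge_min lexx orbT.
pose U w := \sum_(0 <= j < n) X j w.
pose F w w' := Num.min 1 (expR (t * (U w + X n w' - u)) * Lam ^+ r).
have step w : Ex mu (F w) <= Num.min 1 (expR (t * (U w - u)) * Lam ^+ r.+1).
  rewrite le_min; apply/andP; split.
    rewrite -[leRHS](Ex_cst mu1); apply: le_Ex => // w'.
    by rewrite ge_min lexx.
  apply: le_trans (_ : Ex mu (fun w' => expR (t * (U w - u)) * Lam ^+ r *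
      expR (t * X n w')) <= _).
    apply: le_Ex => // w'; rewrite ge_min; apply/orP; right.
    rewrite mulrAC -expRD; apply: ler_wpM2r; first exact: exprn_ge0.
    by rewrite ler_expR; lra.
  rewrite ExZ exprSr mulrA; apply: ler_wpM2l => //.
  by rewrite mulr_ge0 ?expR_ge0 ?exprn_ge0.
have F01 w w' : 0 <= F w w' <= 1.
  rewrite /F ge_min lexx andbT le_min ler01 /=.
  by rewrite mulr_ge0 ?expR_ge0 ?exprn_ge0.
have mix : Ex mu (fun w => F w w) <=
    Ex mu (fun w => Ex mu (F w)) + 4 * expR (- (c * A%:R `^ g1)).
  case: n @U @F step F01 {IH} => [|n] U F step F01.
    have -> : Ex mu (fun w => Ex mu (F w)) = Ex mu (fun w => F w w).
      rewrite -[RHS](Ex_cst mu1); apply: eq_Ex => w; apply: eq_Ex => w'.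
      by rewrite /F /U !big_geq.
    by rewrite lerDl mulr_ge0 // expR_ge0.
  rewrite -lerBlDl; apply: le_trans (ler_norm _) _.
  apply: (sm_mixing h (k := hi n)) => //.
  - move=> w1 w2 w' e; suff UE : U w1 = U w2 by rewrite /F UE.
    rewrite /U; apply: eq_big_nat => j /andP[_ jn]; apply: dep => s /andP[_ sj].
    apply: e; apply: ltnW; apply: leq_trans sj _.
    rewrite ltnS in jn; elim: n jn {U F F01 step} => [|k IH].
      by rewrite leqn0 => /eqP ->.
    rewrite leq_eqVlt => /predU1P[->//|/IH /leq_trans]; apply.
    by apply: leq_trans (lohi _); apply: leq_trans (sep _); exact: leq_addr.
  - move=> w w1 w2 e; suff XE : X n.+1 w1 = X n.+1 w2 by rewrite /F XE.
    apply: dep => s /andP[sn _]; apply: e; exact: leq_trans (sep _) sn.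
have -> : Ex mu (fun w => Num.min 1 (expR (t * (\sum_(0 <= j < n.+1) X j w - u)) *
    Lam ^+ r)) = Ex mu (fun w => F w w).
  by apply: eq_Ex => w; rewrite big_nat_recr.
apply: le_trans mix _.
apply: le_trans (lerD (le_Ex mu_ge0 step) (lexx _)) _.
apply: le_trans (lerD (IH r.+1) (lexx _)) _.
rewrite addnS addSn -[n.+1%:R]natr1; lra.
Qed.

(** Sums of separated blocks behave, up to the mixing error, as sums of
independent blocks: the Chernoff bound is truncated at one, so that replacing
one block by an independent copy costs a mixing coefficient and not a
coefficient multiplied by an exponential. *)
Lemma decoupled_tail D (X : nat -> W -> R) (lo hi : nat -> nat) A t u Lam n :
  ok D -> (0 < A)%N -> 0 < t -> 0 <= Lam ->
  (forall j w1 w2, (forall s, (lo j <= s < hi j)%N -> D s w1 = D s w2) ->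
     X j w1 = X j w2) ->
  (forall j, hi j + A <= lo j.+1)%N -> (forall j, lo j <= hi j)%N ->
  (forall j, Ex mu (fun w => expR (t * X j w)) <= Lam) ->
  Pr mu (fun w => u <= \sum_(0 <= j < n) X j w)
    <= expR (- (t * u)) * Lam ^+ n + n%:R * (4 * expR (- (c * A%:R `^ g1))).
Proof.
move=> h A0 t0 L0 dep sep lohi mgf.
have := @decoupled_mgf D X lo hi A t u Lam n 0 h A0 t0 L0 dep sep lohi mgf.
rewrite addn0; apply: le_trans; apply: le_Ex => // w.
rewrite expr0 mulr1; case: (leP u _) => hu /=.
  rewrite le_min lexx /= -expR0 ler_expR.
  by apply: mulr_ge0; [exact: ltW | rewrite subr_ge0].
by rewrite le_min ler01 expR_ge0.
Qed.

Lemma csum_blocks D A q w :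
  csum mu D (q * A) w =
  \sum_(0 <= j < q) csum mu (fun s => D (j * A + s)%N) A w.
Proof.
elim: q => [|q IH]; first by rewrite mul0n /csum !big_geq.
rewrite big_nat_recr //= -IH mulSn addnC /csum.
rewrite (@big_cat_nat _ _ _ (q * A)%N) ?leq_addr //=; congr (_ + _).
rewrite -{1}[(q * A)%N]add0n big_addn addKn.
by apply: eq_bigr => s _; rewrite addnC.
Qed.

Lemma sum_double (F : nat -> R) q :
  \sum_(0 <= j < 2 * q) F j =
  \sum_(0 <= j < q) F (2 * j)%N + \sum_(0 <= j < q) F (2 * j).+1.
Proof.
elim: q => [|q IH]; first by rewrite !big_geq // addr0.
rewrite mulnS !big_nat_recr //= -[X in \sum_(0 <= i < X) _]/(2 * q)%N IH.
by ring.
Qed.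

(** A cap that is not exceeded changes no value but lowers the mean, so the
centred sum can only increase. *)
Lemma csum_le_cap_kill D M n q w : ok D -> (n <= q)%N -> 0 <= M ->
  (forall s, (s < n)%N -> D s w <= M) ->
  csum mu D n w <= csum mu (cap_kill D M n) q w.
Proof.
move=> h nq M0 DM; rewrite [leRHS]/csum (@big_cat_nat _ _ _ n) //=.
rewrite [X in _ + X]big1_seq ?addr0; last first.
  move=> s; rewrite mem_index_iota => /andP[_ /andP[ns _]].
  by rewrite /cap_kill ltnNge ns /= Ex0 subrr.
apply: ler_sum_nat => s /andP[_ sn].
rewrite /cap_kill sn; apply: lerB; first by rewrite le_min lexx DM.
by apply: le_Ex => // w'; rewrite ge_min lexx.
Qed.

(** Blocks of even index are separated by blocks of odd index, and
conversely; one of the two partial sums reaches [z / 2]. *)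
Lemma block_tail D A M t Lam n z : ok D -> (0 < A)%N -> 0 <= M -> 0 < t ->
  0 <= Lam ->
  (forall a, Ex mu (fun w => expR
     (t * csum mu (fun s => cap_kill D M n (a + s)%N) A w)) <= Lam) ->
  Pr mu (fun w => z <= csum mu D n w) <=
    n%:R * (2 * expR (- (b * M `^ th))) +
    (2 * (expR (- (t * z / 2)) * Lam ^+ (n %/ (2 * A)).+1) +
     2 * ((n %/ (2 * A)).+1%:R * (4 * expR (- (c * A%:R `^ g1))))).
Proof.
move=> h A0 M0 t0 L0 mgf.
set q := (n %/ (2 * A)).+1.
have nq : (n <= 2 * q * A)%N.
  by rewrite mulnAC mulnC ltnW // ltn_ceil // muln_gt0.
have h' : ok (cap_kill D M n) by exact: sm_cap_kill.
pose B j w := csum mu (fun s => cap_kill D M n (j * A + s)%N) A w.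
have depB j w1 w2 : (forall s, (j * A <= s < j * A + A)%N ->
    cap_kill D M n s w1 = cap_kill D M n s w2) -> B j w1 = B j w2.
  move=> e; rewrite /B /csum; apply: eq_big_nat => s /andP[_ sA].
  by rewrite e // leq_addr ltn_add2l.
have tailB (e : bool) :
    Pr mu (fun w => z / 2 <= \sum_(0 <= j < q) B (2 * j + e)%N w) <=
    expR (- (t * z / 2)) * Lam ^+ q + q%:R * (4 * expR (- (c * A%:R `^ g1))).
  rewrite -mulrA; apply: (@decoupled_tail (cap_kill D M n)
     (fun j => B (2 * j + e)%N)
     (fun j => (2 * j + e) * A)%N (fun j => (2 * j + e) * A + A)%N) => //.
  - by move=> j w1 w2; apply: depB.
  - by move=> j; rewrite mulnS add2n !addSn !mulSn -addnA addnC -addnA leqnn.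
  - by move=> j; apply: leq_addr.
  - by move=> j; apply: mgf.
have split w : z <= csum mu D n w ->
    has (fun s => M < `|D s w|) (iota 0 n) ||
    ((z / 2 <= \sum_(0 <= j < q) B (2 * j + false)%N w) ||
     (z / 2 <= \sum_(0 <= j < q) B (2 * j + true)%N w)).
  move=> zS; case: (boolP (has _ _)) => //= /hasPn noM.
  have := le_trans zS (csum_le_cap_kill h nq M0 _).
  have e0 : \sum_(0 <= j < q) B (2 * j + false)%N w = \sum_(0 <= j < q) B (2 * j)%N w.
    by apply: eq_bigr => j _; rewrite addn0.
  have e1 : \sum_(0 <= j < q) B (2 * j + true)%N w = \sum_(0 <= j < q) B (2 * j).+1 w.
    by apply: eq_bigr => j _; rewrite addn1.
  rewrite csum_blocks sum_double => H; apply: contraT; rewrite negb_or -!ltNge => /andP[h1 h2].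
  have : z <= \sum_(0 <= j < q) B (2 * j + false)%N w +
              \sum_(0 <= j < q) B (2 * j + true)%N w.
    rewrite e0 e1; apply: H => s sn; apply: le_trans (ler_norm _) _.
    by rewrite leNgt; apply: noM; rewrite mem_iota add0n.
  lra.
have T1 := le_PrU mu_ge0 (A := fun w => z <= csum mu D n w)
  (B := fun w => has (fun s => M < `|D s w|) (iota 0 n))
  (C := fun w => (z / 2 <= \sum_(0 <= j < q) B (2 * j + false)%N w) ||
     (z / 2 <= \sum_(0 <= j < q) B (2 * j + true)%N w)) split.
apply: (le_trans T1).
have T2 := le_PrU mu_ge0 (A := fun w => (z / 2 <= \sum_(0 <= j < q) B (2 * j + false)%N w) ||
     (z / 2 <= \sum_(0 <= j < q) B (2 * j + true)%N w)) (fun w => id).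
apply: lerD.
  apply: le_trans (le_Pr_has mu_ge0 n (fun s w => M < `|D s w|)) _.
  apply: le_trans (_ : \sum_(0 <= s < n) (2 * expR (- (b * M `^ th))) <= _).
    by apply: ler_sum => s _; apply: (sm_tail h).
  by rewrite big_const_nat subn0 iter_addr_0 -[_ *+ n]mulr_natl.
apply: le_trans T2 _; have := tailB false; have := tailB true; lra.
Qed.

(** As [A <= n], the blocks of one parity cover at most [2 * n] indices, so the
product of their Laplace transforms is sub-Gaussian with a variance proxy
proportional to [n]. *)
Lemma block_tail_gauss D A M t K n z : ok D -> (0 < A <= n)%N -> 0 <= M ->
  0 < t -> 0 <= K ->
  (forall a, Ex mu (fun w => expR
     (t * csum mu (fun s => cap_kill D M n (a + s)%N) A w))
       <= expR (K * t ^+ 2 * A%:R)) ->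
  Pr mu (fun w => z <= csum mu D n w) <=
    n%:R * (2 * expR (- (b * M `^ th)) + 16 * expR (- (c * A%:R `^ g1))) +
    2 * expR (2 * K * t ^+ 2 * n%:R - t * z / 2).
Proof.
move=> h /andP[A0 An] M0 t0 K0 mgf.
apply: le_trans (block_tail z h A0 M0 t0 (expR_ge0 _) mgf) _.
set q := (n %/ (2 * A)).+1.
have qA : (q * A <= 2 * n)%N.
  by rewrite mulSn; have := leq_divM n (2 * A)%N; rewrite mulnCA; lia.
have qn : (q <= 2 * n)%N by apply: leq_trans qA; rewrite leq_pmulr.
rewrite mulrDr -[leRHS]addrA; apply: lerD => //; rewrite addrC; apply: lerD; first last.
  have qn' : q%:R <= 2 * n%:R :> R by rewrite -natrM ler_nat.
  have := expR_ge0 (- (c * A%:R `^ g1)); move: (expR (- (c * _))) => e e0.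
  have := ler_wpM2l e0 qn'; lra.
apply: ler_wpM2l => //; rewrite -expRM_natr -expRD ler_expR addrC.
apply: lerB => //.
rewrite (_ : 2 * K * t ^+ 2 * n%:R = K * t ^+ 2 * (2 * n%:R)); last by ring.
have Kt : 0 <= K * t ^+ 2 by rewrite mulr_ge0 // exprn_ge0 // ltW.
rewrite -[leLHS]mulrA ler_wpM2l //.
by rewrite -!natrM ler_nat mulnC.
Qed.

End Blocks.

(** * Slicing the exponential *)

Section ExpEstimates.
Context {R : realType}.
Implicit Types x : R.

Lemma expR_le_quad x : x <= 1 -> expR x <= 1 + x + 2 * x ^+ 2.
Proof.
move=> x1.
have h : 0 < 1 - x / 2 by lra.
have e1 : 1 - x / 2 <= expR (- (x / 2)) by have := expR_ge1Dx (- (x / 2)).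
have e2 : (1 - x / 2) ^+ 2 <= expR (- x).
  have -> : - x = 2%:R * - (x / 2) by field.
  by rewrite expRM_natl lerXn2r ?nnegrE ?expR_ge0 // ltW.
have e3 : (1 - x / 2) ^+ 2 * expR x <= 1.
  apply: le_trans (ler_wpM2r (expR_ge0 x) e2) _.
  by rewrite mulrC expRxMexpNx_1.
have q0 : 0 < (1 - x / 2) ^+ 2 by rewrite exprn_gt0.
rewrite -(ler_pM2l q0); apply: le_trans e3 _.
have -> : (1 - x / 2) ^+ 2 * (1 + x + 2 * x ^+ 2) =
  1 + x ^+ 2 * ((1 - x) * (5 - 2 * x)) / 4 by field.
by rewrite lerDl divr_ge0 // mulr_ge0 ?sqr_ge0 // mulr_ge0; lra.
Qed.

Lemma expR1_le4 : expR 1 <= 4 :> R.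
Proof. by have := expR_le_quad (lexx 1); rewrite expr1n; lra. Qed.

Lemma sum_expRN n : \sum_(0 <= k < n) expR (- k.+1%:R) <= 1 :> R.
Proof.
suff H : \sum_(0 <= k < n) expR (- k.+1%:R) <= 1 - 2^-1 ^+ n :> R.
  by apply: le_trans H _; rewrite lerBlDr lerDl exprn_ge0.
elim: n => [|n IH]; first by rewrite big_geq // expr0 subrr.
rewrite big_nat_recr //=; apply: le_trans (lerD IH (lexx _)) _.
have : expR (- n.+1%:R) <= 2^-1 ^+ n.+1 :> R.
  rewrite -[n.+1%:R]mulr1 -mulrN expRM_natl lerXn2r ?nnegrE ?expR_ge0 //.
  rewrite expRN lef_pV2 ?posrE ?expR_gt0 //.
  by have := expR_ge1Dx (1 : R); lra.
rewrite exprS; lra.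
Qed.

(** Large values of the exponential are bounded level by level, so that only
tail probabilities of [x] at the integers enter. *)
Lemma expR_slices x n : x <= n%:R ->
  expR x <= 1 + x + 2 * x ^+ 2 +
    \sum_(0 <= k < n) expR k.+2%:R * (k.+1%:R <= x)%R%:R.
Proof.
move=> xn.
have S0 : 0 <= \sum_(0 <= k < n) expR k.+2%:R * (k.+1%:R <= x)%R%:R :> R.
  by apply: sumr_ge0 => k _; rewrite mulr_ge0 ?expR_ge0.
case: (leP x 1) => x1.
  by apply: le_trans (expR_le_quad x1) _; rewrite lerDl.
have x0 : 0 <= x by lra.
have [k kn kx] : exists2 k, (k < n)%N & k.+1%:R <= x <= k.+2%:R.
  have tx := truncn_itv x0; have t1 : (0 < Num.truncn x)%N.
    by rewrite truncn_ge_nat // ltW.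
  exists (Num.truncn x).-1; last by rewrite prednK //; case/andP: tx => -> /ltW ->.
  by rewrite prednK // -(ler_nat R) (le_trans _ xn) //; case/andP: tx.
apply: le_trans (_ : \sum_(0 <= k < n) expR k.+2%:R * (k.+1%:R <= x)%R%:R <= _); last first.
  by rewrite lerDr addr_ge0 ?mulr_ge0 ?sqr_ge0 //; lra.
rewrite (bigD1_seq k) ?mem_index_iota ?iota_uniq //=.
case/andP: kx => -> kx; rewrite mulr1 -[leLHS]addr0; apply: lerD.
  by rewrite ler_expR.
by apply: sumr_ge0 => i _; rewrite mulr_ge0 ?expR_ge0.
Qed.

(** The factor [X] on the right is what makes the sum over the slices of
second order in the Laplace parameter. *)
Lemma gauss_slice (X : R) n : 0 < X ->
  expR n.+2%:R * expR (- (n.+1%:R ^+ 2 / X)) <=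
  8 * X * expR (2 * X) * expR (- n.+1%:R).
Proof.
move=> X0; rewrite -[n.+2%:R]natr1.
have : 1 <= n.+1%:R :> R by rewrite ler1n.
move: (n.+1%:R : R) => k k1; have k0 : 0 < k by lra.
have h1 : 2 * k <= k ^+ 2 / (2 * X) + 2 * X.
  rewrite -lerBlDr ler_pdivlMr ?mulr_gt0 //.
  rewrite -subr_ge0 (_ : _ - _ = (k - 2 * X) ^+ 2) ?sqr_ge0 //; ring.
have h2 : expR (- (k ^+ 2 / (2 * X))) <= 2 * X.
  have p : 0 < k ^+ 2 / (2 * X) by rewrite divr_gt0 ?mulr_gt0 // exprn_gt0.
  rewrite expRN; apply: le_trans (_ : (k ^+ 2 / (2 * X))^-1 <= _).
    rewrite lef_pV2 ?posrE ?expR_gt0 //; apply: le_trans (expR_ge1Dx _).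
    by rewrite lerDr.
  rewrite invf_div ler_pdivrMr ?exprn_gt0 //.
  by rewrite ler_peMr ?exprn_ege1 // mulr_ge0 // ltW.
have -> : k ^+ 2 / X = k ^+ 2 / (2 * X) + k ^+ 2 / (2 * X).
  by field; rewrite gt_eqF.
rewrite opprD [expR (- _ - _)]expRD mulrA -expRD.
apply: le_trans (_ : expR (1 + 2 * X - k) * (2 * X) <= _).
  apply: ler_pM => //; rewrite ?expR_ge0 // ler_expR; lra.
rewrite !expRD (mulrC (expR 1)).
have := expR1_le4; have := expR_ge0 (2 * X); have := expR_ge0 (- k).
move: (expR 1) (expR (2 * X)) (expR (- k)) => u p q q0 p0 u4.
rewrite (_ : 8 * X * p * q = p * 4 * q * (2 * X)); last by ring.
apply: ler_wpM2r; first by rewrite mulr_ge0 // ltW.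
by rewrite ler_wpM2r // ler_wpM2l.
Qed.

End ExpEstimates.

(** * Laplace transforms of capped blocks *)

Section Laplace.
Context {R : realType} {W : finType} {mu : W -> R}.
Hypothesis mu_ge0 : forall w, 0 <= mu w.
Hypothesis mu1 : \sum_w mu w = 1.

(** The linear term of the exponential vanishes because [f] is centred, the
quadratic term is the variance, and the slices contribute a multiple of
[s ^+ 2 * V]. The bound [U] only makes the number of slices finite; the
estimate does not depend on it. *)
Lemma mgf_of_tail (f : W -> R) (s V Q K U v : R) :
  0 < s -> 0 < V -> 0 < K -> 0 <= Q ->
  Ex mu f = 0 -> (forall w, f w <= U) ->
  Ex mu (fun w => f w ^+ 2) <= v * V ->
  (forall k : nat, Pr mu (fun w => k.+1%:R / s <= f w) <=
     Q * s ^+ 2 * V * expR (- (4 * k.+1%:R)) +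
     2 * expR (- (k.+1%:R ^+ 2 / (32 * K * s ^+ 2 * V)))) ->
  Ex mu (fun w => expR (s * f w)) <=
    expR ((2 * v + Q + 576 * K) * s ^+ 2 * V).
Proof.
move=> s0 V0 K0 Q0 f0 fU fv tail.
set X := 32 * K * s ^+ 2 * V.
have X0 : 0 < X by rewrite /X !mulr_gt0 // exprn_gt0.
have sV : 0 < s ^+ 2 * V by rewrite mulr_gt0 // exprn_gt0.
pose n := (Num.truncn (Num.max 0 (s * U))).+1.
have bnd w : s * f w <= n%:R.
  apply: le_trans (ler_wpM2l (ltW s0) (fU w)) _.
  apply: le_trans (_ : Num.max 0 (s * U) <= _); first by rewrite le_max lexx orbT.
  by rewrite ltW // truncnS_gt.
apply: le_trans (le_Ex mu_ge0 (fun w => expR_slices (bnd w))) _.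
rewrite 2!ExD ExD ExZ ExZ Ex_cst // f0 mulr0 addr0 Ex_sum.
under [X in _ + X <= _]eq_bigr do rewrite ExZ.
have E2 : Ex mu (fun w => (s * f w) ^+ 2) = s ^+ 2 * Ex mu (fun w => f w ^+ 2).
  by rewrite -ExZ; apply: eq_Ex => w; rewrite exprMn.
rewrite E2.
have T k : expR k.+2%:R * Ex mu (fun w => (k.+1%:R <= s * f w)%R%:R) <=
   (Q * (s ^+ 2 * V) + 16 * X * expR (2 * X)) * expR (- k.+1%:R).
  have -> : Ex mu (fun w => (k.+1%:R <= s * f w)%R%:R) =
            Pr mu (fun w => k.+1%:R / s <= f w).
    by apply: eq_Ex => w; rewrite ler_pdivrMr // (mulrC s).
  apply: le_trans (ler_wpM2l (expR_ge0 _) (tail k)) _.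
  rewrite mulrDr [leRHS]mulrDl; apply: lerD.
    have e : expR k.+2%:R * expR (- (4 * k.+1%:R)) <= expR (- k.+1%:R) :> R.
      rewrite -expRD ler_expR -[k.+2%:R]natr1.
      have : 1 <= k.+1%:R :> R by rewrite ler1n.
      by lra.
    have := ler_wpM2l (mulr_ge0 Q0 (ltW sV)) e; lra.
  have := gauss_slice k X0; rewrite -/X.
  move: (expR k.+2%:R) (expR (- (_ / X))) (expR (2 * X)) (expR (- k.+1%:R)).
  by move=> x y z t; lra.
have S : \sum_(0 <= k < n) expR k.+2%:R * Ex mu (fun w => (k.+1%:R <= s * f w)%R%:R)
   <= Q * (s ^+ 2 * V) + 16 * X * expR (2 * X).
  apply: le_trans (ler_sum _ (fun k _ => T k)) _.
  rewrite -mulr_sumr -[leRHS]mulr1 ler_wpM2l ?sum_expRN //.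
  by rewrite addr_ge0 ?mulr_ge0 ?expR_ge0 // ltW.
apply: le_trans (_ : 1 + (2 * v + Q) * (s ^+ 2 * V) + 16 * X * expR (2 * X) <= _).
  have := ler_wpM2l (ltW (exprn_gt0 2 s0)) fv; lra.
have b1 : 1 <= expR (2 * X) by rewrite -expR0 ler_expR mulr_ge0 // ltW.
have v0 : 0 <= v.
  rewrite -(pmulr_lge0 _ V0); apply: le_trans fv; apply: Ex_ge0 => // w.
  exact: sqr_ge0.
set a := (2 * v + Q) * (s ^+ 2 * V).
have a0 : 0 <= a by rewrite mulr_ge0 ?(ltW sV) // addr_ge0 // mulr_ge0.
apply: le_trans (_ : (1 + (a + 16 * X)) * expR (2 * X) <= _).
  have := ler_wpM2l a0 b1; lra.
have -> : (2 * v + Q + 576 * K) * s ^+ 2 * V = (a + 16 * X) + 2 * X.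
  by rewrite /a /X; ring.
rewrite expRD ler_wpM2r ?expR_ge0 //; exact: expR_ge1Dx.
Qed.

End Laplace.

Lemma gauss_exponent (R : realType) (K t t' z lz k a : R) :
  0 <= lz -> 1 <= k -> k <= t * z -> 0 <= z -> 0 <= t' ->
  t * (16 + 8 * lz) <= t' -> t' * (8 * K * a) <= z ->
  2 * K * t' ^+ 2 * a - t' * z / 2 <= - (2 * lz) + - (4 * k).
Proof.
move=> lz0 k1 ktz z0 t'0 tt' tz.
have h1 := ler_wpM2l t'0 tz.
have h2 := ler_wpM2r z0 tt'.
have h4 : 0 <= (16 + 8 * lz) * (t * z - k).
  by rewrite mulr_ge0 ?subr_ge0 // addr_ge0 ?mulr_ge0.
have h5 : 0 <= lz * (k - 1) by rewrite mulr_ge0 // subr_ge0.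
lra.
Qed.

Lemma block_errors (R : realType) (a e1 e2 e g h : R) : 0 <= a ->
  e1 <= e -> e2 <= e -> g <= 2 * (a * e) + h ->
  a * (2 * e1 + 16 * e2) + g <= 20 * (a * e) + h.
Proof. by move=> a0 /(ler_wpM2l a0) h1 /(ler_wpM2l a0) h2 h3; lra. Qed.

Section LaplaceStep.
Context {R : realType}.
Variables (c g1 b th m : R).
Context {W : finType} {mu : W -> R}.
Hypothesis mu_ge0 : forall w, 0 <= mu w.
Hypothesis mu1 : \sum_w mu w = 1.
Hypothesis m0 : 0 <= m.
Notation ok := (subweibull_mixing c g1 b th m mu).
Variables (g : R) (v : R).
Hypothesis g_lt1 : g < 1.
Hypothesis g_gt0 : 0 < g.
Hypothesis variance : forall D n, ok D ->
  Ex mu (fun w => csum mu D n w ^+ 2) <= v * n%:R.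

Definition stretched (G B : R) n := forall D, ok D -> forall y : R, 0 < y ->
  n%:R <= y `^ (2 - g) ->
  Pr mu (fun w => y <= csum mu D n w)
    <= B * (n%:R / y ^+ 2) * expR (- (y `^ g / G)).

(** For summands with heavy tails a sub-Gaussian Laplace transform is
only possible below a cap [M] and for parameters up to some [t]. *)
Definition subgauss A (M t K : R) := forall D, ok D ->
  (forall s w, D s w <= M) -> forall s : R, 0 < s <= t ->
  Ex mu (fun w => expR (s * csum mu D A w)) <= expR (K * s ^+ 2 * A%:R).

(** The stretched exponential tail of blocks of length [A] applies to the
deviations [z >= A `^ (2 - g)^-1], and the smallness of [t] makes its exponent
[z `^ g / G] at least [4 * s * z] up to the maximal value of the capped sum.
What remains to be supplied is a bound for the smaller deviations. *)
Lemma subgauss_of_middle (G B Q : R) A (M t K : R) : 0 < G -> 0 <= B -> 0 <= Q -> 0 < K ->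
  (0 < A)%N -> 0 <= M -> stretched G B A ->
  4 * G * t * (A%:R * (M + (1 + m))) `^ (1 - g) <= 1 ->
  (forall D, ok D -> forall (s : R) (k : nat), 0 < s <= t ->
     k.+1%:R / s < A%:R `^ (2 - g)^-1 ->
     Pr mu (fun w => k.+1%:R / s <= csum mu D A w) <=
     Q * s ^+ 2 * A%:R * expR (- (4 * k.+1%:R)) +
     2 * expR (- (k.+1%:R ^+ 2 / (32 * K * s ^+ 2 * A%:R)))) ->
  subgauss A M t (2 * v + (B + Q) + 576 * K).
Proof.
have [m0' gl1 gg0] := And3 m0 g_lt1 g_gt0.
move=> G0 B0 Q0 K0 A0 M0 st small middle D h DM s /andP[s0 st'].
have Ap : 0 < A%:R :> R by rewrite ltr0n.
have M1 : 0 < M + (1 + m) by lra.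
set U : R := A%:R * (M + (1 + m)) in small.
have U0 : 0 < U by rewrite mulr_gt0.
apply: (@mgf_of_tail _ _ _ mu_ge0 mu1 _ s A%:R (B + Q) K U) => //;
  rewrite ?addr_ge0 //.
- exact: Ex_csum.
- exact: (csum_le_cap mu_ge0 mu1 A M0 h DM).
- exact: variance.
move=> k; set z : R := k.+1%:R / s.
have k1 : 1 <= k.+1%:R :> R by rewrite ler1n.
have z0 : 0 < z by rewrite divr_gt0.
have sA : 0 <= s ^+ 2 * A%:R * expR (- (4 * k.+1%:R)).
  by rewrite !mulr_ge0 ?expR_ge0 ?exprn_ge0 // ltW.
have e0 : 0 <= 2 * expR (- (k.+1%:R ^+ 2 / (32 * K * s ^+ 2 * A%:R))).
  by rewrite mulr_ge0 ?expR_ge0.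
have BsA := mulr_ge0 B0 sA; have QsA := mulr_ge0 Q0 sA.
case: (ltP z (A%:R `^ (2 - g)^-1)) => hz.
  by apply: le_trans (middle D h s k _ hz) _; rewrite ?s0 //; lra.
case: (ltP U z) => zU.
  rewrite (_ : Pr _ _ = 0); first by lra.
  rewrite -(Ex0 mu); apply: eq_Ex => w.
  by rewrite leNgt (le_lt_trans (csum_le_cap mu_ge0 mu1 A M0 h DM w) zU).
have Az : A%:R <= z `^ (2 - g).
  have e : A%:R = (A%:R `^ (2 - g)^-1) `^ (2 - g) :> R.
    by rewrite -powRrM mulVf ?powRr1 ?ltW // gt_eqF //; lra.
  by rewrite e; apply: ge0_ler_powR; rewrite ?nnegrE ?powR_ge0 //; lra.
apply: le_trans (st D h z z0 Az) _.
have E : A%:R / z ^+ 2 <= s ^+ 2 * A%:R.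
  have kp : 0 < k.+1%:R ^+ 2 :> R by rewrite exprn_gt0.
  rewrite /z expr_div_n invf_div mulrA (mulrC _ (s ^+ 2)) ler_pdivrMr //.
  by rewrite ler_peMr ?exprn_ege1 // mulr_ge0 ?exprn_ge0 // ltW.
have F : expR (- (z `^ g / G)) <= expR (- (4 * k.+1%:R)).
  rewrite ler_expR lerN2 ler_pdivlMr //.
  have -> : k.+1%:R = s * z by rewrite /z mulrC divfK // gt_eqF.
  have -> : z `^ g = z / z `^ (1 - g).
    rewrite -{1}(subKr 1 g) powRB; last by apply/implyP => _; rewrite gt_eqF.
    by rewrite powRr1 // ltW.
  rewrite ler_pdivlMr ?powR_gt0 //.
  have H : z `^ (1 - g) <= U `^ (1 - g).
    by apply: ge0_ler_powR; rewrite ?nnegrE //; lra.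
  have H2 : 4 * G * s * z `^ (1 - g) <= 1.
    apply: le_trans small; apply: ler_pM => //; rewrite ?powR_ge0 ?mulr_ge0 ?(ltW G0) ?(ltW s0) //.
    by rewrite ler_wpM2l // mulr_ge0 // ltW.
  have := ler_wpM2l (ltW z0) H2; lra.
have P0 : 0 <= A%:R / z ^+ 2 by rewrite divr_ge0 ?ler0n ?exprn_ge0 // ltW.
have := ler_pM (mulr_ge0 B0 P0) (expR_ge0 _) (ler_wpM2l B0 E) F; lra.
Qed.

(** No deviation [k / s] with [k >= 1] and [s <= t] is below the threshold
[A `^ (2 - g)^-1]. *)
Lemma subgauss_base (G B : R) A (M t : R) : 0 < G -> 0 <= B ->
  (0 < A)%N -> 0 <= M -> stretched G B A ->
  4 * G * t * (A%:R * (M + (1 + m))) `^ (1 - g) <= 1 ->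
  t * A%:R `^ (2 - g)^-1 <= 1 ->
  subgauss A M t (2 * v + B + 576).
Proof.
move=> G0 B0 A0 M0 st small base.
have -> : 2 * v + B + 576 = 2 * v + (B + 0) + 576 * 1 by lra.
apply: (subgauss_of_middle G0) => // D h s k /andP[s0 st'] kz.
exfalso; move: kz; rewrite ltNge => /negP; apply.
rewrite ler_pdivlMr //; apply: le_trans (_ : 1 <= _); last by rewrite ler1n.
by apply: le_trans base; rewrite mulrC ler_wpM2r ?powR_ge0.
Qed.

(** The deviations below the threshold [z0] are estimated with blocks of
length [A'] capped at [M']. The condition on [b * M' `^ th] and
[c * A'%:R `^ g1] makes the truncation and mixing errors at most
[s ^+ 2 * expR (- (4 * k.+1))] for every such deviation [k.+1 / s]. *)
Lemma subgauss_step (G B : R) A (M t : R) A' (M' t' K : R) : 0 < G -> 0 <= B -> 0 < K ->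
  (0 < A' <= A)%N -> 0 <= M -> 0 <= M' -> stretched G B A ->
  4 * G * t * (A%:R * (M + (1 + m))) `^ (1 - g) <= 1 ->
  let z0 : R := A%:R `^ (2 - g)^-1 in
  4 * t * z0 + 2 * ln z0 <= b * M' `^ th ->
  4 * t * z0 + 2 * ln z0 <= c * A'%:R `^ g1 ->
  t * (16 + 8 * ln z0) <= t' ->
  subgauss A' M' t' K ->
  subgauss A M t (2 * v + (B + 20) + 576 * K).
Proof.
have [m0' gl1 gg0] := And3 m0 g_lt1 g_gt0.
move=> G0 B0 K0 /andP[A'0 A'A] M0 M'0 st small z0 bM cA tt' sub.
have A0 : (0 < A)%N by exact: leq_trans A'A.
have Ap : 1 <= A%:R :> R by rewrite ler1n.
have z01 : 1 <= z0.
  rewrite -[1](powRr0 (A%:R : R)) /z0; apply: ler_powR => //.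
  by rewrite invr_ge0; lra.
have lz0 : 0 <= ln z0 by exact: ln_ge0.
apply: (subgauss_of_middle G0) => // D h s k /andP[s0 st'] kz.
set z : R := k.+1%:R / s.
have k1 : 1 <= k.+1%:R :> R by rewrite ler1n.
have zp : 0 < z by rewrite divr_gt0 //; lra.
have szk : s * z = k.+1%:R by rewrite /z mulrC divfK // gt_eqF.
have iz0 : expR (- (2 * ln z0)) <= s ^+ 2.
  have -> : - (2 * ln z0) = 2%:R * - ln z0 by ring.
  have zp0 : 0 < z0 by lra.
  rewrite expRM_natl expRN lnK ?posrE //.
  rewrite lerXn2r ?nnegrE ?invr_ge0 ?(ltW s0) ?(ltW zp0) //.
  rewrite -[leLHS]mul1r ler_pdivrMr // mulrC -ler_pdivrMr //.
  apply: ltW; apply: le_lt_trans kz.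
  by rewrite ler_pdivrMr // divfK ?gt_eqF.
have sz : k.+1%:R <= t * z0.
  rewrite -szk; apply: ler_pM => //; rewrite ltW //.
have mixE q : 4 * t * z0 + 2 * ln z0 <= q ->
    expR (- q) <= s ^+ 2 * expR (- (4 * k.+1%:R)).
  move=> hq; apply: le_trans (_ : expR (- (2 * ln z0)) * expR (- (4 * k.+1%:R)) <= _).
    by rewrite -expRD ler_expR; lra.
  by rewrite ler_wpM2r ?expR_ge0.
have K1 := mixE _ bM; have K2 := mixE _ cA.
have tp : 0 < t by lra.
have t'0 : 0 < t'.
  apply: lt_le_trans tt'; rewrite mulr_gt0 //; lra.
have A1 : 0 < 8 * K * A%:R by rewrite mulr_gt0 ?mulr_gt0 //; lra.
(* [z / (8 * K * A)] optimises the Chernoff bound; if it exceeds the admissible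
range, then [t'] itself makes the bound as small as the error terms. *)
pose t2 := Num.min t' (z / (8 * K * A%:R)).
have t20 : 0 < t2 by rewrite lt_min t'0 divr_gt0.
have block := @block_tail_gauss R c g1 b th m W mu mu_ge0 mu1 D A' M' t2 K A z
  h _ M'0 t20 (ltW K0) _.
apply: le_trans (block _ _) _; rewrite ?A'0 //.
  move=> a; apply: sub.
  - by apply: sm_shift; apply: sm_cap_kill.
  - move=> j w; rewrite /cap_kill; case: ifP => // _; by rewrite ge_min lexx orbT.
  - by rewrite t20 /= ge_min lexx.
have s2e : 0 <= s ^+ 2 * expR (- (4 * k.+1%:R)).
  by rewrite mulr_ge0 ?expR_ge0 // exprn_ge0 // ltW.
have gauss : 2 * expR (2 * K * t2 ^+ 2 * A%:R - t2 * z / 2) <=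
   2 * (A%:R * (s ^+ 2 * expR (- (4 * k.+1%:R)))) +
   2 * expR (- (k.+1%:R ^+ 2 / (32 * K * s ^+ 2 * A%:R))).
  rewrite /t2; case: (leP t' (z / (8 * K * A%:R))) => ht.
    rewrite ler_wpDr ?mulr_ge0 ?expR_ge0 // ler_wpM2l //.
    apply: le_trans (_ : s ^+ 2 * expR (- (4 * k.+1%:R)) <= _); last first.
      by rewrite ler_peMl.
    apply: le_trans (_ : expR (- (2 * ln z0)) * expR (- (4 * k.+1%:R)) <= _); last first.
      by rewrite ler_wpM2r ?expR_ge0.
    rewrite -expRD ler_expR.
    rewrite ler_pdivlMr // in ht.
    apply: (gauss_exponent lz0 k1 _ (ltW zp) (ltW t'0) tt' ht).
    by rewrite -szk ler_wpM2r // ltW.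
  apply: ler_wpDl; first by rewrite mulr_ge0 // mulr_ge0.
  rewrite ler_wpM2l // ler_expR le_eqVlt; apply/orP; left; apply/eqP.
  have Ap0 : 0 < A%:R :> R by rewrite ltr0n.
  by rewrite -szk; field; rewrite !gt_eqF.
have -> : 20 * s ^+ 2 * A%:R * expR (- (4 * k.+1%:R)) =
    20 * (A%:R * (s ^+ 2 * expR (- (4 * k.+1%:R)))) by ring.
exact: (block_errors (ler0n _ A) K1 K2 gauss).
Qed.

End LaplaceStep.

(** * Scales of block lengths, caps and parameters *)

Section Eventually.
Context {R : realType}.

Lemma ln_le_powR (a x : R) : 0 < a -> 0 < x -> ln x <= a^-1 * x `^ a.
Proof.
move=> a0 x0; rewrite mulrC ler_pdivlMr // mulrC -ln_powR ltW //.
by apply: ln_sublinear; rewrite powR_gt0.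
Qed.

Lemma eventually_log_le (C a : R) : 0 <= C -> 0 < a ->
  exists2 x0 : R, 1 <= x0 & forall x : R, x0 <= x -> C * (1 + ln x) <= x `^ a.
Proof.
move=> C0 a0; pose B : R := C * (1 + 2 / a) + 1.
have B1 : 1 <= B by rewrite lerDr mulr_ge0 // addr_ge0 // divr_ge0 // ltW.
have a2 : 0 < a / 2 by rewrite divr_gt0.
exists (B `^ (a / 2)^-1) => [|x hx].
  rewrite -[leLHS](powRr0 B); apply: ler_powR => //.
  by rewrite invr_ge0 ltW.
have x1 : 1 <= x.
  apply: le_trans hx; rewrite -[leLHS](powRr0 B); apply: ler_powR => //.
  by rewrite invr_ge0 ltW.
have x0 : 0 < x by lra.
have Bx : B <= x `^ (a / 2).
  have -> : B = (B `^ (a / 2)^-1) `^ (a / 2).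
    by rewrite -powRrM mulVf ?powRr1 ?gt_eqF //; lra.
  by apply: ge0_ler_powR; rewrite ?nnegrE ?powR_ge0 ?(ltW a2) ?(ltW x0).
have hl := ln_le_powR a2 x0.
have -> : x `^ a = x `^ (a / 2) * x `^ (a / 2).
  rewrite -powRD; first by rewrite -splitr.
  by apply/implyP => _; rewrite gt_eqF.
rewrite invf_div in hl.
move: (x `^ (a / 2)) Bx hl => u Bu hl.
have u1 : 1 <= u by lra.
apply: le_trans (_ : C * (1 + 2 / a) * u <= _).
  rewrite -mulrA; apply: ler_wpM2l => //; lra.
by apply: ler_wpM2r; [lra|rewrite /B in Bu; lra].
Qed.

Lemma eventually_powRN_le (a e : R) : 0 < a -> 0 < e ->
  exists2 x0 : R, 1 <= x0 & forall x : R, x0 <= x -> x `^ (- a) <= e.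
Proof.
move=> a0 e0; have ei : 0 < e^-1 by rewrite invr_gt0.
exists (Num.max 1 (e^-1 `^ a^-1)) => [|x]; first by rewrite le_max lexx.
rewrite ge_max => /andP[x1 hx].
have x0 : 0 < x by lra.
rewrite powRN -[e]invrK lef_pV2 ?posrE ?powR_gt0 //.
have -> : e^-1 = (e^-1 `^ a^-1) `^ a.
  by rewrite -powRrM mulVf ?gt_eqF // powRr1 // ltW.
by apply: ge0_ler_powR; rewrite ?nnegrE ?powR_ge0 // ltW.
Qed.

End Eventually.

Section Scales.
Context {R : realType}.
Variables (c g1 b th m : R) (J : nat) (nu : R).
Hypotheses (c0 : 0 < c) (g10 : 0 < g1) (b0 : 0 < b) (th0 : 0 < th) (m0 : 0 <= m).
Definition tail_exp : R := (g1^-1 + th^-1)^-1.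
Local Notation g := tail_exp.
Hypothesis (g_lt1 : g < 1) (J0 : (0 < J)%N).

(** At scale [i] the truncation and mixing errors are both
[expR (- l `^ scale_exp i)], with the shortest length and the lowest cap that
achieve this; the parameter [scale_par] gains a factor [l `^ nu] per scale to
absorb logarithms. *)
Definition scale_exp (i : nat) : R := 1 - i%:R / J%:R.
Definition scale_len (l : R) i : nat :=
  (Num.truncn ((l `^ scale_exp i / c) `^ g1^-1)).+1.
Definition scale_cap (l : R) i : R := (l `^ scale_exp i / b) `^ th^-1.
Definition scale_par (y l : R) (i : nat) : R := 8 * l `^ (1 + i%:R * nu) / y.

Definition len_cst : R := c^-1 `^ g1^-1 + 1.
Definition cap_cst : R := b^-1 `^ th^-1 + (1 + m).
Local Notation kA := len_cst.
Local Notation kM := cap_cst.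

Lemma scale_exp_ge0 i : (i <= J)%N -> 0 <= scale_exp i.
Proof.
by move=> iJ; rewrite subr_ge0 ler_pdivrMr ?ltr0n // mul1r ler_nat.
Qed.

Lemma scale_exp_le1 i : scale_exp i <= 1.
Proof. by rewrite lerBlDr lerDl divr_ge0. Qed.

Lemma scale_exp_le i j : (i <= j)%N -> scale_exp j <= scale_exp i.
Proof. by move=> ij; rewrite lerD2l lerN2 ler_pM2r ?invr_gt0 ?ltr0n // ler_nat. Qed.

Lemma scale_exp_last i : (i < J)%N -> J%:R^-1 <= scale_exp i.
Proof.
move=> iJ; rewrite lerBrDr -[X in X + _]mul1r -mulrDl ler_pdivrMr ?ltr0n //.
by rewrite mul1r addrC natr1 ler_nat.
Qed.

Lemma scale_capE l i : 0 <= l -> b * scale_cap l i `^ th = l `^ scale_exp i.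
Proof.
move=> l0; rewrite /scale_cap -powRrM mulVf ?gt_eqF // powRr1.
  by rewrite mulrC divfK // gt_eqF.
by rewrite divr_ge0 ?powR_ge0 // ltW.
Qed.

Lemma scale_lenE l i : 0 <= l -> l `^ scale_exp i <= c * (scale_len l i)%:R `^ g1.
Proof.
move=> l0; rewrite -ler_pdivrMl // mulrC.
have -> : l `^ scale_exp i / c = ((l `^ scale_exp i / c) `^ g1^-1) `^ g1.
  rewrite -powRrM mulVf ?gt_eqF // powRr1 //.
  by rewrite divr_ge0 ?powR_ge0 // ltW.
apply: ge0_ler_powR; rewrite ?nnegrE ?powR_ge0 ?ler0n //; first exact: ltW.
by apply: ltW; apply: truncnS_gt.
Qed.

Lemma scale_len_le l i : 1 <= l -> (i <= J)%N ->
  (scale_len l i)%:R <= kA * l `^ (scale_exp i / g1).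
Proof.
move=> l1 iJ; rewrite /len_cst mulrDl mul1r /scale_len -natr1; apply: lerD.
  apply: le_trans (_ : (l `^ scale_exp i / c) `^ g1^-1 <= _).
    by rewrite truncn_le powR_ge0.
  by rewrite mulrC powRM ?powR_ge0 ?invr_ge0 ?(ltW c0) // -powRrM.
rewrite -[X in X <= _](powRr0 l); apply: ler_powR => //.
by rewrite divr_ge0 ?scale_exp_ge0 // ltW.
Qed.

Lemma scale_cap_le l i : 1 <= l -> (i <= J)%N ->
  scale_cap l i + (1 + m) <= kM * l `^ (scale_exp i / th).
Proof.
move=> l1 iJ; rewrite /cap_cst mulrDl /scale_cap; apply: lerD.
  by rewrite powRM ?powR_ge0 ?invr_ge0 ?(ltW b0) // -powRrM mulrC.
rewrite ler_peMr ?addr_ge0 //.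
rewrite -[X in X <= _](powRr0 l); apply: ler_powR => //.
by rewrite divr_ge0 ?scale_exp_ge0 // ltW.
Qed.

Lemma scale_len_mono l i j : 1 <= l -> (i <= j)%N ->
  (scale_len l j <= scale_len l i)%N.
Proof.
move=> l1 ij; rewrite ltnS; apply: le_truncn.
apply: ge0_ler_powR; rewrite ?nnegrE ?invr_ge0 ?divr_ge0 ?powR_ge0 ?(ltW c0) ?(ltW g10) //.
rewrite ler_pM2r ?invr_gt0 //; apply: ler_powR => //.
exact: scale_exp_le.
Qed.

(** The threshold [A `^ (2 - g)^-1] at scale [i] is of order
[l `^ (thr_exp * scale_exp i)]. *)
Definition thr_exp : R := ((2 - g) * g1)^-1.
Definition thr_cst : R := kA `^ (2 - g)^-1.
Local Notation p1 := thr_exp.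
Local Notation kU := (kA * kM).
Local Notation kz := thr_cst.

Lemma scale_gamma_gt0 : 0 < g.
Proof. by rewrite invr_gt0 addr_gt0 ?invr_gt0. Qed.

Lemma scale_size_le l i : 1 <= l -> (i <= J)%N ->
  (scale_len l i)%:R * (scale_cap l i + (1 + m)) <= kU * l `^ (scale_exp i / g).
Proof.
move=> l1 iJ.
have -> : scale_exp i / g = scale_exp i / g1 + scale_exp i / th.
  by rewrite /tail_exp invrK mulrDr.
rewrite powRD; last by apply/implyP => _; rewrite gt_eqF //; lra.
rewrite mulrACA; apply: ler_pM.
- exact: ler0n.
- by rewrite addr_ge0 ?powR_ge0 // addr_ge0.
- exact: scale_len_le.
- exact: scale_cap_le.
Qed.

Section Fixed.
Variables (G l om : R).
Hypotheses (G1 : 1 <= G) (l1 : 1 <= l).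
Let y : R := G `^ om * l `^ g^-1.
Let z i : R := (scale_len l i)%:R `^ (2 - g)^-1.

Lemma scale_parE i :
  scale_par y l i = 8 * G `^ (- om) * l `^ (1 - g^-1 + i%:R * nu).
Proof.
have G0 : 0 < G by exact: lt_le_trans G1.
have l0 : 0 < l by exact: lt_le_trans l1.
rewrite /scale_par /y invfM -!powRN.
rewrite (_ : 1 - g^-1 + i%:R * nu = (1 + i%:R * nu) + - g^-1); last by ring.
rewrite [in RHS]powRD; last by apply/implyP => _; rewrite gt_eqF.
by ring.
Qed.

Lemma scale_par_ge0 i : 0 <= scale_par y l i.
Proof. by rewrite scale_parE !mulr_ge0 ?powR_ge0. Qed.

(** In powers of [l] the left side is
[1 - g^-1 + i * nu + (1 - i / J) * (g^-1 - 1)], which the bound on [nu] makes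
nonpositive: the exponent of the capped size decreases faster along the scales
than the exponent of the parameter grows. *)
Lemma scale_small i : (i <= J)%N -> nu <= (g^-1 - 1) / J%:R ->
  4 * G * scale_par y l i *
    ((scale_len l i)%:R * (scale_cap l i + (1 + m))) `^ (1 - g)
  <= 32 * kU `^ (1 - g) * G `^ (1 - om).
Proof.
move=> iJ hnu; have gl := g_lt1; have gp := scale_gamma_gt0.
have G0 : 0 < G by exact: lt_le_trans G1.
have l0 : 0 < l by exact: lt_le_trans l1.
have kU0 : 0 <= kU by rewrite mulr_ge0 // addr_ge0 ?powR_ge0 ?addr_ge0.
apply: le_trans (_ : 4 * G * scale_par y l i * (kU * l `^ (scale_exp i / g)) `^ (1 - g) <= _).
  apply: ler_wpM2l.
    by apply: mulr_ge0 (scale_par_ge0 i); rewrite mulr_ge0 // ltW.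
  apply: ge0_ler_powR; rewrite ?nnegrE.
  - by rewrite subr_ge0 ltW.
  - by rewrite mulr_ge0 // addr_ge0 ?powR_ge0 // addr_ge0.
  - by rewrite mulr_ge0 ?powR_ge0.
  - exact: scale_size_le.
rewrite powRM ?powR_ge0 // scale_parE -powRrM.
rewrite (_ : G `^ (1 - om) = G * G `^ (- om)); last first.
  rewrite powRD; last by apply/implyP => _; rewrite gt_eqF.
  by rewrite powRr1 // ltW.
have E : l `^ (1 - g^-1 + i%:R * nu) * l `^ (scale_exp i / g * (1 - g)) <= 1.
  rewrite -powRD; last by apply/implyP => _; rewrite gt_eqF.
  rewrite -[leRHS](powRr0 l); apply: ler_powR => //.
  have -> : scale_exp i / g * (1 - g) = (1 - i%:R / J%:R) * (g^-1 - 1).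
    by rewrite /scale_exp; field; rewrite !gt_eqF ?ltr0n.
  have := ler_wpM2l (ler0n R i) hnu; lra.
have F : 0 <= 32 * kU `^ (1 - g) * (G * G `^ (- om)).
  by rewrite !mulr_ge0 ?powR_ge0 ?(ltW G0).
have := ler_wpM2l F E; lra.
Qed.

Lemma scale_thr_le i : (i <= J)%N -> z i <= kz * l `^ (p1 * scale_exp i).
Proof.
move=> iJ; have gl := g_lt1.
have kA0 : 0 <= kA by rewrite addr_ge0 ?powR_ge0.
have -> : p1 * scale_exp i = scale_exp i / g1 * (2 - g)^-1.
  by rewrite /thr_exp; field; rewrite !gt_eqF //; lra.
rewrite powRrM /thr_cst /z -powRM ?powR_ge0 //.
apply: ge0_ler_powR; rewrite ?nnegrE.
- by rewrite invr_ge0; lra.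
- exact: ler0n.
- by rewrite mulr_ge0 ?powR_ge0.
- exact: scale_len_le.
Qed.

Lemma scale_thr_ge1 i : 1 <= z i.
Proof.
have gl := g_lt1.
rewrite /z -[leLHS](powRr0 ((scale_len l i)%:R : R)).
by apply: ler_powR; rewrite ?ler1n // invr_ge0; lra.
Qed.

Lemma scale_ln_thr_le i : (i <= J)%N -> ln (z i) <= ln kz + p1 * ln l.
Proof.
move=> iJ; have gl := g_lt1.
have l0 : 0 < l by exact: lt_le_trans l1.
have z1 := scale_thr_ge1 i; have kz0 : 0 < kz.
  by rewrite powR_gt0 // ltr_wpDl ?powR_ge0.
have p0 : 0 <= p1 by rewrite invr_ge0 mulr_ge0 ?(ltW g10) //; lra.
have lp : 0 < l `^ (p1 * scale_exp i) by exact: powR_gt0.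
apply: le_trans (_ : ln (kz * l `^ (p1 * scale_exp i)) <= _).
  rewrite ler_ln; first exact: scale_thr_le.
    by rewrite posrE; apply: lt_le_trans z1.
  by rewrite posrE mulr_gt0.
rewrite lnM ?posrE // ln_powR lerD2l.
by rewrite ler_wpM2r ?ln_ge0 // ler_piMr // scale_exp_le1.
Qed.

(** The exponent [1 - g^-1 + i * nu + thr_exp * (1 - i / J)] of [l] and its
bound [1 - (i + 1) / J] are affine in [i / J], so only the two ends matter: at
[0] the comparison is the condition on [g^-1 - thr_exp], at [1] it follows from
the condition on [g^-1 - 1] and the bound on [nu]. *)
Lemma scale_middle i : (i < J)%N ->
  J%:R^-1 <= g^-1 - p1 -> 2 / J%:R <= g^-1 - 1 -> nu <= J%:R^-1 ^+ 2 ->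
  scale_par y l i * z i <= 8 * kz * G `^ (- om) * l `^ scale_exp i.+1.
Proof.
move=> iJ a1 a2 hnu; have gl := g_lt1; have gp := scale_gamma_gt0.
have l0 : 0 < l by exact: lt_le_trans l1.
have Jp : 0 < J%:R :> R by rewrite ltr0n.
apply: le_trans (ler_wpM2l (scale_par_ge0 i) (scale_thr_le (ltnW iJ))) _.
rewrite scale_parE.
have E : l `^ (1 - g^-1 + i%:R * nu) * l `^ (p1 * scale_exp i) <= l `^ scale_exp i.+1.
  rewrite -powRD; last by apply/implyP => _; rewrite gt_eqF.
  apply: ler_powR => //; rewrite /scale_exp -[i.+1%:R]natr1 mulrDl mul1r.
  set u : R := i%:R / J%:R; set e : R := J%:R^-1 in a1 a2 hnu *.
  have u0 : 0 <= u by rewrite divr_ge0.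
  have u1 : u <= 1 by rewrite ler_pdivrMr // mul1r ler_nat ltnW.
  have iu : i%:R = u * J%:R :> R by rewrite /u divfK // gt_eqF.
  have Je : J%:R * e = 1 by rewrite mulfV // gt_eqF.
  have inu : i%:R * nu <= u * e.
    rewrite iu -mulrA ler_wpM2l //.
    apply: le_trans (ler_wpM2l (ltW Jp) hnu) _.
    by rewrite expr2 mulrA Je mul1r.
  have h1 : 0 <= (1 - u) * (g^-1 - p1 - e) by rewrite mulr_ge0 // subr_ge0.
  have h2 : 0 <= u * (g^-1 - 1 - 2 * e) by rewrite mulr_ge0 // subr_ge0.
  lra.
have F : 0 <= 8 * kz * G `^ (- om) by rewrite !mulr_ge0 ?powR_ge0.
have := ler_wpM2l F E; lra.
Qed.

Lemma scale_par_step i : scale_par y l i.+1 = scale_par y l i * l `^ nu.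
Proof.
have l0 : 0 < l by exact: lt_le_trans l1.
have e : 1 + i.+1%:R * nu = (1 + i%:R * nu) + nu.
  by rewrite -[i.+1%:R]natr1; ring.
rewrite /scale_par e [in LHS]powRD; last by apply/implyP => _; rewrite gt_eqF.
by rewrite mulrA mulrAC.
Qed.

End Fixed.
End Scales.

Section ScaleChoice.
Context {R : realType}.
Variables (c g1 b th m : R).
Hypotheses (c0 : 0 < c) (g10 : 0 < g1) (b0 : 0 < b) (th0 : 0 < th) (m0 : 0 <= m).
Local Notation g := (tail_exp g1 th).
Local Notation p1 := (thr_exp g1 th).
Local Notation kz := (thr_cst c g1 th).
Local Notation kU := (len_cst c g1 * cap_cst b th m).
Hypothesis (g_lt1 : g < 1).

Lemma thr_exp_lt : p1 < g^-1.
Proof.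
have gp : 0 < g := scale_gamma_gt0 g10 th0; have gl := g_lt1.
have i1 : 0 < g1^-1 by rewrite invr_gt0.
have h1 : g1^-1 < g^-1 by rewrite /tail_exp invrK ltrDl invr_gt0.
apply: lt_trans h1; rewrite /thr_exp invfM gtr_pMl // invf_lt1; lra.
Qed.

Lemma scale_count_exists : exists (J : nat) (nu : R),
  [/\ (0 < J)%N, J%:R^-1 <= g^-1 - p1, 2 / J%:R <= g^-1 - 1, 0 < nu &
      nu <= J%:R^-1 ^+ 2 /\ nu <= (g^-1 - 1) / J%:R].
Proof.
have gp : 0 < g := scale_gamma_gt0 g10 th0; have gl := g_lt1.
have a1 : 0 < g^-1 - p1 by rewrite subr_gt0 thr_exp_lt.
have a2 : 0 < g^-1 - 1 by rewrite subr_gt0 invf_gt1.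
move: (g^-1 - p1) (g^-1 - 1) a1 a2 => x y x0 y0.
pose B : R := x^-1 + 2 / y.
have B0 : x^-1 <= B by rewrite lerDl divr_ge0 // ltW.
have B1 : 2 / y <= B by rewrite lerDr invr_ge0 ltW.
exists (Num.truncn B).+1, (Num.min ((Num.truncn B).+1%:R^-1 ^+ 2) (y / (Num.truncn B).+1%:R)).
have := truncnS_gt B; have : 0 < (Num.truncn B).+1%:R :> R by rewrite ltr0n.
move: ((Num.truncn B).+1%:R : R) => J J0 BJ.
split => //.
- by rewrite -[x]invrK lef_pV2 ?posrE ?invr_gt0 //; lra.
- by rewrite ler_pdivrMr // mulrC -ler_pdivrMr //; lra.
- by rewrite lt_min exprn_gt0 ?invr_gt0 //= divr_gt0.
- by rewrite !ge_min !lexx orbT.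
Qed.

Variables (J : nat) (nu : R).
Hypotheses (J0 : (0 < J)%N) (hJ1 : J%:R^-1 <= g^-1 - p1)
  (hJ2 : 2 / J%:R <= g^-1 - 1) (nu0 : 0 < nu)
  (hnu1 : nu <= J%:R^-1 ^+ 2) (hnu2 : nu <= (g^-1 - 1) / J%:R).

(** The requirements that a level [l] has to meet for the deviation [y].
[gs_small], [gs_mix], [gs_par] and [gs_last] are the hypotheses of
[subgauss_step] and [subgauss_base] along the scales; [gs_size] settles sums
shorter than one block; [gs_error] and [gs_gauss] bound the three error terms of
the block estimate for the whole sum. *)
Record good_scale (B K G y l : R) : Prop := GoodScale {
  gs_ge1 : 1 <= l;
  gs_small : forall i, (i < J)%N -> 4 * G * scale_par nu y l i *
    ((scale_len c g1 J l i)%:R * (scale_cap b th J l i + (1 + m))) `^ (1 - g) <= 1;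
  gs_mix : forall i, (i.+1 < J)%N ->
    let z : R := (scale_len c g1 J l i)%:R `^ (2 - g)^-1 in
    4 * scale_par nu y l i * z + 2 * ln z <= l `^ scale_exp J i.+1;
  gs_par : forall i, (i.+1 < J)%N ->
    let z : R := (scale_len c g1 J l i)%:R `^ (2 - g)^-1 in
    scale_par nu y l i * (16 + 8 * ln z) <= scale_par nu y l i.+1;
  gs_last : scale_par nu y l J.-1 * (scale_len c g1 J l J.-1)%:R `^ (2 - g)^-1 <= 1;
  gs_size : (scale_len c g1 J l 0)%:R * (scale_cap b th J l 0 + (1 + m)) < y;
  gs_error : 20 * expR (- l) <= B / y ^+ 2 * expR (- (y `^ g / G));
  gs_gauss : forall x : R, 0 <= x -> x <= y `^ (2 - g) ->
    2 * K * scale_par nu y l 0 ^+ 2 * x - scale_par nu y l 0 * y / 2 <= - l }.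

End ScaleChoice.

Section GoodScale.
Context {R : realType}.

(** The level is [l = G `^ rho * (y `^ g / G)]. It exceeds the exponent of
the claimed tail by the factor [G `^ rho], which pays for all logarithms once
[G] is large. Since [y = G `^ om * l `^ g^-1] with [om > 1], every requirement
becomes a comparison of powers of [l], settled by the choice of [J] and [nu],
together with a negative power of [G] that absorbs the constants. *)
Lemma good_scale_exists (c g1 b th m : R) (J : nat) (nu B K : R)
    (g := tail_exp g1 th) :
  0 < c -> 0 < g1 -> 0 < b -> 0 < th -> 0 <= m -> g < 1 -> (0 < J)%N ->
  J%:R^-1 <= g^-1 - thr_exp g1 th -> 2 / J%:R <= g^-1 - 1 -> 0 < nu ->
  nu <= J%:R^-1 ^+ 2 -> nu <= (g^-1 - 1) / J%:R -> 0 < B -> 0 < K ->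
  exists2 G : R, 1 <= G & forall y : R, 0 < y -> G < y `^ g ->
    exists l, good_scale c g1 b th m J nu B K G y l.
Proof.
pose p1 := thr_exp g1 th; pose kz := thr_cst c g1 th.
pose kU := len_cst c g1 * cap_cst b th m.
move=> c0 g10 b0 th0 m0 gl J0 hJ1 hJ2 nu0 hnu1 hnu2 B0 K0.
have gp : 0 < g := scale_gamma_gt0 g10 th0.
have gV : 1 < g^-1 by rewrite invf_gt1.
pose rho : R := (1 - g) / 2.
pose om : R := (1 - rho) / g.
have rho0 : 0 < rho by rewrite /rho; lra.
have om1 : 0 < om - 1 by rewrite subr_gt0 /om ltr_pdivlMr // /rho; lra.
have om0 : 0 < om by lra.
have rho1 : 0 < 1 - rho by rewrite /rho; lra.
have kA1 : 1 <= len_cst c g1 by rewrite lerDr powR_ge0.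
have kz1 : 1 <= kz.
  rewrite /kz /thr_cst -/g -[leLHS](powRr0 (len_cst c g1)); apply: ler_powR => //.
  by rewrite invr_ge0; lra.
have kz0 : 0 < kz by lra.
have lkz : 0 <= ln kz by exact: ln_ge0.
have kM0 : 0 < cap_cst b th m by rewrite ltr_wpDl ?powR_ge0 //; lra.
have kU0 : 0 < kU by rewrite mulr_gt0 //; lra.
have p10 : 0 <= p1 by rewrite /p1 /thr_exp -/g invr_ge0 mulr_ge0 ?(ltW g10) //; lra.
have c1 : 0 < (32 * kU `^ (1 - g))^-1 by rewrite invr_gt0 mulr_gt0 // powR_gt0.
have c2 : 0 < (64 * kz)^-1 by rewrite invr_gt0 mulr_gt0.
have c3 : 0 < (128 * K)^-1 by rewrite invr_gt0 mulr_gt0.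
have c5 : 0 < (kU + 1)^-1 by rewrite invr_gt0; lra.
have C1 : 0 <= 4 * (ln kz + p1) by lra.
have C2 : 0 <= 16 + 8 * ln kz + 8 * p1 by lra.
have B20 : 0 <= 20 / B by rewrite divr_ge0 // ltW.
have orho : 0 <= om / rho by rewrite divr_ge0 // ltW.
have C3 : 0 <= 2 * (2 * (om / rho + g^-1) + 20 / B) by lra.
have J1 : 0 < J%:R^-1 :> R by rewrite invr_gt0 ltr0n.
have [x1 x11 e1] := eventually_powRN_le om1 c1.
have [x2 x21 e2] := eventually_powRN_le om0 c2.
have [x3 x31 e3] := eventually_powRN_le rho1 c3.
have [x5 x51 e5] := eventually_powRN_le om0 c5.
have [y1 y11 f1] := eventually_log_le C1 J1.
have [y2 y21 f2] := eventually_log_le C2 nu0.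
have [y3 y31 f3] := eventually_log_le C3 (ltr01 : 0 < 1 :> R).
pose l0 : R := Num.max (Num.max y1 y2) (Num.max y3 2).
have l02 : 2 <= l0 by rewrite /l0 !le_max lexx !orbT.
have l01 : 1 <= l0 by clear -l02; lra.
have c6 : 0 < l0^-1 by rewrite invr_gt0; exact: lt_le_trans l01.
have [x6 x61 e6] := eventually_powRN_le rho0 c6.
pose G : R := Num.max (Num.max (Num.max x1 x2) (Num.max x3 x5)) x6.
have G1 : 1 <= G by rewrite /G !le_max x61 !orbT.
exists G => // y y0 yG.
have Gx1 : x1 <= G by rewrite /G !le_max lexx.
have Gx2 : x2 <= G by rewrite /G !le_max lexx !orbT.
have Gx3 : x3 <= G by rewrite /G !le_max lexx !orbT.
have Gx5 : x5 <= G by rewrite /G !le_max lexx !orbT.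
have Gx6 : x6 <= G by rewrite /G !le_max lexx !orbT.
have {}e1 := e1 _ Gx1; have {}e2 := e2 _ Gx2; have {}e3 := e3 _ Gx3.
have {}e5 := e5 _ Gx5; have {}e6 := e6 _ Gx6.
have G0 : 0 < G by exact: lt_le_trans G1.
pose l : R := G `^ (rho - 1) * y `^ g.
have Grho : l0 <= G `^ rho.
  by rewrite -[G `^ rho]invrK -powRN -[l0]invrK lef_pV2 ?posrE ?powR_gt0.
have lE : l = G `^ rho * (y `^ g / G).
  rewrite /l powRB; last by apply/implyP => _; rewrite gt_eqF.
  by rewrite powRr1 ?(ltW G0) //; ring.
have L1 : 1 < y `^ g / G by rewrite ltr_pdivlMr // mul1r.
have lG : G `^ rho <= l by rewrite lE ler_peMr ?powR_ge0 // ltW.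
have ll0 : l0 <= l by exact: le_trans lG.
have l1 : 1 <= l by exact: le_trans ll0.
have lp : 0 < l by exact: lt_le_trans l1.
have lny : 0 <= ln l by exact: ln_ge0.
have {}f1 : 4 * (ln kz + p1) * (1 + ln l) <= l `^ J%:R^-1.
  by apply: f1; apply: le_trans ll0; rewrite /l0 !le_max lexx.
have {}f2 : (16 + 8 * ln kz + 8 * p1) * (1 + ln l) <= l `^ nu.
  by apply: f2; apply: le_trans ll0; rewrite /l0 !le_max lexx !orbT.
have {}f3 : 2 * (2 * (om / rho + g^-1) + 20 / B) * (1 + ln l) <= l.
  rewrite -[leRHS]powRr1 ?(ltW lp) //.
  by apply: f3; apply: le_trans ll0; rewrite /l0 !le_max lexx !orbT.
have yE : y = G `^ om * l `^ g^-1.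
  rewrite /l powRM ?powR_ge0 // -!powRrM mulfV ?gt_eqF // powRr1 ?(ltW y0) //.
  rewrite mulrA -powRD; last by apply/implyP => _; rewrite gt_eqF.
  by rewrite (_ : om + _ = 0) ?powRr0 ?mul1r // /om; ring.
have par_ge0 i : 0 <= scale_par nu y l i.
  by rewrite yE; apply: scale_par_ge0.
have zge1 i : 1 <= (scale_len c g1 J l i)%:R `^ (2 - g)^-1 :> R.
  exact: scale_thr_ge1.
have lnz i : (i <= J)%N ->
    ln ((scale_len c g1 J l i)%:R `^ (2 - g)^-1) <= ln kz + p1 * ln l.
  by move=> iJ; apply: scale_ln_thr_le.
have kpl : 0 <= ln kz * ln l by rewrite mulr_ge0.
have tzE i : (i < J)%N ->
   scale_par nu y l i * (scale_len c g1 J l i)%:R `^ (2 - g)^-1 <=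
     8^-1 * l `^ scale_exp J i.+1.
  move=> iJ; rewrite {1}yE.
  apply: le_trans (scale_middle c0 g10 th0 gl J0 om G1 l1 iJ hJ1 hJ2 hnu1) _.
  apply: ler_wpM2r; first exact: powR_ge0.
  apply: le_trans (_ : 8 * kz * (64 * kz)^-1 <= _).
    by apply: ler_wpM2l => //; rewrite mulr_ge0 // ltW.
  by rewrite invfM mulrACA mulfV ?gt_eqF // mulr1; clear; lra.
exists l; split => //.
- move=> i iJ; rewrite {1}yE.
  apply: le_trans (scale_small c0 g10 b0 th0 m0 gl J0 om G1 l1 (ltnW iJ) hnu2) _.
  rewrite -(opprB om 1).
  apply: le_trans (ler_wpM2l _ e1) _.
    by rewrite mulr_ge0 // powR_ge0.
  by rewrite mulfV // gt_eqF // mulr_gt0 // powR_gt0.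
- move=> i iJ /=; rewrite -/g.
  have h1 := tzE i (ltnW iJ).
  have h2 := lnz i (ltnW (ltnW iJ)).
  have h3 : l `^ J%:R^-1 <= l `^ scale_exp J i.+1.
    by apply: ler_powR => //; apply: scale_exp_last.
  move: (l `^ scale_exp J i.+1) (l `^ J%:R^-1) h1 h3 f1 => a a' h1 h3 f1.
  have h4 : 2 * ln ((scale_len c g1 J l i)%:R `^ (2 - g)^-1) <= 2^-1 * a.
    by clear -h2 h3 f1 lkz p10 lny kpl; lra.
  by rewrite -mulrA; clear -h1 h4; lra.
- move=> i iJ /=; rewrite -/g.
  have -> : scale_par nu y l i.+1 = scale_par nu y l i * l `^ nu.
    by rewrite yE scale_par_step.
  apply: ler_wpM2l => //.
  have h2 := lnz i (ltnW (ltnW iJ)).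
  have h3 : 0 <= p1 * ln l by rewrite mulr_ge0.
  clear -h2 f2 kpl lkz p10 lny h3; lra.
- apply: le_trans (tzE _ _) _; first by rewrite prednK.
  rewrite prednK // (_ : scale_exp J J = 0) ?powRr0; first by clear; lra.
  by rewrite /scale_exp mulfV ?subrr // gt_eqF // ltr0n.
- apply: le_lt_trans (scale_size_le c0 g10 b0 th0 m0 J0 l1 (ltnW J0)) _.
  rewrite (_ : scale_exp J 0 = 1); last by rewrite /scale_exp mul0r subr0.
  rewrite mul1r [X in _ < X]yE ltr_pM2r ?powR_gt0 //.
  apply: lt_le_trans (_ : kU + 1 <= _); first by rewrite ltrDl.
  by rewrite -[leRHS]invrK -powRN -[leLHS]invrK lef_pV2 ?posrE ?powR_gt0.
- have lny2 : ln y <= (om / rho + g^-1) * ln l.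
    rewrite yE lnM ?posrE ?powR_gt0 // !ln_powR mulrDl lerD2r.
    have : rho * ln G <= ln l by rewrite -ln_powR ler_ln ?posrE ?powR_gt0.
    move=> h; have := ler_wpM2l orho h.
    by rewrite mulrA divfK ?gt_eqF.
  have lnB : ln (20 / B) <= 20 / B.
    by rewrite ltW // ln_sublinear // divr_gt0.
  have L2 : y `^ g / G <= l / 2.
    have h2 : 2 <= G `^ rho by exact: le_trans Grho.
    by rewrite lE; move: (G `^ rho) (_ / G) L1 h2 => u v v1 u2; clear -v1 u2; nra.
  have B0' : 0 < 20 / B by rewrite divr_gt0.
  have E20 : 20 = B * expR (ln (20 / B)) by rewrite lnK ?posrE // mulrC divfK // gt_eqF.
  have Ey : (y ^+ 2)^-1 = expR (- (2 * ln y)).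
    by rewrite expRN expRM_natl lnK.
  rewrite {1}E20 Ey -!mulrA ler_wpM2l ?(ltW B0) // -!expRD ler_expR.
  have h0 : 0 <= om / rho + g^-1 by rewrite addr_ge0 // ltW // (lt_trans ltr01).
  have h1 : 0 <= 20 / B * ln l by rewrite mulr_ge0.
  move: (om / rho + g^-1) (20 / B) h0 h1 lny2 lnB f3 B20 => u w h0 h1 lny2 lnB f3 w0.
  have h4 : 0 <= u * ln l by rewrite mulr_ge0.
  by clear -h0 h1 lny2 lnB f3 w0 L2 h4; lra.
- move=> x x0 xy.
  have tE : scale_par nu y l 0 * y = 8 * l.
    by rewrite /scale_par mul0r addr0 powRr1 ?(ltW lp) // divfK // gt_eqF.
  have t2x : scale_par nu y l 0 ^+ 2 * x <= 64 * (G `^ (rho - 1)) * l.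
    apply: le_trans (ler_wpM2l _ xy) _; first by rewrite exprn_ge0.
    rewrite powRB; last by apply/implyP => _; rewrite gt_eqF.
    have -> : y `^ 2 = y ^+ 2 by rewrite -powR_mulrn // ltW.
    rewrite mulrA -exprMn tE.
    rewrite ler_pdivrMr ?powR_gt0 // le_eqVlt; apply/orP; left; apply/eqP.
    have -> : 64 * G `^ (rho - 1) * l * y `^ g = 64 * l * (G `^ (rho - 1) * y `^ g).
      by ring.
    by rewrite -/l; ring.
  have h3 : 128 * K * G `^ (rho - 1) <= 1.
    rewrite -(opprB 1 rho); apply: le_trans (ler_wpM2l _ e3) _.
      by rewrite mulr_ge0 // ltW.
    by rewrite mulfV // gt_eqF // mulr_gt0.
  rewrite tE -mulrA.
  have h4 := ler_wpM2l (mulr_ge0 (ler0n R 2) (ltW K0)) t2x.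
  have h5 := ler_wpM2r (ltW lp) h3.
  by clear -h4 h5 lp; lra.
Qed.

End GoodScale.

(** * The stretched exponential inequality *)

(** The sub-Gaussian constant deteriorates geometrically along the scales,
whose number is fixed in advance. *)
Fixpoint tower_cst (R : realType) (v B : R) (j : nat) : R :=
  if j is j'.+1 then 2 * v + (B + 20) + 576 * tower_cst v B j'
  else 2 * v + B + 576.

Lemma tower_cst_gt0 (R : realType) (v B : R) j :
  0 <= v -> 0 <= B -> 0 < tower_cst v B j.
Proof. by move=> v0 B0; elim: j => [|j IH] /=; lra. Qed.

Section Tower.
Context {R : realType}.
Variables (c g1 b th m : R).
Context {W : finType} {mu : W -> R}.
Hypothesis mu_ge0 : forall w, 0 <= mu w.
Hypothesis mu1 : \sum_w mu w = 1.
Notation ok := (subweibull_mixing c g1 b th m mu).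
Notation g := (tail_exp g1 th).
Hypotheses (c0 : 0 < c) (g10 : 0 < g1) (b0 : 0 < b) (th0 : 0 < th) (m0 : 0 <= m).
Hypothesis g_lt1 : g < 1.
Variable v : R.
Hypothesis v0 : 0 <= v.
Hypothesis variance : forall D n, ok D ->
  Ex mu (fun w => csum mu D n w ^+ 2) <= v * n%:R.

(** Downward induction on the scale, from the last one, where the base case
applies, to the first. *)
Lemma subgauss_tower J nu (B K G y l : R) : (0 < J)%N -> 0 <= B -> 0 < G ->
  0 < y -> good_scale c g1 b th m J nu B K G y l ->
  (forall i, (i < J)%N ->
     stretched c g1 b th m (mu := mu) g G B (scale_len c g1 J l i)) ->
  subgauss c g1 b th m (mu := mu) (scale_len c g1 J l 0) (scale_cap b th J l 0)
    (scale_par nu y l 0) (tower_cst v B J.-1).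
Proof.
move=> J0 B0 G0 y0 gs st.
have l1 := gs_ge1 gs; have l0 : 0 <= l by exact: le_trans l1.
have gp : 0 < g := scale_gamma_gt0 g10 th0.
suff H j : (j < J)%N -> subgauss c g1 b th m (mu := mu)
    (scale_len c g1 J l (J.-1 - j)) (scale_cap b th J l (J.-1 - j))
    (scale_par nu y l (J.-1 - j)) (tower_cst v B j).
  by have := H J.-1; rewrite subnn prednK // leqnn => /(_ isT).
elim: j => [_|j IH jJ] /=.
  rewrite subn0; apply: (@subgauss_base _ c g1 b th m W mu _ _ _ g _ _ _ _ G) => //.
  - exact: powR_ge0.
  - by apply: st; rewrite prednK.
  - by apply: (gs_small gs); rewrite prednK.
  - exact: (gs_last gs).
have := IH (ltnW jJ).
have jJ' : (j < J.-1)%N by rewrite -ltnS prednK.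
have <- : (J.-1 - j.+1).+1 = (J.-1 - j)%N by rewrite subnSK.
have iJ : ((J.-1 - j.+1).+1 < J)%N.
  by rewrite subnSK // -[X in (_ < X)%N](prednK J0) ltnS leq_subr.
move: (J.-1 - j.+1)%N iJ => i iJ IHi.
apply: (@subgauss_step _ c g1 b th m W mu _ _ _ g _ _ _ _ G B _ _ _
  (scale_len c g1 J l i.+1) (scale_cap b th J l i.+1) (scale_par nu y l i.+1)) => //.
- exact: tower_cst_gt0.
- by rewrite scale_len_mono // andbT.
- exact: powR_ge0.
- exact: powR_ge0.
- by apply: st; apply: ltnW.
- by apply: (gs_small gs); apply: ltnW.
- by rewrite scale_capE //; apply: (gs_mix gs).
- by apply: le_trans (gs_mix gs iJ) _; apply: scale_lenE.
- exact: (gs_par gs).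
Qed.

Lemma cap_tail D n (M z : R) : ok D -> 0 <= M -> n%:R * (M + (1 + m)) < z ->
  Pr mu (fun w => z <= csum mu D n w) <= n%:R * (2 * expR (- (b * M `^ th))).
Proof.
move=> h M0 nz.
apply: le_trans (_ : Pr mu (fun w => has (fun s => M < `|D s w|) (iota 0 n)) <= _).
  apply: le_Pr => // w zS; apply: contraT => /hasPn noM.
  have h' : ok (cap_kill D M n) by exact: sm_cap_kill.
  have : csum mu D n w < z.
    apply: le_lt_trans nz; apply: le_trans (csum_le_cap_kill mu_ge0 h (leqnn n) M0 _) _.
      move=> s sn; apply: le_trans (ler_norm _) _.
      by rewrite leNgt; apply: noM; rewrite mem_iota.
    apply: (csum_le_cap mu_ge0 mu1 n M0 h') => s w'; rewrite /cap_kill.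
    by case: ifP => // _; rewrite ge_min lexx orbT.
  by rewrite ltNge zS.
apply: le_trans (le_Pr_has mu_ge0 n (fun s w => M < `|D s w|)) _.
apply: le_trans (_ : \sum_(0 <= s < n) (2 * expR (- (b * M `^ th))) <= _).
  by apply: ler_sum => s _; apply: (sm_tail h).
by rewrite big_const_nat subn0 iter_addr_0 -[_ *+ n]mulr_natl.
Qed.

Lemma chebyshev_csum D n (y : R) : ok D -> 0 < y ->
  Pr mu (fun w => y <= csum mu D n w) <= v * (n%:R / y ^+ 2).
Proof.
move=> h y0; rewrite mulrA.
apply: le_trans (_ : Pr mu (fun w => y ^+ 2 <= csum mu D n w ^+ 2) <= _).
  apply: le_Pr => // w yS; rewrite lerXn2r ?nnegrE ?(ltW y0) //.
  exact: le_trans (ltW y0) yS.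
apply: le_trans (finite_markov mu_ge0 _ _) _; first exact: exprn_gt0.
  by move=> w; exact: sqr_ge0.
by rewrite ler_pM2r ?invr_gt0 ?exprn_gt0 //; apply: variance.
Qed.

(** For [y `^ g <= G] the exponential on the right is at least [expR (- 1)], and
the factor [expR 1] in [B] lets Chebyshev's inequality suffice. For larger [y],
a capped sum of at most [A] terms cannot reach [y]; a longer one is cut into
blocks, and the induction hypothesis is available for their lengths, all
smaller than [n]. *)
Lemma stretched_induction J nu (G : R) : (0 < J)%N -> 0 < v -> 1 <= G ->
  let B := v * expR 1 in
  (forall y : R, 0 < y -> G < y `^ g -> exists l,
     good_scale c g1 b th m J nu B (tower_cst v B J.-1) G y l) ->
  forall n, stretched c g1 b th m (mu := mu) g G B n.
Proof.
move=> J0 vp G1 B good; have G0 : 0 < G by exact: lt_le_trans G1.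
have B0 : 0 < B by rewrite mulr_gt0 ?expR_gt0.
set K := tower_cst _ _ _ in good.
have K0 : 0 < K by apply: tower_cst_gt0 => //; apply: ltW.
elim/ltn_ind => n IH D h y y0 ny.
have nn : 0 <= n%:R / y ^+ 2 by rewrite divr_ge0 // exprn_ge0 // ltW.
case: (leP (y `^ g) G) => [small|large].
  apply: le_trans (chebyshev_csum n h y0) _.
  have e : 1 <= expR 1 * expR (- (y `^ g / G)).
    by rewrite -expRD -[leLHS]expR0 ler_expR subr_ge0 ler_pdivrMr // mul1r.
  rewrite -[leLHS]mulr1; apply: le_trans (ler_wpM2l (mulr_ge0 v0 nn) e) _.
  by rewrite le_eqVlt /B; apply/orP; left; apply/eqP; ring.
have [l gs] := good y y0 large.
have l1 := gs_ge1 gs; have l0 : 0 <= l by exact: le_trans l1.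
set A := scale_len c g1 J l 0; set M := scale_cap b th J l 0.
have M0 : 0 <= M by exact: powR_ge0.
have capE : b * M `^ th = l.
  by rewrite scale_capE // /scale_exp mul0r subr0 powRr1.
have lenE : l <= c * A%:R `^ g1.
  by apply: le_trans (scale_lenE J c0 g10 0 l0); rewrite /scale_exp mul0r subr0 powRr1.
have final : n%:R * (20 * expR (- l)) <= B * (n%:R / y ^+ 2) * expR (- (y `^ g / G)).
  have := ler_wpM2l (ler0n R n) (gs_error gs); move/le_trans; apply.
  by rewrite le_eqVlt; apply/orP; left; apply/eqP; ring.
apply: le_trans final.
have e0 : 0 <= n%:R * expR (- l) by rewrite mulr_ge0 ?expR_ge0.
case: (leqP n A) => nA.
  apply: le_trans (cap_tail (M := M) h M0 _) _.
    apply: le_lt_trans (gs_size gs); apply: ler_wpM2r; last by rewrite ler_nat.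
    by rewrite addr_ge0 // addr_ge0.
  by rewrite capE mulrCA; lra.
have n1 : 1 <= n%:R :> R by rewrite ler1n; exact: leq_ltn_trans nA.
have tp : 0 < scale_par nu y l 0.
  by rewrite divr_gt0 // mulr_gt0 // powR_gt0 //; exact: lt_le_trans l1.
have sub : subgauss c g1 b th m (mu := mu) A M (scale_par nu y l 0) K.
  apply: (subgauss_tower J0 (ltW B0) G0 y0 gs) => i iJ; apply: IH.
  apply: leq_ltn_trans nA; exact: scale_len_mono.
have An : (0 < A <= n)%N by rewrite /= ltnW.
apply: le_trans (block_tail_gauss mu_ge0 mu1 y h An M0 tp (ltW K0) _) _.
  move=> a; apply: sub; last by rewrite tp lexx.
  - by apply: sm_shift; apply: sm_cap_kill.
  - move=> s w; rewrite /cap_kill; case: ifP => // _.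
    by rewrite ge_min lexx orbT.
rewrite capE.
have h1 : expR (- (c * A%:R `^ g1)) <= expR (- l) by rewrite ler_expR lerN2.
have h2 : expR (2 * K * scale_par nu y l 0 ^+ 2 * n%:R - scale_par nu y l 0 * y / 2)
   <= expR (- l) by rewrite ler_expR; apply: (gs_gauss gs) => //.
have h3 := ler_wpM2l (ler0n R n) h1.
have h4 : expR (- l) <= n%:R * expR (- l) by rewrite ler_peMl ?expR_ge0.
lra.
Qed.

End Tower.

(** In the range [n <= y `^ (2 - g)] the stretched exponential dominates the
Gaussian tail [expR (- y ^+ 2 / n)], so no Gaussian term is present. *)
Theorem stretched_exponential_tail (R : realType) (c g1 b th m : R)
    (g := tail_exp g1 th) :
  0 < c -> 0 < g1 -> 0 < b -> 0 < th -> 0 <= m -> g < 1 ->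
  exists G B : R, [/\ 1 <= G, 0 < B & forall (W : finType) (mu : W -> R),
    (forall w, 0 <= mu w) -> \sum_w mu w = 1 ->
    forall D, subweibull_mixing c g1 b th m mu D ->
    forall (n : nat) (y : R), 0 < y -> n%:R <= y `^ (2 - g) ->
    Pr mu (fun w => y <= csum mu D n w)
      <= B * (n%:R / y ^+ 2) * expR (- (y `^ g / G))].
Proof.
move=> c0 g10 b0 th0 m0 gl.
have [v v0 var] := sm_variance b th c0 g10 m0.
have [J [nu [J0 hJ1 hJ2 nu0 [hnu1 hnu2]]]] := scale_count_exists g10 th0 gl.
have B0 : 0 < v * expR 1 by rewrite mulr_gt0 ?expR_gt0.
have K0 := tower_cst_gt0 J.-1 (ltW v0) (ltW B0).
have [G G1 good] := good_scale_exists c0 g10 b0 th0 m0 gl J0 hJ1 hJ2 nu0 hnu1 hnu2 B0 K0.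
exists G, (v * expR 1); split => // W mu mu0 mu1 D h n y y0 ny.
apply: (@stretched_induction _ c g1 b th m W mu mu0 mu1 c0 g10 b0 th0 m0 gl v (ltW v0) _ J nu) => //.
by move=> D' n' h'; apply: var.
Qed.

(** * Discretisation of a real process *)

Section FiniteImage.
Context {d} {Omega : measurableType d} {R : realType} (P : probability Omega R).
Context {W : finType} (de : Omega -> W).
Hypothesis fiber : forall x, measurable (de @^-1` [set x]).

Definition law (x : W) : R := fine (P (de @^-1` [set x])).

Lemma law_ge0 x : 0 <= law x.
Proof. by rewrite fine_ge0. Qed.

Lemma lawE x : (law x)%:E = P (de @^-1` [set x]).
Proof. by rewrite fineK ?fin_num_measure. Qed.

Lemma integral_law (f : W -> R) : (forall x, 0 <= f x) ->
  (\int[P]_w (f (de w))%:E = (Ex law f)%:E)%E.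
Proof.
move=> f0.
have E w : (f (de w))%:E =
    \sum_(x <- index_enum W) (f x * \1_(de @^-1` [set x]) w)%:E.
  rewrite sumEFin; congr (_%:E).
  rewrite (bigD1_seq (de w)) ?mem_index_enum ?index_enum_uniq //=.
  rewrite indicE mem_set // mulr1 big1 ?addr0 // => x xw.
  rewrite indicE memNset ?mulr0 // => /= xE; by rewrite xE eqxx in xw.
under eq_integral do rewrite E.
rewrite ge0_integral_sum //.
- rewrite /Ex -sumEFin; apply: eq_bigr => x _.
  rewrite (integralZl_indic measurableT (fun=> de @^-1` [set x])) //; last by move=> h; have := f0 x; rewrite leNgt h.
  by rewrite integral_indic // setIT mulrC EFinM lawE.
- move=> x; apply/measurable_EFinP; apply: measurable_funM.
    exact: measurable_cst.
  exact: measurable_indic.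
- by move=> x w _; rewrite lee_fin mulr_ge0.
Qed.

Lemma measurable_image_event (A : W -> bool) : measurable [set w | A (de w)].
Proof.
have -> : [set w | A (de w)] = \big[setU/set0]_(x | A x) (de @^-1` [set x]).
  rewrite -bigcup_seq_cond; apply/seteqP; split => w /=.
    by move=> Aw; exists (de w) => //=; rewrite mem_index_enum.
  by case=> x /andP[_ Ax] /= ->.
by apply: bigsetU_measurable.
Qed.

Lemma Pr_law (A : W -> bool) : P [set w | A (de w)] = (Pr law A)%:E.
Proof.
rewrite -[Pr _ _]/(Ex law (fun x => (A x)%:R)) -integral_law; last by move=> x; exact: ler0n.
rewrite -[in LHS](setIT [set w | A (de w)]) -integral_indic //.
  apply: eq_integral => w _; rewrite indicE; congr (_%:R%:E).
  by case: (boolP (A (de w))) => h; [rewrite mem_set | rewrite memNset //; apply/negP].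
exact: measurable_image_event.
Qed.

Lemma law_sum1 : \sum_x law x = 1.
Proof.
have := Pr_law (fun=> true).
have -> : [set w | (fun=> true) (de w)] = setT by apply/seteqP; split.
rewrite probability_setT => - [] /esym; rewrite /Pr /Ex.
by under eq_bigr do rewrite mulr1.
Qed.

End FiniteImage.

Section SigmaAlgebra.
Context {T : Type} (F : set (set T)).
Hypothesis sF : sigma_algebra setT F.

Lemma sigma_algebra_compl A : F A -> F (~` A).
Proof. by case: sF => _ h _ /h; rewrite setTD. Qed.

Lemma sigma_algebra_full : F setT.
Proof. by rewrite -setC0; apply: sigma_algebra_compl; case: sF. Qed.

Lemma sigma_algebra_inter A B : F A -> F B -> F (A `&` B).
Proof.
move=> FA FB; rewrite -[_ `&` _]setCK setCI; apply: sigma_algebra_compl.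
rewrite -bigcup2E; case: sF => F0 _ h; apply: h => -[|[|n]] //=.
- exact: sigma_algebra_compl.
- exact: sigma_algebra_compl.
Qed.

Lemma sigma_algebra_bigI (I : finType) (A : I -> set T) :
  (forall i, F (A i)) -> F [set x | forall i, A i x].
Proof.
move=> FA.
have -> : [set x | forall i, A i x] = \big[setI/setT]_(i : I) A i.
  rewrite -bigcap_seq; apply/seteqP; split => x /=.
    by move=> h i _.
  by move=> h i; apply: h; rewrite /= mem_index_enum.
by elim/big_ind: _ => //; [exact: sigma_algebra_full | exact: sigma_algebra_inter].
Qed.

End SigmaAlgebra.

Section Grid.
Context {R : realType} (h : R) (N : nat).
Hypothesis h0 : 0 < h.

Definition grid (x : R) : 'I_N.+1 := inord (minn (Num.truncn (x / h)) N).

Lemma gridE x : grid x = minn (Num.truncn (x / h)) N :> nat.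
Proof. by rewrite inordK // ltnS geq_minr. Qed.

Lemma grid_le x : 0 <= x -> h * (grid x)%:R <= x.
Proof.
move=> x0; rewrite gridE mulrC -ler_pdivlMr //.
apply: le_trans (_ : (Num.truncn (x / h))%:R <= _); first by rewrite ler_nat geq_minl.
by rewrite truncn_le divr_ge0 // ltW.
Qed.

Lemma grid_ge x : x <= h * N%:R -> x - h * (grid x)%:R <= h.
Proof.
move=> xN; rewrite lerBlDl -[X in _ + X]mulr1 -mulrDr natr1 gridE /minn.
case: ifP => tN; first by rewrite mulrC -ler_pdivrMr // ltW // truncnS_gt.
by apply: le_trans xN _; rewrite ler_pM2l // ler_nat.
Qed.

Lemma measurable_grid (k : 'I_N.+1) : measurable [set x : R | grid x = k].
Proof.
apply: is_interval_measurable => x y /= xk yk z /andP[xz zy].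
have mono u v : u <= v -> (grid u <= grid v)%N.
  move=> uv; rewrite !gridE leq_min geq_minr andbT.
  by rewrite (leq_trans (geq_minl _ _)) // le_truncn // ler_pM2r // invr_gt0.
apply/val_inj/eqP => /=; rewrite eqn_leq.
by rewrite -{1}yk mono //= -xk mono.
Qed.

End Grid.

(** Both expectations are sums of [F a e] over the values [a] of [f] and [e] of
[g], one with joint and one with product weights. *)
Lemma decoupling_error (R : realType) (W : finType) (mu : W -> R)
    (f g : W -> W) (F : W -> W -> R) :
  (forall x y, 0 <= F x y <= 1) ->
  `|Ex mu (fun x => F (f x) (g x)) - Ex mu (fun x => Ex mu (fun y => F (f x) (g y)))|
  <= \sum_a \sum_e `|Pr mu (fun x => (f x == a) && (g x == e)) -
       Pr mu (fun x => f x == a) * Pr mu (fun x => g x == e)|.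
Proof.
move=> F01.
have ind (x : W) (k : W -> R) : k x = \sum_a k a * (x == a)%:R.
  rewrite (bigD1 x) //= eqxx mulr1 big1 ?addr0 // => z.
  by rewrite eq_sym => /negPf ->; rewrite mulr0.
have E1 : Ex mu (fun x => F (f x) (g x)) = \sum_a \sum_e F a e *
    Pr mu (fun x => (f x == a) && (g x == e)).
  transitivity (Ex mu (fun x => \sum_a \sum_e F a e * ((f x == a) && (g x == e))%:R)).
    apply: eq_Ex => x; rewrite (ind (f x) (F^~ (g x))); apply: eq_bigr => a _.
    rewrite (ind (g x) (F a)) mulr_suml; apply: eq_bigr => e _.
    by rewrite -mulrA -natrM mulnb andbC.
  rewrite Ex_sum; apply: eq_bigr => a _; rewrite Ex_sum; apply: eq_bigr => e _.
  by rewrite ExZ.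
have E2 : Ex mu (fun x => Ex mu (fun y => F (f x) (g y))) = \sum_a \sum_e F a e *
    (Pr mu (fun x => f x == a) * Pr mu (fun x => g x == e)).
  have E3 a : Ex mu (fun y => F a (g y)) = \sum_e F a e * Pr mu (fun x => g x == e).
    transitivity (Ex mu (fun y => \sum_e F a e * (g y == e)%:R)).
      by apply: eq_Ex => y; rewrite -ind.
    by rewrite Ex_sum; apply: eq_bigr => e _; rewrite ExZ.
  transitivity (Ex mu (fun x => \sum_a Ex mu (fun y => F a (g y)) * (f x == a)%:R)).
    by apply: eq_Ex => x; rewrite -(ind (f x) (fun a => Ex mu (fun y => F a (g y)))).
  rewrite Ex_sum; apply: eq_bigr => a _; rewrite ExZ E3 mulr_suml.
  by apply: eq_bigr => e _; rewrite -mulrA [X in _ * X]mulrC.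
rewrite E1 E2 -sumrB; apply: le_trans (ler_norm_sum _ _ _) _.
apply: ler_sum => a _; rewrite -sumrB; apply: le_trans (ler_norm_sum _ _ _) _.
apply: ler_sum => e _; rewrite -mulrBr normrM.
have /andP[F0 F1] := F01 a e.
by rewrite (ger0_norm F0) ler_piMl.
Qed.

Section Discretization.
Context {d} {Omega : measurableType d} {R : realType} (P : probability Omega R).
Variables (c g1 b th m : R) (V : nat -> Omega -> R) (T N : nat) (h : R).
Hypothesis h0 : 0 < h.
Hypothesis V_meas : forall s, measurable_fun setT (V s).
Hypothesis V_ge0 : forall s w, 0 <= V s w.

(** The sigma-algebras may be larger than those generated by the past and
the future of [V], as is the case for a functional of a mixing process. *)
Definition mixing_rate := forall k l : nat, (0 < l)%N -> exists F G : set (set Omega),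
  [/\ sigma_algebra setT F, sigma_algebra setT G,
      forall s (B : set R), (s <= k)%N -> measurable B -> F (V s @^-1` B),
      forall s (B : set R), (k + l <= s)%N -> measurable B -> G (V s @^-1` B) &
      (beta_coef P F G <= (2 * expR (- (c * l%:R `^ g1)))%:E)%E].

Local Notation W := {ffun 'I_T -> 'I_N.+1}.

Definition discr (w : Omega) : W := [ffun i : 'I_T => grid h N (V i w)].

Definition discr_val (s : nat) (x : W) : R :=
  oapp (fun i : 'I_T => h * (x i)%:R) 0 (insub s).

Lemma discr_valE (i : 'I_T) x : discr_val i x = h * (x i)%:R.
Proof. by rewrite /discr_val valK. Qed.

Lemma discr_val_ge0 s x : 0 <= discr_val s x.
Proof. by rewrite /discr_val; case: insub => //= i; rewrite mulr_ge0 // ltW. Qed.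

Lemma discr_val_le s w : discr_val s (discr w) <= V s w.
Proof.
rewrite /discr_val; case: insubP => //= i _ <-.
by rewrite ffunE; apply: grid_le.
Qed.

Lemma fiber_discr x : measurable (discr @^-1` [set x]).
Proof.
have -> : discr @^-1` [set x] = \big[setI/setT]_(i : 'I_T) (V i @^-1` [set y | grid h N y = x i]).
  rewrite -bigcap_seq; apply/seteqP; split => w /=.
    by move=> <- i _ /=; rewrite ffunE.
  by move=> H; apply/ffunP => i; rewrite ffunE; apply: H; rewrite /= mem_index_enum.
apply: bigsetI_measurable => i _; rewrite -[X in measurable X]setTI.
by apply: V_meas => //; apply: measurable_grid.
Qed.

Lemma measurable_discr_val s : measurable_fun setT (fun w => discr_val s (discr w)).
Proof.
rewrite /discr_val; case: insub => [i|] /=; last exact: measurable_cst.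
apply: measurable_funM; first exact: measurable_cst.
move=> _ B _; rewrite setTI.
have -> : (fun w => (discr w i)%:R : R) @^-1` B =
    [set w | (fun x : W => `[< B (x i)%:R >]) (discr w)].
  by apply/seteqP; split => w /= /asboolP.
exact: (measurable_image_event fiber_discr (fun x : W => `[< B (x i)%:R >])).
Qed.

Local Notation mu := (law P discr).

Lemma discr_tail : (forall s y, 0 <= y ->
    (P [set w | (y < V s w)%R] <= (2 * expR (- (b * y `^ th)))%:E)%E) ->
  forall s y, 0 <= y ->
    Pr mu (fun x => y < `|discr_val s x|) <= 2 * expR (- (b * y `^ th)).
Proof.
move=> tail s y y0; rewrite -lee_fin -Pr_law; last exact: fiber_discr.
apply: le_trans (tail s y y0); apply: le_measure; rewrite ?inE.
- exact: (measurable_image_event fiber_discr (fun x => y < `|discr_val s x|)).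
- rewrite -[X in measurable X]setTI.
  have -> : [set w | (y < V s w)%R] = V s @^-1` `]y, +oo[%classic.
    by apply/seteqP; split => w /=; rewrite in_itv /= andbT.
  exact: V_meas.
- move=> w /=; rewrite ger0_norm ?discr_val_ge0 // => /lt_le_trans; apply.
  exact: discr_val_le.
Qed.

Lemma discr_moment4 : (forall s, (\int[P]_w (V s w ^+ 4)%:E <= m%:E)%E) ->
  forall s, Ex mu (fun x => discr_val s x ^+ 4) <= m.
Proof.
move=> mom s; rewrite -lee_fin -integral_law; first last.
- by move=> x; rewrite exprn_ge0 // discr_val_ge0.
- exact: fiber_discr.
have mD : measurable_fun setT (fun w => (discr_val s (discr w) ^+ 4)%:E).
  by apply/measurable_EFinP; apply: measurable_funX; exact: measurable_discr_val.
apply: le_trans (mom s); apply: ge0_le_integral => //.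
- by move=> w _; rewrite lee_fin exprn_ge0 // discr_val_ge0.
- by apply/measurable_EFinP; apply: measurable_funX.
- move=> w _; rewrite lee_fin lerXn2r ?nnegrE ?discr_val_ge0 //.
  exact: discr_val_le.
Qed.

(** For finitely valued processes the mixing coefficient is the sum over all
values of the past and of the future, so it bounds the effect of replacing
the future by an independent copy. *)
Lemma discr_mixing : mixing_rate ->
  forall (k l : nat) (F : W -> W -> R), (0 < l)%N ->
    (forall w w', 0 <= F w w' <= 1) ->
    (forall w1 w2 w', (forall s, (s <= k)%N -> discr_val s w1 = discr_val s w2) ->
       F w1 w' = F w2 w') ->
    (forall w w1 w2, (forall s, (k + l <= s)%N -> discr_val s w1 = discr_val s w2) ->
       F w w1 = F w w2) ->
    `|Ex mu (fun w => F w w) - Ex mu (fun w => Ex mu (F w))|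
      <= 4 * expR (- (c * l%:R `^ g1)).
Proof.
move=> mix k l F l0 F01 Fl Fr.
have [FF [GG [sF sG FV GV beta]]] := mix k l l0.
pose sel (p : nat -> bool) (x : W) : W := [ffun i : 'I_T => if p i then x i else ord0].
pose pa := sel (fun i => i <= k)%N; pose fu := sel (fun i => k + l <= i)%N.
have selE (p : nat -> bool) x s : p s -> discr_val s (sel p x) = discr_val s x.
  move=> ps; rewrite /discr_val; case: insubP => //= i _ e.
  by rewrite ffunE e ps.
have FE x y : F x y = F (pa x) (fu y).
  rewrite (Fl x (pa x)); last by move=> s sk; rewrite selE.
  by apply: Fr => s sk; rewrite selE.
rewrite (_ : Ex mu _ = Ex mu (fun w => F (pa w) (fu w))); last first.
  by apply: eq_Ex => w; rewrite FE.
rewrite (_ : Ex mu (fun w => Ex mu (F w)) =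
    Ex mu (fun x => Ex mu (fun y => F (pa x) (fu y)))); last first.
  by apply: eq_Ex => x; apply: eq_Ex => y; rewrite FE.
apply: le_trans (decoupling_error _ pa fu F01) _.
have selF (H : set (set Omega)) (p : nat -> bool) (a : W) : sigma_algebra setT H ->
    (forall s (B : set R), p s -> measurable B -> H (V s @^-1` B)) ->
    H [set w | sel p (discr w) == a].
  move=> sH HV.
  have -> : [set w | sel p (discr w) == a] =
     [set w | forall i : 'I_T, [set w | sel p (discr w) i = a i] w].
    apply/seteqP; split => w /=; first by move/eqP => <-.
    by move=> e; apply/eqP/ffunP.
  apply: sigma_algebra_bigI => // i.
  case: (boolP (p i)) => pi.
    rewrite (_ : [set w | _] = V i @^-1` [set x | grid h N x = a i]).
      by apply: HV => //; apply: measurable_grid.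
    by apply/seteqP; split => w /=; rewrite !ffunE pi.
  case: (ord0 =P a i) => e.
    rewrite (_ : [set w | _] = setT); first exact: sigma_algebra_full.
    by apply/seteqP; split => w //= _; rewrite ffunE (negPf pi).
  rewrite (_ : [set w | _] = set0); first by case: sH.
  by apply/seteqP; split => w //=; rewrite ffunE (negPf pi).
have part (H : set (set Omega)) (p : nat -> bool) : sigma_algebra setT H ->
    (forall s (B : set R), p s -> measurable B -> H (V s @^-1` B)) ->
    fin_partition H (fun i : 'I_#|W| => [set w | sel p (discr w) == enum_val i]).
  move=> sH HV; split.
  - by move=> i; apply: selF.
  - move=> i j _ _ [w [/= /eqP -> /eqP]]; exact: enum_val_inj.
  - apply/seteqP; split => w //= _; exists (enum_rank (sel p (discr w))) => //=.
    by rewrite enum_rankK.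
have := beta; rewrite {1}/beta_coef => ub.
pose S := \sum_(a : W) \sum_(e : W) `|Pr mu (fun x => (pa x == a) && (fu x == e)) -
   Pr mu (fun x => pa x == a) * Pr mu (fun x => fu x == e)|.
have : ((2^-1 * S)%:E <= (2 * expR (- (c * l%:R `^ g1)))%:E)%E.
  apply: le_trans ub; apply: ereal_sup_ubound => /=.
  exists #|W|, #|W|, (fun i => [set w | pa (discr w) == enum_val i]),
    (fun i => [set w | fu (discr w) == enum_val i]); split.
  - exact: part sF FV.
  - exact: part sG GV.
  rewrite EFinM; congr (_ * _)%E.
  have re (f : W -> R) : \sum_a f a = \sum_(i < #|W|) f (enum_val i).
    by rewrite (reindex (@enum_val W predT)) //; apply/onW_bij/enum_val_bij.
  rewrite /S re -sumEFin; apply: eq_bigr => i _.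
  rewrite re -sumEFin; apply: eq_bigr => j _.
  rewrite (_ : [set w | pa (discr w) == enum_val i] `&` _ =
    [set w | (fun x => (pa x == enum_val i) && (fu x == enum_val j)) (discr w)]); last first.
    by apply/seteqP; split => w /= => [[-> ->]|/andP].
  rewrite (Pr_law P fiber_discr (fun x => pa x == enum_val i)).
  rewrite (Pr_law P fiber_discr (fun x => fu x == enum_val j)).
  by rewrite (Pr_law P fiber_discr (fun x => (pa x == enum_val i) && (fu x == enum_val j)))
    -EFinM -EFinB.
rewrite lee_fin -/S; lra.
Qed.

End Discretization.

Section ProcessConcentration.
Context {d} {Omega : measurableType d} {R : realType} (P : probability Omega R).
Variables (c g1 b th m : R) (V : nat -> Omega -> R).
Hypothesis V_meas : forall s, measurable_fun setT (V s).
Hypothesis V_ge0 : forall s w, 0 <= V s w.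
Hypothesis V_tail : forall s (y : R), 0 <= y ->
  (P [set w | (y < V s w)%R] <= (2 * expR (- (b * y `^ th)))%:E)%E.
Hypothesis V_moment4 : forall s, (\int[P]_w (V s w ^+ 4)%:E <= m%:E)%E.
Variable a : R.
Hypothesis V_mean : forall s, (\int[P]_w (V s w)%:E = a%:E)%E.
Hypothesis V_mixing : mixing_rate P c g1 V.

Lemma discr_subweibull_mixing (T N : nat) (h : R) : 0 < h ->
  subweibull_mixing c g1 b th m (law P (discr V T N h)) (discr_val (T:=T) (N:=N) h).
Proof.
move=> h0; split.
- exact: discr_tail.
- exact: discr_moment4.
- exact: discr_mixing.
Qed.

(** Rounding down lowers the mean by at most [h]; above the cap [h * N], which
is at least one, [V s] is at most its fourth power divided by the cap. *)
Lemma discr_mean (T N : nat) (h : R) (s : nat)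
    (e := Ex (law P (discr V T N h)) (discr_val h s)) :
  0 < h -> 1 <= h * N%:R -> (s < T)%N -> e <= a <= e + h + m / (h * N%:R).
Proof.
move=> h0 cap1 sT; set cap := h * N%:R in cap1 *.
have cap0 : 0 < cap by lra.
have eE : (\int[P]_w (discr_val h s (discr V T N h w))%:E = e%:E)%E.
  rewrite integral_law // => [x|x]; first exact: fiber_discr.
  exact: discr_val_ge0.
have mD := measurable_discr_val T N h0 V_meas s.
have mV4 : measurable_fun setT (fun w => V s w ^+ 4) by apply: measurable_funX.
apply/andP; split; rewrite -lee_fin -(V_mean s).
  rewrite -eE; apply: ge0_le_integral => //.
  - by move=> w _; rewrite lee_fin discr_val_ge0.
  - exact/measurable_EFinP.
  - exact/measurable_EFinP.
  - by move=> w _; rewrite lee_fin discr_val_le.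
apply: (@le_trans _ _ (\int[P]_w ((discr_val h s (discr V T N h w))%:E +
   (h%:E + (cap^-1)%:E * (V s w ^+ 4)%:E)))%E).
  apply: ge0_le_integral => //.
  - by move=> w _; rewrite lee_fin.
  - exact/measurable_EFinP.
  - apply: emeasurable_funD; first exact/measurable_EFinP.
    apply: emeasurable_funD; first exact: measurable_cst.
    apply/measurable_EFinP; apply: measurable_funM => //; exact: measurable_cst.
  - move=> w _; rewrite -EFinM -!EFinD lee_fin.
    case: (leP (V s w) cap) => hV.
      have := grid_ge h0 hV.
      have -> : discr_val h s (discr V T N h w) = h * (grid h N (V s w))%:R.
        by rewrite (discr_valE _ (Ordinal sT)) ffunE.
      have : 0 <= cap^-1 * V s w ^+ 4 by rewrite mulr_ge0 ?exprn_ge0 // invr_ge0 ltW.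
      lra.
    have : V s w <= cap^-1 * V s w ^+ 4.
      rewrite mulrC ler_pdivlMr // exprS ler_wpM2l //.
      apply: le_trans (ltW hV) _; rewrite -[leLHS]expr1.
      by rewrite ler_weXn2l //; lra.
    by have := discr_val_ge0 h0 s (discr V T N h w); lra.
rewrite ge0_integralD //; first last.
- apply: emeasurable_funD; first exact: measurable_cst.
  apply/measurable_EFinP; apply: measurable_funM => //; exact: measurable_cst.
- by move=> w _; rewrite -EFinM -EFinD lee_fin addr_ge0 ?mulr_ge0 ?exprn_ge0 ?invr_ge0 // ltW.
- exact/measurable_EFinP.
- by move=> w _; rewrite lee_fin discr_val_ge0.
rewrite eE ge0_integralD //; first last.
- apply/measurable_EFinP; apply: measurable_funM => //; exact: measurable_cst.
- by move=> w _; rewrite -EFinM lee_fin mulr_ge0 ?exprn_ge0 ?invr_ge0 // ltW.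
- by move=> w _; rewrite lee_fin ltW.
rewrite integral_cst //= probability_setT mule1 ge0_integralZl //; first last.
- by rewrite lee_fin invr_ge0 ltW.
- by move=> w _; rewrite lee_fin exprn_ge0.
- exact/measurable_EFinP.
rewrite -addrA EFinD; apply: leeD => //; rewrite EFinD; apply: leeD => //.
rewrite mulrC EFinM.
by apply: lee_wpmul2l; [rewrite lee_fin invr_ge0 ltW | exact: V_moment4].
Qed.

Local Notation g := (tail_exp g1 th).
Variables (G B : R).
Hypothesis b0 : 0 < b.
Hypothesis th0 : 0 < th.
Hypothesis m0 : 0 <= m.
Hypothesis finite_tail : forall (W : finType) (mu : W -> R),
  (forall w, 0 <= mu w) -> \sum_w mu w = 1 ->
  forall D, subweibull_mixing c g1 b th m mu D ->
  forall (n : nat) (y : R), 0 < y -> n%:R <= y `^ (2 - g) ->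
  Pr mu (fun w => y <= csum mu D n w) <= B * (n%:R / y ^+ 2) * expR (- (y `^ g / G)).

Lemma measurable_deviation (T : nat) (x : R) :
  measurable [set w | x <= `|\sum_(0 <= s < T) (V s w - a)|].
Proof.
have mS : measurable_fun setT (fun w => `|\sum_(0 <= s < T) (V s w - a)|).
  apply: measurableT_comp; first exact: normr_measurable.
  apply: measurable_sum => s; apply: measurable_funB => //; exact: measurable_cst.
rewrite -[X in measurable X]setTI.
have -> : [set w | x <= `|\sum_(0 <= s < T) (V s w - a)|] =
    (fun w => `|\sum_(0 <= s < T) (V s w - a)|) @^-1` `[x, +oo[%classic.
  by apply/seteqP; split => w /=; rewrite in_itv /= andbT.
exact: mS.
Qed.

(** The discretised centred sum differs from the original one by at most
[x / 2] unless some value exceeds the cap. The cap is free, so the probability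
of the exceptional event is governed by an independent parameter [z]. *)
Lemma process_tail (T : nat) (x z : R) : 0 < x -> T%:R <= (x / 2) `^ (2 - g) -> 0 <= z ->
  (P [set w | (x <= `|\sum_(0 <= s < T) (V s w - a)|)%R] <=
    (2 * (B * (T%:R / (x / 2) ^+ 2) * expR (- ((x / 2) `^ g / G))) +
     T%:R * (2 * expR (- z)))%:E)%E.
Proof.
have [b0' th0' m0'] := And3 b0 th0 m0.
move=> x0 Tx z0.
have T1 : 0 < T.+1%:R :> R by rewrite ltr0n.
have TT : T%:R <= T.+1%:R :> R by rewrite ler_nat.
pose h : R := x / (8 * T.+1%:R).
have h0 : 0 < h by rewrite divr_gt0 // mulr_gt0.
(* A cap of at least [C] exceeds one, as [discr_mean] requires; it makes a single
exceedance have probability at most [2 * expR (- z)], and it keeps the total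
loss of mean by truncation at most [x / 8]. *)
pose C : R := Num.max 1 (Num.max ((z / b) `^ th^-1) (8 * T.+1%:R * m / x)).
pose N := (Num.truncn (C / h)).+1.
set cap := h * N%:R.
have Ccap : C <= cap by rewrite /cap mulrC -ler_pdivrMr // ltW // truncnS_gt.
have cap1 : 1 <= cap by apply: le_trans Ccap; rewrite /C le_max lexx.
have capz : z <= b * cap `^ th.
  rewrite -ler_pdivrMl // mulrC.
  have -> : z / b = ((z / b) `^ th^-1) `^ th.
    by rewrite -powRrM mulVf ?gt_eqF // powRr1 // divr_ge0 // ltW.
  apply: ge0_ler_powR; rewrite ?nnegrE ?powR_ge0 ?(ltW th0) //; first lra.
  by apply: le_trans Ccap; rewrite /C !le_max lexx !orbT.
have capm : T.+1%:R * (m / cap) <= x / 8.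
  have cp : 0 < cap by lra.
  have : 8 * T.+1%:R * m / x <= cap by apply: le_trans Ccap; rewrite /C !le_max lexx !orbT.
  rewrite mulrA ler_pdivrMr // ler_pdivrMr //; lra.
have hT : T.+1%:R * h = x / 8 by rewrite /h; field; rewrite gt_eqF.
pose de := discr V T N h; pose D := discr_val (T:=T) (N:=N) h.
pose mu := law P de.
have fib : forall y, measurable (de @^-1` [set y]) by exact: fiber_discr.
have mu0 : forall y, 0 <= mu y by exact: law_ge0.
have mu1 : \sum_y mu y = 1 by exact: law_sum1.
have ok : subweibull_mixing c g1 b th m mu D by exact: discr_subweibull_mixing.
have okN := sm_opp mu0 ok.
have x2 : 0 < x / 2 by lra.
have t1 := finite_tail mu0 mu1 ok x2 Tx.
have t2 := finite_tail mu0 mu1 okN x2 Tx.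
pose E1 := [set w | (fun y => x / 2 <= csum mu D T y) (de w)].
pose E2 := [set w | (fun y => x / 2 <= csum mu (fun s y => - D s y) T y) (de w)].
pose E3 := \big[setU/set0]_(s < T) [set w | cap < V s w].
have mE1 : measurable E1 by exact: measurable_image_event.
have mE2 : measurable E2 by exact: measurable_image_event.
have mcap s : measurable [set w | cap < V s w].
  rewrite -[X in measurable X]setTI.
  have -> : [set w | (cap < V s w)%R] = V s @^-1` `]cap, +oo[%classic.
    by apply/seteqP; split => w /=; rewrite in_itv /= andbT.
  exact: V_meas.
have mE3 : measurable E3 by apply: bigsetU_measurable.
have incl : [set w | x <= `|\sum_(0 <= s < T) (V s w - a)|] `<=` (E1 `|` E2) `|` E3.
  move=> w /= xS; case: (pselect (E3 w)) => [|nE3]; first by right.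
  left; have Vcap s : (s < T)%N -> V s w <= cap.
    move=> sT; rewrite leNgt; apply/negP => Vs; apply: nE3.
    by rewrite /E3 -(bigcup_mkord T (fun s => [set w | cap < V s w])); exists s.
  have diff : `|\sum_(0 <= s < T) (V s w - a) - csum mu D T (de w)| <= x / 2.
    rewrite /csum -sumrB; apply: le_trans (ler_norm_sum _ _ _) _.
    apply: le_trans (_ : \sum_(0 <= s < T) (2 * h + m / cap) <= _).
      apply: ler_sum_nat => s /andP[_ sT].
      have /andP[m1 m2] := discr_mean h0 cap1 sT.
      have v2 := grid_ge h0 (Vcap s sT).
      have -> : D s (de w) = h * (grid h N (V s w))%:R.
        by rewrite /D (discr_valE _ (Ordinal sT)) ffunE.
      have v3 := grid_le N h0 (V_ge0 s w).
      have mc : 0 <= m / cap by rewrite divr_ge0 //; lra.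
      rewrite ler_norml; move: m1 m2; rewrite -/cap -/D -/mu => m1 m2.
      by apply/andP; split; lra.
    rewrite big_const_nat subn0 iter_addr_0 -[_ *+ T]mulr_natl.
    have mc0 : 0 <= m / cap by rewrite divr_ge0 //; lra.
    have mc : 0 <= 2 * h + m / cap by lra.
    apply: le_trans (ler_wpM2r mc TT) _; rewrite mulrDr; lra.
  have : x / 2 <= `|csum mu D T (de w)|.
    have := ler_normD (\sum_(0 <= s < T) (V s w - a) - csum mu D T (de w)) (csum mu D T (de w)).
    rewrite subrK; lra.
  rewrite ler_normr => /orP[|]; first by left.
  by right; rewrite /E2 /= csum_opp.
have mE12 : measurable (E1 `|` E2) by exact: measurableU.
apply: (@le_trans _ _ (P ((E1 `|` E2) `|` E3))).
  apply: le_measure incl; rewrite inE; first exact: measurable_deviation.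
  exact: measurableU.
apply: le_trans (measureU2 _ mE12 mE3) _.
rewrite EFinD; apply: leeD.
  apply: le_trans (measureU2 _ mE1 mE2) _.
  rewrite mulr_natl mulr2n EFinD; apply: leeD.
    by rewrite -lee_fin -(Pr_law P fib) in t1.
  by rewrite -lee_fin -(Pr_law P fib) in t2.
apply: le_trans (Boole_inequality P (A := fun s => [set w | cap < V s w]) _) _ => //.
apply: le_trans (_ : (\sum_(s < T) (2 * expR (- z))%:E <= _)%E).
  apply: lee_sum => s _; apply: le_trans (V_tail _ _) _; first lra.
  by rewrite lee_fin ler_pM2l // ler_expR lerN2.
by rewrite sumEFin lee_fin sumr_const card_ord -[_ *+ T]mulr_natl.
Qed.

End ProcessConcentration.

(** * Squares of subweibull variables *)

Section PsiNorm.
Context {d} {Omega : measurableType d} {R : realType} (P : probability Omega R).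
Implicit Types U : Omega -> R.

Lemma markov_set (f : Omega -> R) (t : R) (A : set Omega) : 0 < t ->
  measurable_fun setT f -> (forall w, 0 <= f w) -> measurable A ->
  (forall w, A w -> t <= f w) -> (t%:E * P A <= \int[P]_w (f w)%:E)%E.
Proof.
move=> t0 mf f0 mA Af.
rewrite -{1}(setIT A) -integral_indic // -(integralZl_indic measurableT (fun=> A)) //.
  apply: ge0_le_integral => //.
  - by move=> w _; rewrite lee_fin mulr_ge0 // ltW.
  - by apply/measurable_EFinP; apply: measurable_funM; [exact: measurable_cst | exact: measurable_indic].
  - exact/measurable_EFinP.
  - move=> w _; rewrite lee_fin indicE.
    by case: (boolP (w \in A)) => [/set_mem /Af|_]; rewrite ?mulr1 ?mulr0.
by rewrite ltNge (ltW t0).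
Qed.

Lemma psi_norm_moment (g K r : R) U : (psi_norm P g U <= K%:E)%E -> 1 <= r ->
  (\int[P]_w (`|U w| `^ r)%:E <= ((K * r `^ g^-1) `^ r)%:E)%E.
Proof.
move=> UK r1; have r0 : 0 < r by lra.
have c0 : 0 < r `^ (- g^-1) by rewrite powR_gt0.
have H : ('N[P]_r%:E [EFin \o U] * (r `^ (- g^-1))%:E <= K%:E)%E.
  by apply: le_trans UK; apply: ereal_sup_ubound => /=; exists r.
have E : (\int[P]_w (`|U w| `^ r)%:E)%E = ('N[P]_r%:E [EFin \o U] `^ r)%E.
  by rewrite poweR_Lnorm ?gt_eqF //.
rewrite E -poweR_EFin.
have N0 := Lnorm_ge0 P r%:E (EFin \o U).
have NK : ('N[P]_r%:E [EFin \o U] <= (K * r `^ g^-1)%:E)%E.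
  by move: H; rewrite -lee_pdivlMr // -EFinM powRN invrK.
apply: gt0_ler_poweR => //; first exact: ltW.
  by rewrite in_itv /= N0 /= leey.
by rewrite in_itv /= (le_trans N0 NK) /= leey.
Qed.

Lemma psi_norm_ge0 (g K : R) U : (psi_norm P g U <= K%:E)%E -> 0 <= K.
Proof.
move=> UK; have H : ('N[P]_1%:E [EFin \o U] * (1 `^ (- g^-1))%:E <= K%:E)%E.
  by apply: le_trans UK; apply: ereal_sup_ubound => /=; exists 1 => //=.
rewrite -lee_fin; apply: le_trans H; rewrite powR1 mule1; exact: Lnorm_ge0.
Qed.

Variables (g2 KX : R) (U : Omega -> R).
Hypothesis g20 : 0 < g2.
Hypothesis KX0 : 0 < KX.
Hypothesis mU : measurable_fun setT U.
Hypothesis UK : (psi_norm P g2 U <= KX%:E)%E.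
Let K : R := 2 `^ (2 / g2) * KX ^+ 2.
Let V w := U w ^+ 2 / K.

Lemma sq_scale_gt0 : 0 < K.
Proof. by rewrite mulr_gt0 ?powR_gt0 ?exprn_gt0. Qed.

Lemma measurable_sq_scaled : measurable_fun setT V.
Proof.
apply: measurable_funM; last exact: measurable_cst.
exact: measurable_funX.
Qed.

(** Markov's inequality for the moment of order [2 * q] of [U], where the
exponent [q = expR (- (g2 / 2)) * y `^ (g2 / 2)] is the optimal one. The bound
on the moment needs [2 * q >= 1]; otherwise the right-hand side exceeds one. *)
Lemma sq_scaled_tail (y : R) : 0 <= y ->
  (P [set w | (y < V w)%R] <= (2 * expR (- (expR (- (g2 / 2)) * y `^ (g2 / 2))))%:E)%E.
Proof.
have [g0 k0] := conj g20 KX0; have K0 := sq_scale_gt0.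
have th0 : 0 < g2 / 2 by rewrite divr_gt0.
have mA : measurable [set w | y < V w].
  rewrite -[X in measurable X]setTI.
  have -> : [set w | (y < V w)%R] = V @^-1` `]y, +oo[%classic.
    by apply/seteqP; split => w /=; rewrite in_itv /= andbT.
  exact: measurable_sq_scaled.
move=> y0.
pose q : R := expR (- (g2 / 2)) * y `^ (g2 / 2).
have triv : q < 2^-1 -> (P [set w | (y < V w)%R] <= (2 * expR (- q))%:E)%E.
  move=> hq; apply: le_trans (probability_le1 P mA) _.
  by rewrite lee_fin; have := expR_ge1Dx (- q); lra.
rewrite -/q; case: (ltP q 2^-1) => // hq.
have yp : 0 < y.
  rewrite lt_neqAle y0 andbT; apply/eqP => yE.
  by move: hq; rewrite /q -yE powR0 ?gt_eqF // mulr0; lra.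
have qp : 0 < q by lra.
pose r : R := 2 * q; have r1 : 1 <= r by rewrite /r; lra.
have r0 : 0 < r by lra.
have t0 : 0 < (K * y) `^ q by rewrite powR_gt0 // mulr_gt0.
have M := psi_norm_moment UK r1.
have := @markov_set (fun w => `|U w| `^ r) ((K * y) `^ q) [set w | y < V w] t0 _ _ mA _.
move=> /(_ _ _ _) H.
have {H} H : (((K * y) `^ q)%:E * P [set w | (y < V w)%R] <= \int[P]_w (`|U w| `^ r)%:E)%E.
  apply: H.
  - apply: (measurableT_comp (measurable_powR r)).
    by apply: measurableT_comp => //; exact: normr_measurable.
  - by move=> w; exact: powR_ge0.
  - move=> w /= yV; rewrite /r powRrM.
    apply: ge0_ler_powR; rewrite ?nnegrE ?powR_ge0 ?(mulr_ge0 (ltW K0) y0) ?(ltW qp) //.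
    have -> : `|U w| `^ 2 = U w ^+ 2.
      by rewrite powR_mulrn // -normrX ger0_norm // sqr_ge0.
    by move: yV; rewrite ltr_pdivlMr // mulrC => /ltW.
have {M} := le_trans H M.
rewrite muleC -lee_pdivlMr // => /le_trans; apply.
rewrite -EFinM lee_fin.
have qe : y `^ (g2 / 2) = expR (g2 / 2) * q.
  by rewrite /q mulrA expRxMexpNx_1 mul1r.
have ye : y = expR 1 * q `^ (g2 / 2)^-1.
  have -> : y = (y `^ (g2 / 2)) `^ (g2 / 2)^-1.
    by rewrite -powRrM mulfV ?gt_eqF // powRr1.
  have q0 : 0 <= q by lra.
  rewrite qe powRM ?expR_ge0 //; congr (_ * _).
  by rewrite -expRM mulfV // gt_eqF.
have -> : (KX * r `^ g2^-1) `^ r = (K * q `^ (g2 / 2)^-1) `^ q.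
  rewrite {2}/r powRrM; congr (_ `^ _).
  have e1 : (r `^ g2^-1) ^+ 2 = r `^ (2 / g2).
    by rewrite -powR_mulrn ?powR_ge0 // -powRrM mulrC.
  rewrite powR_mulrn ?mulr_ge0 ?powR_ge0 ?(ltW KX0) // exprMn e1 /K invf_div.
  by rewrite /r powRM ?(ltW qp) //; ring.
have zp : 0 < q `^ (g2 / 2)^-1 by rewrite powR_gt0.
have Zp : 0 < K * q `^ (g2 / 2)^-1 by rewrite mulr_gt0.
rewrite {1}ye (_ : K * (expR 1 * _) = (K * q `^ (g2 / 2)^-1) * expR 1); last by ring.
move: (K * _) Zp => Z Zp; rewrite [X in _ / X]powRM ?expR_ge0 ?(ltW Zp) //.
rewrite invfM mulrA mulfV ?mul1r ?gt_eqF ?powR_gt0 //.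
rewrite -expRM mul1r -expRN; have := expR_ge0 (- q); lra.
Qed.

Lemma sq_scaled_moment4 :
  (\int[P]_w (V w ^+ 4)%:E <= (((8 : R) `^ g2^-1) ^+ 8 / (2 `^ (2 / g2)) ^+ 4)%:E)%E.
Proof.
have K0 := sq_scale_gt0.
have r1 : 1 <= 8 :> R by lra.
have := psi_norm_moment UK r1.
rewrite powR_mulrn; last by rewrite mulr_ge0 ?powR_ge0 // ltW.
move=> H.
have -> : (\int[P]_w (V w ^+ 4)%:E = \int[P]_w ((K ^+ 4)^-1%:E * (`|U w| `^ 8)%:E))%E.
  apply: eq_integral => w _; rewrite -EFinM; congr (_%:E).
  rewrite powR_mulrn // /V expr_div_n mulrC; congr (_ * _).
  by rewrite -exprM -normrX ger0_norm // exprn_even_ge0.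
rewrite ge0_integralZl //; first last.
- by rewrite lee_fin invr_ge0 exprn_ge0 // ltW.
- apply/measurable_EFinP; apply: (measurableT_comp (measurable_powR 8)).
  by apply: measurableT_comp => //; exact: normr_measurable.
apply: le_trans (lee_wpmul2l _ H) _; first by rewrite lee_fin invr_ge0 exprn_ge0 // ltW.
rewrite -EFinM lee_fin le_eqVlt; apply/orP; left; apply/eqP.
have -> : K ^+ 4 = (2 `^ (2 / g2)) ^+ 4 * KX ^+ 8 by rewrite /K; ring.
rewrite exprMn.
have p : 2 `^ (2 / g2) ^+ 4 != 0 :> R by rewrite gt_eqF // exprn_gt0 // powR_gt0.
have q : KX ^+ 8 != 0 by rewrite gt_eqF // exprn_gt0.
move: p q; move: (2 `^ _ ^+ 4) (KX ^+ 8) (8 `^ _ ^+ 8) => u v w p q.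
by field; rewrite p q.
Qed.

End PsiNorm.

(** * Quadratic forms *)

Section BilinearForm.
Context {R : realType} {n : nat}.
Implicit Types (A B : 'M[R]_n) (x y z : 'cV[R]_n).

Definition bform A x y : R := (x^T *m A *m y) 0 0.

Lemma bformDl A x y z : bform A (x + y) z = bform A x z + bform A y z.
Proof. by rewrite /bform linearD /= !mulmxDl mxE. Qed.

Lemma bformDr A x y z : bform A x (y + z) = bform A x y + bform A x z.
Proof. by rewrite /bform mulmxDr mxE. Qed.

Lemma bformZl A a x y : bform A (a *: x) y = a * bform A x y.
Proof. by rewrite /bform linearZ /= -!scalemxAl mxE. Qed.

Lemma bformZr A a x y : bform A x (a *: y) = a * bform A x y.
Proof. by rewrite /bform -scalemxAr mxE. Qed.

Lemma bform_suml A I (r : seq I) (F : I -> 'cV[R]_n) y :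
  bform A (\sum_(i <- r) F i) y = \sum_(i <- r) bform A (F i) y.
Proof.
elim: r => [|i r IH]; last by rewrite !big_cons bformDl IH.
by rewrite !big_nil /bform trmx0 !mul0mx mxE.
Qed.

Lemma bformC A x y : A^T = A -> bform A x y = bform A y x.
Proof.
move=> AT; rewrite /bform.
have -> : x^T *m A *m y = (y^T *m A *m x)^T by rewrite !trmx_mul trmxK AT mulmxA.
by rewrite mxE.
Qed.

Lemma bformDA A B x y : bform (A + B) x y = bform A x y + bform B x y.
Proof. by rewrite /bform mulmxDr mulmxDl mxE. Qed.

Lemma bformNA A x y : bform (- A) x y = - bform A x y.
Proof. by rewrite /bform mulmxN mulNmx mxE. Qed.

Lemma bform_scalar a x : bform a%:M x x = a * l2norm x ^+ 2.
Proof.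
rewrite /bform mul_mx_scalar -scalemxAl mxE; congr (_ * _).
rewrite /l2norm sqr_sqrtr; last by apply: sumr_ge0 => i _; exact: sqr_ge0.
by rewrite mxE; apply: eq_bigr => i _; rewrite mxE expr2.
Qed.

Lemma bform_delta A j : bform A (delta_mx j 0) (delta_mx j 0) = A j j.
Proof. by rewrite /bform trmx_delta -rowE -colE !mxE. Qed.

Lemma bformE A x y : bform A x y = \sum_i \sum_j x i 0 * A i j * y j 0.
Proof.
rewrite /bform mxE exchange_big /=; apply: eq_bigr => j _.
by rewrite mxE mulr_suml; apply: eq_bigr => i _; rewrite mxE.
Qed.

Lemma l2norm_sqrE x : l2norm x ^+ 2 = \sum_i x i 0 ^+ 2.
Proof. by rewrite sqr_sqrtr //; apply: sumr_ge0 => i _; exact: sqr_ge0. Qed.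

Lemma l2norm_eq0 x : l2norm x ^+ 2 = 0 -> x = 0.
Proof.
rewrite l2norm_sqrE => /eqP; rewrite psumr_eq0; last by move=> i _; exact: sqr_ge0.
move=> /allP H; apply/matrixP => i j; rewrite ord1 mxE.
by have := H i (mem_index_enum i); rewrite /= sqrf_eq0 => /eqP.
Qed.

End BilinearForm.

(** * Sparsification *)

Section Sparsification.
Context {R : realType} {p : nat}.

Definition sign_vec (e : 'I_p * bool) : 'cV[R]_p := (-1) ^+ e.2 *: delta_mx e.1 0.
Definition signed_sum (t : seq ('I_p * bool)) : 'cV[R]_p := \sum_(e <- t) sign_vec e.

Variables (B : 'M[R]_p) (v : 'cV[R]_p).
Hypothesis B_sym : B^T = B.

(** For weights [`|v j 0|] of sum one, the mean of the form at [z] plus [d]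
independent random signed basis vectors, as an iterated finite sum. *)
Fixpoint walk_mean (d : nat) (z : 'cV[R]_p) : R :=
  if d is d'.+1 then \sum_j `|v j 0| * walk_mean d' (z + sign_vec (j, v j 0 < 0))
  else bform B z z.

Lemma walk_mean_ge0 d z :
  (forall t : d.-tuple ('I_p * bool), 0 <= bform B (z + signed_sum t) (z + signed_sum t)) ->
  0 <= walk_mean d z.
Proof.
elim: d z => [|d IH] z H /=.
  by have := H [tuple]; rewrite /signed_sum big_nil addr0.
apply: sumr_ge0 => j _; apply: mulr_ge0 => //; apply: IH => t.
have := H [tuple of (j, v j 0 < 0) :: t].
by rewrite /signed_sum big_cons addrA.
Qed.

Lemma sum_sign_vec : \sum_j `|v j 0| *: sign_vec (j, v j 0 < 0) = v.
Proof.
rewrite [RHS]matrix_sum_delta; apply: eq_bigr => j _.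
rewrite big_ord1 /sign_vec scalerA /=; congr (_ *: _).
by rewrite [RHS]numEsign mulrC.
Qed.

(** One random signed basis vector has mean [v], and the form has mean
[\sum_j `|v j 0| * B j j] at it. By independence the [d * (d - 1)] cross terms
have mean [bform B v v] each. *)
Lemma walk_meanE d z : l1norm v = 1 ->
  walk_mean d z = bform B z z + 2 * d%:R * bform B z v +
    (d%:R * (d%:R - 1)) * bform B v v + d%:R * \sum_j `|v j 0| * B j j.
Proof.
rewrite /l1norm => v1.
have sgn_sq j : bform B (sign_vec (j, v j 0 < 0)) (sign_vec (j, v j 0 < 0)) = B j j.
  by rewrite /sign_vec bformZl bformZr bform_delta mulrA -expr2 sqrr_sign mul1r.
have mean_l x : \sum_j `|v j 0| * bform B (sign_vec (j, v j 0 < 0)) x = bform B v x.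
  rewrite -[in RHS]sum_sign_vec bform_suml; apply: eq_bigr => j _.
  by rewrite [RHS]bformZl.
elim: d z => [|d IH] z /=; first by rewrite !mulr0 !mul0r !addr0.
under eq_bigr do rewrite IH.
transitivity (\sum_j (`|v j 0| * (bform B z z + 2 * d%:R * bform B z v +
    d%:R * (d%:R - 1) * bform B v v + d%:R * \sum_k `|v k 0| * B k k) +
   (2 * (`|v j 0| * bform B (sign_vec (j, v j 0 < 0)) z) +
    (2 * d%:R * (`|v j 0| * bform B (sign_vec (j, v j 0 < 0)) v) +
     `|v j 0| * B j j)))).
  apply: eq_bigr => j _; rewrite -sgn_sq.
  rewrite !bformDl !bformDr [bform B z (sign_vec _)]bformC //.
  by ring.
rewrite !big_split /= -mulr_suml v1 mul1r -2!mulr_sumr !mean_l.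
rewrite [bform B v z]bformC // -[d.+1%:R]natr1.
by ring.
Qed.

End Sparsification.

(** Maurey's empirical method. The form of [A + de] is nonnegative at sums of [d]
signed basis vectors, hence in the mean over the random sums built from
[v / l1norm v]; the cross terms reproduce the form at [v], and the diagonal
terms, at most [2 * de] each, are the price. *)
Lemma sparse_to_all (R : realType) (p d : nat) (A : 'M[R]_p) (de : R) (v : 'cV[R]_p) :
  A^T = A -> (1 < d)%N -> 0 <= de ->
  (forall t : d.-tuple ('I_p * bool),
     - de * l2norm (signed_sum (R:=R) t) ^+ 2 <= bform A (signed_sum t) (signed_sum t)) ->
  (forall j, A j j <= de) ->
  - de * l2norm v ^+ 2 - 2 * de / (d%:R - 1) * l1norm v ^+ 2 <= bform A v v.
Proof.
move=> AT d1 de0 sparse diag.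
have dp : 0 < d%:R - 1 :> R by rewrite subr_gt0 ltr1n.
have [N0|N0] := eqVneq (l1norm v) 0.
  have -> : v = 0.
    apply/matrixP => i j; rewrite ord1 mxE; move/eqP: N0.
    rewrite /l1norm psumr_eq0 // => /allP /(_ i (mem_index_enum i)).
    by rewrite normr_eq0 => /eqP.
  rewrite -[bform A 0 0]mul1r -(scale0r (0 : 'cV[R]_p)) bformZl mul0r mulr0.
  rewrite scale0r /l1norm big1 ?expr0n ?mulr0 ?subr0; last by move=> i _; rewrite mxE normr0.
  by rewrite mulNr oppr_le0 mulr_ge0 // sqr_ge0.
set N := l1norm v in N0 *.
have Np : 0 < N by rewrite lt_def N0 sumr_ge0.
pose B := A + de%:M.
have BT : B^T = B by rewrite linearD /= AT tr_scalar_mx.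
pose w := N^-1 *: v.
have wabs j : `|w j 0| = N^-1 * `|v j 0|.
  by rewrite mxE normrM ger0_norm // invr_ge0 ltW.
have w1 : l1norm w = 1.
  rewrite /l1norm; under eq_bigr do rewrite wabs.
  by rewrite -mulr_sumr mulVf.
have := @walk_mean_ge0 R p B w d 0; rewrite walk_meanE //.
have z0 x : bform B 0 x = 0 by rewrite -(scale0r (0 : 'cV[R]_p)) bformZl mul0r.
rewrite !z0 mulr0 !add0r => H.
have {}H : 0 <= d%:R * (d%:R - 1) * bform B w w + d%:R * \sum_j `|w j 0| * B j j.
  apply: H => t; rewrite add0r /B bformDA bform_scalar.
  by have := sparse t; rewrite mulNr; lra.
have S : \sum_j `|w j 0| * B j j <= 2 * de.
  apply: le_trans (_ : \sum_j `|w j 0| * (2 * de) <= _).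
    apply: ler_sum => j _; rewrite ler_wpM2l // /B !mxE eqxx mulr1n.
    by have := diag j; lra.
  by rewrite -mulr_suml -/(l1norm w) w1 mul1r.
have d0 : 0 < d%:R :> R by rewrite ltr0n; apply: leq_trans d1.
have H2 : - (2 * de) <= (d%:R - 1) * bform B w w.
  rewrite -(ler_pM2l d0).
  have := ler_wpM2l (ltW d0) S.
  move: H; rewrite -mulrA; lra.
have E : bform B w w = (bform A v v + de * l2norm v ^+ 2) / N ^+ 2.
  rewrite /w bformZl bformZr /B bformDA bform_scalar.
  by field.
move: H2; rewrite E mulrA -(ler_pM2r (exprn_gt0 2 Np)) divfK ?expf_neq0 //.
move=> H2; rewrite -(ler_pM2l dp).
have -> : (d%:R - 1) * (- de * l2norm v ^+ 2 - 2 * de / (d%:R - 1) * N ^+ 2) =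
   (d%:R - 1) * (- de * l2norm v ^+ 2) - 2 * de * N ^+ 2.
  by field; rewrite gt_eqF.
move: H2; lra.
Qed.

(** * The smallest eigenvalue as a minimum of Rayleigh quotients *)

Lemma cvg_sumr (R : realType) (I T : Type) (F : set_system T) (r : seq I)
    (f : I -> T -> R) (l : I -> R) : Filter F ->
  (forall i, f i x @[x --> F] --> l i) ->
  (\sum_(i <- r) f i x) @[x --> F] --> \sum_(i <- r) l i.
Proof. by move=> FF fl; apply: cvg_big => //; exact: add_continuous. Qed.

Section Rayleigh.
Context {R : realType} {n : nat}.
Variable A : 'M[R]_n.
Hypothesis A_sym : A^T = A.
Let q (x : 'rV[R]_n) : R := bform A x^T x^T.
Let s (x : 'rV[R]_n) : R := l2norm x^T ^+ 2.

Lemma continuous_quadratic (C : 'M[R]_n) : continuous (fun x : 'rV[R]_n => bform C x^T x^T).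
Proof.
have -> : (fun x : 'rV[R]_n => bform C x^T x^T) =
    (fun x : 'rV[R]_n => \sum_i \sum_j x 0 i * C i j * x 0 j).
  apply/funext => x; rewrite bformE; apply: eq_bigr => i _; apply: eq_bigr => j _.
  by rewrite !mxE.
move=> x; apply: (@cvg_sumr _ _ _ (nbhs x)) => i; apply: (@cvg_sumr _ _ _ (nbhs x)) => j.
have co k : (fun y : 'rV[R]_n => y 0 k) y @[y --> nbhs x] --> x 0 k.
  exact: coord_continuous.
by apply: cvgM (co j); apply: cvgM (co i) _; exact: cvg_cst.
Qed.

(** Compactness of the unit sphere, and homogeneity for the other vectors. *)
Lemma rayleigh_min : (0 < n)%N -> exists c : 'rV[R]_n,
  c != 0 /\ forall x, q c * s x <= q x * s c.
Proof.
move=> n0.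
have sE x : s x = bform 1%:M x^T x^T by rewrite bform_scalar mul1r.
have sZ a x : s (a *: x) = a ^+ 2 * s x.
  by rewrite !sE linearZ /= bformZl bformZr mulrA expr2.
have qZ a x : q (a *: x) = a ^+ 2 * q x.
  by rewrite /q linearZ /= bformZl bformZr mulrA expr2.
have s0 x : x != 0 -> 0 < s x.
  move=> x0; rewrite lt_def sqr_ge0 andbT; apply: contra_neq x0 => h.
  by apply: trmx_inj; rewrite trmx0; apply: l2norm_eq0.
pose S : set 'rV[R]_n := [set x | s x = 1].
have S0 : S !=set0.
  pose x0 : 'rV[R]_n := delta_mx 0 (Ordinal n0).
  exists x0; rewrite /S /= sE trmx_delta bform_delta.
  by rewrite mxE eqxx.
have cs : continuous s.
  by rewrite (_ : s = fun x => bform 1%:M x^T x^T); [exact: continuous_quadratic | apply/funext].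
have Sc : closed S.
  rewrite (_ : S = s @^-1` [set 1]) //.
  by apply: preimage_closed; [move=> x _; exact: cs | exact: closed_eq].
have Sb : bounded_set S.
  exists 1; split; first exact: num_real.
  move=> M M1 x Sx; rewrite /Num.norm /= mx_normrE; apply: bigmax_le => [|[i j] _ /=].
    by apply: le_trans (ltW M1).
  apply: le_trans (ltW M1); rewrite ord1 -(@expr_le1 _ 2) // -normrX ger0_norm ?sqr_ge0 //.
  rewrite -[leRHS]Sx /s l2norm_sqrE (bigD1 j) //= mxE lerDl.
  by apply: sumr_ge0 => k _; exact: sqr_ge0.
have cq : {within S, continuous q} by apply: continuous_subspaceT; exact: continuous_quadratic.
have [c cS cmin] := EVT_min_rV S0 (bounded_closed_compact Sb Sc) cq.
have {}cS : s c = 1 by move/set_mem: cS.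
exists c; split.
  apply/eqP => c0; move: cS; rewrite c0 -(scale0r (0 : 'rV_n)) sZ expr0n mul0r.
  by move/eqP; rewrite eq_sym oner_eq0.
move=> x; rewrite cS mulr1.
have [->|x0] := eqVneq x 0.
  by rewrite -(scale0r (0 : 'rV_n)) sZ qZ expr0n !mul0r mulr0.
have sx := s0 _ x0.
pose a := (Num.sqrt (s x))^-1.
have a2 : a ^+ 2 = (s x)^-1 by rewrite exprVn sqr_sqrtr // ltW.
have := cmin (a *: x); rewrite inE /S /= sZ qZ a2 mulVf ?gt_eqF // => /(_ erefl).
by rewrite mulrC ler_pdivlMr.
Qed.

(** The form of [A - mu] is nonnegative and vanishes at [c]; its first
variation at [c] in the direction [c A - mu c] is twice the squared norm of that
vector, which must therefore be zero. *)
Lemma rayleigh_eigenvalue (c : 'rV[R]_n) : c != 0 ->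
  (forall x, q c * s x <= q x * s c) -> eigenvalue A (q c / s c).
Proof.
move=> c0 cmin.
have sp : 0 < s c.
  rewrite lt_def sqr_ge0 andbT; apply: contra_neq c0 => h.
  by apply: trmx_inj; rewrite trmx0; apply: l2norm_eq0.
set mu := q c / s c.
apply/eigenvalueP; exists c => //; apply/eqP; rewrite -subr_eq0; apply/eqP.
set r := _ - _.
pose C := A - mu%:M.
have CT : C^T = C by rewrite linearB /= A_sym tr_scalar_mx.
have Cx (x : 'rV[R]_n) : bform C x^T x^T = q x - mu * s x.
  by rewrite /C bformDA bformNA bform_scalar.
have C0 (x : 'rV[R]_n) : 0 <= bform C x^T x^T.
  rewrite Cx subr_ge0 /mu mulrAC ler_pdivrMr //; exact: cmin.
have Cc : bform C c^T c^T = 0 by rewrite Cx /mu divfK ?subrr // gt_eqF.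
have Ccr : bform C c^T r^T = s r.
  rewrite /bform trmxK /C mulmxBr mul_mx_scalar -/r.
  by rewrite /s l2norm_sqrE mxE; apply: eq_bigr => i _; rewrite !mxE expr2.
have key e : 0 <= 2 * e * s r + e ^+ 2 * bform C r^T r^T.
  have := C0 (c + e *: r); rewrite linearD linearZ /=.
  rewrite bformDl !bformDr !bformZl !bformZr Cc [bform C r^T c^T]bformC // Ccr.
  by move/le_trans; apply; rewrite le_eqVlt; apply/orP; left; apply/eqP; ring.
apply: trmx_inj; rewrite trmx0; apply: l2norm_eq0; rewrite -/(s r).
have sr : 0 <= s r by exact: sqr_ge0.
apply/eqP; rewrite eq_le sr andbT leNgt; apply/negP => srp.
set k := bform C r^T r^T in key.
have k0 : 0 <= k by exact: C0.
have k1 : 0 < k + 1 by lra.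
have := key (- (s r / (k + 1))).
set e := s r / (k + 1).
have e0 : 0 < e by rewrite divr_gt0.
have ek : e * k <= s r by rewrite /e mulrAC ler_pdivrMr // ler_wpM2l //; lra.
have := ler_wpM2l (ltW e0) ek; have := mulr_gt0 e0 srp.
nra.
Qed.

End Rayleigh.

Lemma posdef_bform (R : realType) n (A : 'M[R]_n) (x : 'cV[R]_n) :
  posdef A -> x != 0 -> 0 < bform A x x.
Proof. by case=> _; apply. Qed.

Lemma lambda_min_rayleigh (R : realType) n (A : 'M[R]_n) : (0 < n)%N -> posdef A ->
  0 < lambda_min A /\ forall x, lambda_min A * l2norm x ^+ 2 <= bform A x x.
Proof.
move=> n0 pA; have AT : A^T = A by case: pA.
have [c [c0 cmin]] := rayleigh_min A n0.
have ev := rayleigh_eigenvalue AT c0 cmin.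
have cT : c^T != 0 by rewrite -(inj_eq trmx_inj) trmxK trmx0.
have sp : 0 < l2norm c^T ^+ 2.
  by rewrite lt_def sqr_ge0 andbT; apply: contra_neq cT; exact: l2norm_eq0.
set mu := _ / _ in ev.
have mu0 : 0 < mu by rewrite divr_gt0 // posdef_bform.
have lb : lbound [set a : R | eigenvalue A a] mu.
  move=> a /= /eigenvalueP[x xA x0].
  have xT : x^T != 0 by rewrite -(inj_eq trmx_inj) trmxK trmx0.
  have xs : 0 < l2norm x^T ^+ 2.
    by rewrite lt_def sqr_ge0 andbT; apply: contra_neq xT; exact: l2norm_eq0.
  have qx : bform A x^T x^T = a * l2norm x^T ^+ 2.
    rewrite /bform trmxK xA -scalemxAl mxE; congr (_ * _).
    by rewrite l2norm_sqrE mxE; apply: eq_bigr => i _; rewrite !mxE expr2.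
  rewrite /mu ler_pdivrMr //; have := cmin x; rewrite qx.
  by rewrite mulrAC ler_pM2r.
have E : lambda_min A = mu.
  apply/eqP; rewrite eq_le; apply/andP; split.
    by apply: ge_inf => //; exists mu.
  by apply: lb_le_inf => //; exists mu.
rewrite E; split => // x.
have := cmin x^T; rewrite trmxK => h.
by rewrite /mu mulrAC ler_pdivrMr.
Qed.

(** * Projections of a stationary mixing process *)

Section Projections.
Context {d} {Omega : measurableType d} {R : realType} (P : probability Omega R).
Variables (p q : nat) (X : int -> {RV P >-> p.-tuple R}) (Y : int -> {RV P >-> q.-tuple R}).

Lemma projE (u : 'cV[R]_p) (Z : Omega -> p.-tuple R) w :
  Defs.proj u Z w = \sum_i u i 0 * tnth (Z w) i.
Proof. by rewrite /Defs.proj mxE; apply: eq_bigr => i _; rewrite !mxE. Qed.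

Lemma measurable_coord t (i : 'I_p) : measurable_fun setT (fun w => tnth (X t w) i).
Proof. by apply: (measurableT_comp (measurable_tnth i)). Qed.

Lemma measurable_dot (u : 'cV[R]_p) :
  measurable_fun setT (fun x : p.-tuple R => \sum_i u i 0 * tnth x i).
Proof.
apply: measurable_sum => i; apply: measurable_funM; first exact: measurable_cst.
exact: measurable_tnth.
Qed.

Lemma measurable_proj (u : 'cV[R]_p) t : measurable_fun setT (Defs.proj u (X t)).
Proof.
rewrite (_ : Defs.proj u (X t) = (fun x : p.-tuple R => \sum_i u i 0 * tnth x i) \o X t).
  by apply: measurableT_comp; [exact: measurable_dot | ].
by apply/funext => w; rewrite /= projE.
Qed.

(** ** Second moments *)

Section SecondMoment.
Variables (g2 KX : R) (t : int).
Hypothesis XK : (psi_norm_vec P g2 (X t) <= KX%:E)%E.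

Lemma psi_norm_proj (u : 'cV[R]_p) : l2norm u = 1 ->
  (psi_norm P g2 (Defs.proj u (X t)) <= KX%:E)%E.
Proof. by move=> u1; apply: le_trans XK; apply: ereal_sup_ubound => /=; exists u. Qed.

(** A coordinate is the projection on a unit vector, so the psi-norm bounds its
second moment. *)
Lemma integrable_coord_sqr (i : 'I_p) :
  P.-integrable setT (fun w => (tnth (X t w) i ^+ 2)%:E).
Proof.
pose u : 'cV[R]_p := delta_mx i 0.
have u1 : l2norm u = 1.
  rewrite /l2norm (bigD1 i) //= mxE !eqxx expr1n big1 ?addr0 ?sqrtr1 // => j ji.
  by rewrite mxE (negPf ji) expr0n.
have uE w : Defs.proj u (X t) w = tnth (X t w) i.
  rewrite projE (bigD1 i) //= mxE !eqxx mul1r big1 ?addr0 // => j ji.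
  by rewrite mxE (negPf ji) mul0r.
have r1 : 1 <= 2 :> R by lra.
have M := psi_norm_moment (psi_norm_proj u1) r1.
have mc := measurable_coord t i.
apply/integrableP; split; first by apply/measurable_EFinP; apply: measurable_funX.
apply: (le_lt_trans _ (ltry ((KX * 2 `^ g2^-1) `^ 2))); apply: le_trans M.
rewrite le_eqVlt; apply/orP; left; apply/eqP; apply: eq_integral => w _.
by rewrite uE /= powR_mulrn // -normrX.
Qed.

Lemma integrable_coord_mul (i j : 'I_p) :
  P.-integrable setT (fun w => (tnth (X t w) i * tnth (X t w) j)%:E).
Proof.
have := integrableD measurableT (integrable_coord_sqr i) (integrable_coord_sqr j).
apply: le_integrable => //.
  by apply/measurable_EFinP; apply: measurable_funM; exact: measurable_coord.
move=> w _ /=; rewrite lee_fin [leRHS]ger0_norm ?addr_ge0 ?sqr_ge0 //.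
rewrite ler_norml.
have := sqr_ge0 (tnth (X t w) i - tnth (X t w) j).
have := sqr_ge0 (tnth (X t w) i + tnth (X t w) j).
have := sqr_ge0 (tnth (X t w) i); have := sqr_ge0 (tnth (X t w) j).
by move: (tnth _ i) (tnth _ j) => x y h1 h2 h3 h4; apply/andP; split; lra.
Qed.

Lemma second_moment_proj (u : 'cV[R]_p) :
  (\int[P]_w (Defs.proj u (X t) w ^+ 2)%:E = (bform (second_moment P (X t)) u u)%:E)%E.
Proof.
have E w : (Defs.proj u (X t) w ^+ 2)%:E =
   (\sum_(i < p) \sum_(j < p) (u i 0 * u j 0)%:E * (tnth (X t w) i * tnth (X t w) j)%:E)%E.
  under eq_bigr do (under eq_bigr do rewrite -EFinM; rewrite sumEFin).
  rewrite sumEFin; congr (_%:E).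
  rewrite projE expr2 mulr_suml; apply: eq_bigr => i _.
  by rewrite mulr_sumr; apply: eq_bigr => j _; ring.
have I i j : P.-integrable setT
    (fun w => (u i 0 * u j 0)%:E * (tnth (X t w) i * tnth (X t w) j)%:E)%E.
  by apply: integrableZl => //; exact: integrable_coord_mul.
under eq_integral do rewrite E.
rewrite integral_sum //; last by move=> i; apply: integrable_sum => // j _; exact: I.
rewrite bformE -sumEFin; apply: eq_bigr => i _.
rewrite integral_sum //; rewrite -sumEFin; apply: eq_bigr => j _.
rewrite integralZl //; last exact: integrable_coord_mul.
rewrite mxE unlock [in RHS]mulrAC [in RHS]EFinM fineK //.
apply: integrable_fin_num => //; exact: integrable_coord_mul.
Qed.

End SecondMoment.

(** ** Stationarity *)

Let Z (t : int) (w : Omega) := (X t w, Y t w).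

Hypothesis Z_stat : strictly_stationary P Z.

Lemma stationary_event (t : int) (B : set (p.-tuple R)) : measurable B ->
  P (X 0 @^-1` B) = P (X t @^-1` B).
Proof.
move=> mB.
pose C := [set x : 1.-tuple (p.-tuple R * q.-tuple R)%type | B (tnth x ord0).1].
have mC : measurable C.
  rewrite -[X in measurable X]setTI.
  have mf : measurable_fun setT (fun x : 1.-tuple (p.-tuple R * q.-tuple R)%type =>
      (tnth x ord0).1).
    by apply: (measurableT_comp measurable_fst); exact: measurable_tnth.
  exact: mf.
have := Z_stat (fun _ : 'I_1 => 0) t mC.
rewrite (_ : [set w | C [tuple Z 0 w | i < 1]] = X 0 @^-1` B); last first.
  by apply/seteqP; split => w; rewrite /C /= tnth_mktuple.
rewrite (_ : [set w | C [tuple Z (0 + t) w | i < 1]] = X t @^-1` B) //.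
by apply/seteqP; split => w; rewrite /C /= tnth_mktuple /= add0r.
Qed.

Lemma stationary_integral (t : int) (f : p.-tuple R -> R) :
  measurable_fun setT f -> (forall x, 0 <= f x) ->
  (\int[P]_w (f (X t w))%:E = \int[P]_w (f (X 0 w))%:E)%E.
Proof.
move=> mf f0.
have push s : (\int[P]_w (f (X s w))%:E = \int[pushforward P (X s)]_x (f x)%:E)%E.
  rewrite ge0_integral_pushforward //; first by apply/measurable_EFinP.
  by move=> x _; rewrite lee_fin.
rewrite !push; apply: eq_measure_integral => A mA _.
exact/esym/stationary_event.
Qed.

(** ** Mixing *)

(** The index shift makes index [s] of the new sequence correspond to time
[s + 1], the time of row [s] of the design matrix. *)
Lemma mixing_rate_of_beta (c g1 : R) (f : p.-tuple R -> R) :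
  measurable_fun setT f ->
  (forall (t : int) (n : nat), (0 < n)%N ->
    (beta_mixing P Z t n <= (2 * expR (- (c * n%:R `^ g1)))%:E)%E) ->
  mixing_rate P c g1 (fun s w => f (X s.+1%:Z w)).
Proof.
move=> mf beta k l l0.
have gen (I : set int) (t : int) (B : set R) : I t -> measurable B ->
    sigma_process Z I ((fun w => f (X t w)) @^-1` B).
  move=> It mB; apply: sub_gen_smallest; exists t => //.
  exists ((fun z : p.-tuple R * q.-tuple R => f z.1) @^-1` B); last by rewrite setTI.
  rewrite -[X in measurable X]setTI; apply: (measurableT_comp mf) => //.
exists (sigma_process Z [set s | s <= k.+1%:Z]), (sigma_process Z [set s | k.+1%:Z + l%:Z <= s]).
split.
- exact: smallest_sigma_algebra.
- exact: smallest_sigma_algebra.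
- move=> s B sk mB; apply: gen => //=; rewrite lez_nat; lia.
- move=> s B sk mB; apply: gen => //=; rewrite -PoszD lez_nat; lia.
- exact: beta.
Qed.

End Projections.

(** * Choice of the constants *)

(** With [Q = C2 / C1], the second lower bound on [T] is equivalent to
[Q * T <= x `^ (2 - g)], and the first one to [lp <= s]. As
[C1 = 14 * G], the exponent [(x / 2) `^ g / G] is at least [14 * s]. One half
of it absorbs the factor [B + 1]; the other half pays [6 * s] for the number of
directions and leaves [s]. *)
Lemma sample_size_constants (R : realType) (g G B : R) : 0 < g -> g < 1 -> 1 <= G -> 0 < B ->
  exists C1 C2 : R, [/\ 0 < C1, 0 < C2 &
  forall (K lam lp : R) (T : nat), 0 < K -> 0 < lam -> 0 <= lp ->
  54 * K * (2 * C1 * lp) `^ g^-1 / lam <= T%:R ->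
  (54 * K / lam) `^ ((2 - g) / (1 - g)) * (C2 / C1) `^ (1 - g)^-1 <= T%:R ->
  let x : R := T%:R * lam / (54 * K) in
  let s : R := lam `^ g / ((54 * K) `^ g * (2 * C1)) * T%:R `^ g in
  [/\ 0 < T%:R :> R, 2 <= x, T%:R <= (x / 2) `^ (2 - g), 1 <= s /\ lp <= s &
    expR (6 * s) * ((B + 1) * expR (- ((x / 2) `^ g / G))) <= expR (- s)]].
Proof.
move=> g0 g1 G1 B0.
have G0 : 0 < G by lra.
pose L0 : R := 28 * G * (B + 1).
have L00 : 0 < L0 by rewrite !mulr_gt0 //; lra.
pose Q : R := Num.max 4 (L0 `^ ((2 - g) / g)).
have Q4 : 4 <= Q by rewrite /Q le_max lexx.
have Q0 : 0 < Q by lra.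
pose C1 : R := 14 * G.
have C10 : 0 < C1 by rewrite mulr_gt0.
exists C1, (Q * C1); split; rewrite ?mulr_gt0 //.
move=> K lam lp T K0 lam0 lp0 h1 h2 x s.
pose a : R := 54 * K / lam.
have a0 : 0 < a by rewrite divr_gt0 // mulr_gt0.
have QE : Q * C1 / C1 = Q by rewrite mulfK // gt_eqF.
rewrite QE -/a in h2.
have T0 : 0 < T%:R :> R.
  by apply: lt_le_trans h2; rewrite mulr_gt0 ?powR_gt0.
have T1 : 1 <= T%:R :> R by rewrite ler1n -(ltr_nat R).
have xE : x = T%:R / a by rewrite /x /a invf_div mulrA.
have x0 : 0 < x by rewrite xE divr_gt0.
have g2 : 0 < 2 - g by lra.
have xQ : Q * T%:R <= x `^ (2 - g).
  have h3 : a `^ (2 - g) * Q <= T%:R `^ (1 - g).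
    have -> : a `^ (2 - g) * Q = (a `^ ((2 - g) / (1 - g)) * Q `^ (1 - g)^-1) `^ (1 - g).
      rewrite powRM ?powR_ge0 // -!powRrM mulVf ?gt_eqF ?subr_gt0 //.
      by rewrite mulfVK ?gt_eqF ?subr_gt0 // powRr1 // ltW.
    apply: ge0_ler_powR; rewrite ?nnegrE ?mulr_ge0 ?powR_ge0 //; lra.
  have -> : x `^ (2 - g) = T%:R * T%:R `^ (1 - g) / a `^ (2 - g).
    rewrite xE powRM ?ler0n ?invr_ge0 ?(ltW a0) //; congr (_ * _).
      have -> : 2 - g = 1 + (1 - g) by lra.
      by rewrite powRD ?powRr1 ?ler0n //; apply/implyP => _; rewrite gt_eqF.
    by rewrite -powR_inv1 ?(ltW a0) // -powRrM mulN1r powRN.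
  rewrite ler_pdivlMr ?powR_gt0 //.
  by have := ler_wpM2l (ltW T0) h3; lra.
pose La : R := x `^ g.
have sE : s = La / (2 * C1).
  have K54 : 0 <= 54 * K by rewrite mulr_ge0 // ltW.
  have pV : ((54 * K)^-1) `^ g = ((54 * K) `^ g)^-1.
    by rewrite -powR_inv1 // -powRrM mulN1r powRN.
  have -> : La = T%:R `^ g * lam `^ g / (54 * K) `^ g.
    rewrite /La /x powRM ?invr_ge0 // ?mulr_ge0 // ?(ltW lam0) //.
    by rewrite powRM ?ler0n ?(ltW lam0) // pV.
  by rewrite /s invfM; ring.
have LaL : L0 <= La.
  have e1 : L0 = (L0 `^ ((2 - g) / g)) `^ (g / (2 - g)).
    rewrite -powRrM (_ : _ * _ = 1) ?powRr1 // ?(ltW L00) //.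
    by field; rewrite !gt_eqF.
  have e2 : La = (x `^ (2 - g)) `^ (g / (2 - g)).
    by rewrite -powRrM mulrCA mulfV ?mulr1 // gt_eqF.
  rewrite e1 e2; apply: ge0_ler_powR; rewrite ?nnegrE ?powR_ge0 ?divr_ge0 ?(ltW g0) ?(ltW g2) //.
  apply: le_trans (_ : Q * T%:R <= _) => //.
  apply: le_trans (_ : Q <= _); first by rewrite /Q le_max lexx orbT.
  by rewrite ler_peMr // ltW.
have x2 : 2 <= x.
  rewrite leNgt; apply/negP => xlt.
  have : x `^ (2 - g) < 4.
    have -> : 4 = 2 `^ 2 :> R by rewrite powR_mulrn //; ring.
    apply: lt_le_trans (_ : 2 `^ (2 - g) <= _).
      by apply: gt0_ltr_powR; rewrite ?nnegrE // ltW.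
    by apply: ler_powR; lra.
  have : 4 * 1 <= Q * T%:R by apply: ler_pM.
  lra.
split => //.
- have -> : (x / 2) `^ (2 - g) = x `^ (2 - g) / 2 `^ (2 - g).
    rewrite powRM ?invr_ge0 ?(ltW x0) //; congr (_ * _).
    by rewrite -powR_inv1 // -powRrM mulN1r powRN.
  rewrite ler_pdivlMr ?powR_gt0 // mulrC; apply: le_trans xQ.
  rewrite ler_pM2r //; apply: le_trans Q4.
  have -> : 4 = 2 `^ 2 :> R by rewrite powR_mulrn //; ring.
  by apply: ler_powR; lra.
- have C1p : 0 < 2 * C1 by rewrite mulr_gt0.
  split.
    rewrite sE ler_pdivlMr // mul1r; apply: le_trans LaL.
    rewrite /C1 /L0; have := mulr_gt0 G0 B0; lra.
  rewrite sE ler_pdivlMr //.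
  have h3 : (2 * C1 * lp) `^ g^-1 <= x.
    by move: h1; rewrite ler_pdivrMr // /x ler_pdivlMr ?mulr_gt0 // mulrC.
  have -> : lp * (2 * C1) = ((2 * C1 * lp) `^ g^-1) `^ g.
    rewrite -powRrM mulVf ?gt_eqF // powRr1 ?mulr_ge0 ?(ltW G0) //.
    by rewrite mulrC.
  by rewrite /La; apply: ge0_ler_powR; rewrite ?nnegrE ?powR_ge0 // ltW.
have hy : La / 2 <= (x / 2) `^ g.
  rewrite powRM ?invr_ge0 ?(ltW x0) //; apply: ler_pM; rewrite ?powR_ge0 //.
  by apply: ger1_powR; lra.
have hG : La / (2 * G) <= (x / 2) `^ g / G.
  by rewrite invfM mulrA ler_wpM2r // invr_ge0 ltW.
have lB : B + 1 <= expR (La / (4 * G)).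
  apply: le_trans (expR_ge1Dx _); rewrite addrC lerD2l ler_pdivlMr ?mulr_gt0 //.
  by apply: le_trans LaL; rewrite /L0; have := mulr_gt0 G0 B0; lra.
apply: le_trans (_ : expR (6 * s) * (expR (La / (4 * G)) * expR (- (La / (2 * G)))) <= _).
  apply: ler_wpM2l; first exact: expR_ge0.
  apply: ler_pM => //; rewrite ?expR_ge0 //; first lra.
  by rewrite ler_expR lerN2.
rewrite -!expRD ler_expR sE /C1 le_eqVlt; apply/orP; left; apply/eqP.
by field; rewrite gt_eqF.
Qed.

(** * Measurability of the restricted eigenvalue event *)

Section RestrictedEigenvalueEvent.
Context {d} {Omega : measurableType d} {R : realType} (P : probability Omega R).
Variables (p : nat) (X : int -> {RV P >-> p.-tuple R}) (T : nat).

Lemma design_norm w (v : 'cV[R]_p) :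
  l2norm (design X T w *m v) ^+ 2 = \sum_(0 <= t < T) Defs.proj v (X t.+1%:Z) w ^+ 2.
Proof.
rewrite l2norm_sqrE big_mkord; apply: eq_bigr => t _; congr (_ ^+ 2).
by rewrite mxE projE; apply: eq_bigr => j _; rewrite mxE mulrC.
Qed.

Definition re_gap (al tau : R) (w : Omega) (v : 'cV[R]_p) : R :=
  T%:R^-1 * l2norm (design X T w *m v) ^+ 2 - (al * l2norm v ^+ 2 - tau * l1norm v ^+ 2).

Lemma measurable_re_gap al tau v : measurable_fun setT (fun w => re_gap al tau w v).
Proof.
rewrite /re_gap; under eq_fun do rewrite design_norm.
apply: measurable_funB; last exact: measurable_cst.
apply: measurable_funM; first exact: measurable_cst.
apply: measurable_sum => t; apply: measurable_funX; exact: measurable_proj.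
Qed.

Definition grid_vec (v : 'cV[R]_p) (n : nat) : 'cV[rat]_p :=
  \col_i ((Num.floor (v i 0 * n.+1%:R))%:~R / n.+1%:R).

Lemma cvg_grid_vec v i : (ratr (grid_vec v n i 0) : R) @[n --> \oo] --> v i 0.
Proof.
have E n : ratr (grid_vec v n i 0) = (Num.floor (v i 0 * n.+1%:R))%:~R / n.+1%:R :> R.
  by rewrite mxE fmorph_div /= ratr_int ratr_nat.
under eq_fun do rewrite E.
have H n : v i 0 - harmonic n <= (Num.floor (v i 0 * n.+1%:R))%:~R / n.+1%:R <= v i 0.
  have n0 : 0 < n.+1%:R :> R by rewrite ltr0n.
  apply/andP; split.
    rewrite /harmonic /= ler_pdivlMr // mulrBl mulVf ?gt_eqF // lerBlDr.
    by rewrite -[1]/(1%:~R) -intrD ltW // floorD1_gt.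
  by rewrite ler_pdivrMr // floor_le.
apply: (@squeeze_cvgr _ _ _ _ (fun n => v i 0 - harmonic n) (fun=> v i 0)).
- by apply: nearW.
- rewrite -[X in _ --> X]subr0; apply: cvgB; [exact: cvg_cst | exact: cvg_harmonic].
- exact: cvg_cst.
Qed.

Lemma cvg_re_gap al tau w v :
  re_gap al tau w (map_mx ratr (grid_vec v n)) @[n --> \oo] --> re_gap al tau w v.
Proof.
have cv i : (map_mx (ratr : rat -> R) (grid_vec v n)) i 0 @[n --> \oo] --> v i 0.
  by under eq_fun do rewrite mxE; apply: cvg_grid_vec.
have sq (u : nat -> R) (l : R) : u n @[n --> \oo] --> l -> u n ^+ 2 @[n --> \oo] --> l ^+ 2.
  by move=> ul; rewrite expr2; under eq_fun do rewrite expr2; apply: cvgM.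
have cp (t : int) : Defs.proj (map_mx ratr (grid_vec v n)) (X t) w @[n --> \oo] --> Defs.proj v (X t) w.
  under eq_fun do rewrite projE.
  rewrite projE; apply: cvg_sumr => i.
  by apply: cvgM; [exact: cv | exact: cvg_cst].
have cd : l2norm (design X T w *m map_mx ratr (grid_vec v n)) ^+ 2 @[n --> \oo] -->
    l2norm (design X T w *m v) ^+ 2.
  under eq_fun do rewrite design_norm.
  by rewrite design_norm; apply: cvg_sumr => t; apply: sq.
have c2 : l2norm (map_mx (ratr : rat -> R) (grid_vec v n)) ^+ 2 @[n --> \oo] --> l2norm v ^+ 2.
  under eq_fun do rewrite l2norm_sqrE.
  by rewrite l2norm_sqrE; apply: cvg_sumr => i; apply: sq.
have c1 : l1norm (map_mx (ratr : rat -> R) (grid_vec v n)) @[n --> \oo] --> l1norm v.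
  by apply: cvg_sumr => i; apply: cvg_norm; exact: cv.
rewrite /re_gap; apply: cvgB; first by apply: cvgM; [exact: cvg_cst | exact: cd].
apply: cvgB; first by apply: cvgM; [exact: cvg_cst | exact: c2].
by apply: cvgM; [exact: cvg_cst | exact: sq].
Qed.

(** By continuity in [v] the event is the countable intersection over vectors
with rational entries. *)
Lemma measurable_re_event al tau : measurable [set w : Omega | forall v : 'cV[R]_p,
    T%:R^-1 * l2norm (design X T w *m v) ^+ 2 >=
    al * l2norm v ^+ 2 - tau * l1norm v ^+ 2].
Proof.
pose F (n : nat) : set Omega := if unpickle n is Some r
  then [set w | 0 <= re_gap al tau w (map_mx ratr (r : 'cV[rat]_p))] else setT.
rewrite (_ : [set w | _] = \bigcap_n F n).
  apply: bigcapT_measurable => n; rewrite /F; case: unpickle => [r|] //.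
  rewrite -[X in measurable X]setTI.
  have -> : [set w | 0 <= re_gap al tau w (map_mx ratr r)] =
     (fun w => re_gap al tau w (map_mx ratr r)) @^-1` `[0, +oo[%classic.
    by apply/seteqP; split => w /=; rewrite in_itv /= andbT.
  exact: measurable_re_gap.
apply/seteqP; split => w /=.
  by move=> H n _; rewrite /F; case: unpickle => //= r; rewrite subr_ge0.
move=> H v; rewrite -subr_ge0 -/(re_gap al tau w v).
rewrite -(cvg_lim _ (@cvg_re_gap al tau w v)) //.
apply: limr_ge; first by apply/cvg_ex; exists (re_gap al tau w v); exact: (@cvg_re_gap al tau w v).
apply: nearW => n; have := H (pickle (grid_vec v n)) I.
by rewrite /F pickleK.
Qed.

End RestrictedEigenvalueEvent.

(** * Deviations in finitely many directions *)

Lemma measure_bigU_le {d} {Omega : measurableType d} {R : realType}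
    (P : probability Omega R) (I : Type) (r : seq I) (F : I -> set Omega) :
  (forall i, measurable (F i)) ->
  measurable (\big[setU/set0]_(i <- r) F i) /\
  (P (\big[setU/set0]_(i <- r) F i) <= \sum_(i <- r) P (F i))%E.
Proof.
move=> mF; split; first by apply: bigsetU_measurable.
elim: r => [|i r IH]; first by rewrite !big_nil measure0.
rewrite !big_cons; apply: le_trans (measureU2 _ _ _) _ => //.
  by apply: bigsetU_measurable.
exact: leeD.
Qed.

Section Directions.
Context {d} {Omega : measurableType d} {R : realType} (P : probability Omega R).
Variables (p q : nat) (X : int -> {RV P >-> p.-tuple R}) (Y : int -> {RV P >-> q.-tuple R}).
Variables (c g1 g2 KX : R).
Let Z (t : int) (w : Omega) := (X t w, Y t w).
Local Notation th := (g2 / 2).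
Local Notation g := (tail_exp g1 th).
Local Notation b := (expR (- (g2 / 2))).
Local Notation m := (((8 : R) `^ g2^-1) ^+ 8 / (2 `^ (2 / g2)) ^+ 4).
Hypothesis g20 : 0 < g2.
Hypothesis KX0 : 0 < KX.
Hypothesis Z_stat : strictly_stationary P Z.
Hypothesis Z_beta : forall (t : int) (n : nat), (0 < n)%N ->
  (beta_mixing P Z t n <= (2 * expR (- (c * n%:R `^ g1)))%:E)%E.
Hypothesis X_psi : forall t : int, (psi_norm_vec P g2 (X t) <= KX%:E)%E.
Variables (G B : R).
Hypothesis finite_tail : forall (W : finType) (mu : W -> R),
  (forall w, 0 <= mu w) -> \sum_w mu w = 1 ->
  forall D, subweibull_mixing c g1 b th m mu D ->
  forall (n : nat) (y : R), 0 < y -> n%:R <= y `^ (2 - g) ->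
  Pr mu (fun w => y <= csum mu D n w) <= B * (n%:R / y ^+ 2) * expR (- (y `^ g / G)).
Let Sigma := second_moment P (X 0).
Let K : R := 2 `^ (2 / g2) * KX ^+ 2.

Definition direction_deviation (T : nat) (u : 'cV[R]_p) (w : Omega) : R :=
  \sum_(0 <= s < T) (Defs.proj u (X s.+1%:Z) w ^+ 2 / K - bform Sigma u u / K).

(** The scaled squares of the projection on [u] satisfy all hypotheses of
[process_tail], with constants that do not depend on [u]. *)
Lemma direction_tail (T : nat) (u : 'cV[R]_p) (x z : R) : l2norm u = 1 ->
  0 < x -> T%:R <= (x / 2) `^ (2 - g) -> 0 <= z ->
  measurable [set w | x <= `|direction_deviation T u w|] /\
  (P [set w | (x <= `|direction_deviation T u w|)%R] <=
    (2 * (B * (T%:R / (x / 2) ^+ 2) * expR (- ((x / 2) `^ g / G))) +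
     T%:R * (2 * expR (- z)))%:E)%E.
Proof.
move=> u1 x0 Tx z0.
have K0 : 0 < K by exact: sq_scale_gt0.
have Xu t : (psi_norm P g2 (Defs.proj u (X t)) <= KX%:E)%E by exact: psi_norm_proj.
pose f (y : p.-tuple R) : R := (\sum_i u i 0 * tnth y i) ^+ 2 / K.
have mf : measurable_fun setT f.
  apply: measurable_funM; last exact: measurable_cst.
  apply: measurable_funX; exact: measurable_dot.
have f0 y : 0 <= f y by rewrite divr_ge0 ?sqr_ge0 // ltW.
have fE t w : f (X t w) = Defs.proj u (X t) w ^+ 2 / K by rewrite /f projE.
pose V (s : nat) (w : Omega) := f (X s.+1%:Z w).
have mV s : measurable_fun setT (V s) by exact: measurableT_comp.
have Vm s : (\int[P]_w (V s w)%:E = (bform Sigma u u / K)%:E)%E.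
  rewrite /V (stationary_integral Z_stat) //.
  under eq_integral do rewrite fE mulrC EFinM.
  rewrite ge0_integralZl //.
  - by rewrite (second_moment_proj (X_psi 0)) -EFinM mulrC.
  - apply/measurable_EFinP; apply: measurable_funX; exact: measurable_proj.
  - by move=> w _; rewrite lee_fin sqr_ge0.
  - by rewrite lee_fin invr_ge0 ltW.
have V0 s w : 0 <= V s w by exact: f0.
have Vt s (y : R) : 0 <= y -> (P [set w | (y < V s w)%R] <= (2 * expR (- (b * y `^ th)))%:E)%E.
  move=> y0; rewrite (_ : [set w | _] = [set w | (y < Defs.proj u (X s.+1%:Z) w ^+ 2 / K)%R]).
    by apply: sq_scaled_tail => //; exact: measurable_proj.
  by apply/seteqP; split => w /=; rewrite /V fE.
have V4 s : (\int[P]_w (V s w ^+ 4)%:E <= m%:E)%E.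
  under eq_integral do rewrite /V fE.
  by apply: sq_scaled_moment4 => //; exact: measurable_proj.
have Vmix := mixing_rate_of_beta (X := X) (Y := Y) mf Z_beta.
have th0 : 0 < th by rewrite divr_gt0.
have m0 : 0 <= m by rewrite divr_ge0 // exprn_ge0 // powR_ge0.
have DE w : direction_deviation T u w = \sum_(0 <= s < T) (V s w - bform Sigma u u / K).
  by apply: eq_bigr => s _; rewrite /V fE.
rewrite (_ : [set w | _] = [set w | x <= `|\sum_(0 <= s < T) (V s w - bform Sigma u u / K)|]).
  split; first exact: measurable_deviation.
  by apply: (process_tail mV V0 Vt V4 Vm Vmix _ th0 m0 finite_tail) => //; exact: expR_gt0.
by apply/seteqP; split => w /=; rewrite DE.
Qed.

End Directions.

Lemma l2norm_unit (R : realType) (p : nat) (z : 'cV[R]_p) : z != 0 ->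
  l2norm ((l2norm z)^-1 *: z) = 1.
Proof.
move=> z0; have zs : 0 < l2norm z ^+ 2.
  by rewrite lt_def sqr_ge0 andbT; apply: contra_neq z0; exact: l2norm_eq0.
have z1 : l2norm z != 0 by move: zs; apply: contraTneq => ->; rewrite expr0n ltxx.
apply/eqP; rewrite -(@eqrXn2 _ 2) ?ler01 ?sqrtr_ge0 // expr1n.
have := bform_scalar 1 ((l2norm z)^-1 *: z); rewrite mul1r => <-.
rewrite bformZl bformZr bform_scalar mul1r mulrA -expr2 exprVn mulVf // expf_neq0 //.
Qed.

Section SampleForm.
Context {R : realType} (p T : nat) (M : 'M[R]_(T, p)).

Definition sample_second_moment : 'M[R]_p := T%:R^-1 *: (M^T *m M).

Lemma sample_second_moment_sym : sample_second_moment^T = sample_second_moment.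
Proof. by rewrite /sample_second_moment linearZ /= trmx_mul trmxK. Qed.

Lemma bform_sample v : bform sample_second_moment v v = T%:R^-1 * l2norm (M *m v) ^+ 2.
Proof.
rewrite /bform /sample_second_moment -scalemxAr -scalemxAl mxE; congr (_ * _).
rewrite mulmxA -trmx_mul -mulmxA l2norm_sqrE mxE.
by apply: eq_bigr => i _; rewrite mxE expr2.
Qed.

End SampleForm.

(** For [p >= 2], [d * ln p] is at most [s + 2 * ln p <= 3 * s], and
[p * 2 <= p ^ 2]. *)
Lemma count_le_exp (R : realType) (p d : nat) (s : R) : (0 < p)%N -> 1 <= s ->
  ln p%:R <= s -> d = (if p == 1%N then 2%N else (Num.truncn (s / ln p%:R)).+2) ->
  ((p * 2) ^ d)%:R <= expR (6 * s).
Proof.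
move=> p0 s1 lps ->.
have pR : 0 < p%:R :> R by rewrite ltr0n.
have e2 : 2 <= expR 1 :> R by have := expR_ge1Dx (1 : R); lra.
case: (eqVneq p 1%N) => [->|p1].
  rewrite mul1n natrX; apply: le_trans (_ : expR 1 ^+ 2 <= _).
    by rewrite lerXn2r ?nnegrE ?expR_ge0.
  by rewrite -expRM_natl ler_expR; lra.
have p2 : (1 < p)%N by rewrite ltn_neqAle eq_sym p1.
have lp : 0 < ln p%:R :> R by rewrite ln_gt0 // ltr1n.
set k := (Num.truncn _).+2.
have sp : 0 <= s / ln p%:R by rewrite divr_ge0 // ?ltW //; lra.
have kle : k%:R * ln p%:R <= 3 * s.
  have h : (Num.truncn (s / ln p%:R))%:R <= s / ln p%:R by rewrite truncn_le.
  rewrite /k -natr1 -natr1.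
  have := ler_wpM2r (ltW lp) h; rewrite divfK ?gt_eqF //; lra.
apply: le_trans (_ : ((p * p) ^ k)%:R <= _).
  by rewrite ler_nat leq_exp2r // leq_mul2l p2 orbT.
rewrite natrX natrM -{1 2}[p%:R]lnK ?posrE // -expRD -expRM_natl ler_expR.
lra.
Qed.

(** * The restricted eigenvalue condition *)

Unset Implicit Arguments.
Set Strict Implicit.

Theorem proposition8 (R : realType) (c gamma1 gamma2 : R)
    (c_gt0 : 0 < c) (gamma1_gt0 : 0 < gamma1) (gamma2_gt0 : 0 < gamma2) :
  let gamma := (gamma1^-1 + 2 / gamma2)^-1 in
  gamma < 1 ->
  exists C1 C2 : R, 0 < C1 /\ 0 < C2 /\
  forall (d : measure_display) (Omega : measurableType d)
    (P : probability Omega R) (p q : nat)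
    (X : int -> {RV P >-> p.-tuple R}) (Y : int -> {RV P >-> q.-tuple R})
    (K_X K_Y : R) (ThetaStar : 'M[R]_(p, q)) (s : nat),
  let Z := fun (t : int) (w : Omega) => (X t w, Y t w) in
  let Sigma_X := second_moment P (X 0) in
  strictly_stationary P Z ->
  (forall (t : int) (i : 'I_p), ('E_P[fun w => tnth (X t w) i] = 0)%E) ->
  (forall (t : int) (i : 'I_q), ('E_P[fun w => tnth (Y t w) i] = 0)%E) ->
  (forall (t : int) (n : nat), (0 < n)%N ->
    (beta_mixing P Z t n <= (2 * expR (- (c * n%:R `^ gamma1)))%:E)%E) ->
  (forall t : int,
    subweibull_vec P gamma2 (X t) /\ (psi_norm_vec P gamma2 (X t) <= K_X%:E)%E) ->
  (forall t : int,
    subweibull_vec P gamma2 (Y t) /\ (psi_norm_vec P gamma2 (Y t) <= K_Y%:E)%E) ->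
  posdef Sigma_X ->
  let theta_risk := risk P (X 0) (Y 0) in
  (forall Theta : 'M[R]_(p, q), (theta_risk ThetaStar <= theta_risk Theta)%E) ->
  nnz ThetaStar = s ->
  let lam := lambda_min Sigma_X in
  let K := 2 `^ (2 / gamma2) * K_X ^+ 2 in
  forall T : nat,
  Num.max
    (54 * K * (2 * C1 * ln p%:R) `^ gamma^-1 / lam)
    ((54 * K / lam) `^ ((2 - gamma) / (1 - gamma)) *
     (C2 / C1) `^ (1 - gamma)^-1) <= T%:R ->
  let ctilde := lam `^ gamma / ((54 * K) `^ gamma * (2 * C1)) in
  let alpha_RE := 2^-1 * lam in
  let tau := alpha_RE / (2 * ctilde) * (ln p%:R / T%:R `^ gamma) in
  let RE_event := [set w : Omega | forall v : 'cV[R]_p,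
    T%:R^-1 * l2norm (design X T w *m v) ^+ 2 >=
    alpha_RE * l2norm v ^+ 2 - tau * l1norm v ^+ 2] in
  ((1 - 2 * T%:R * expR (- (ctilde * T%:R `^ gamma)))%:E <= P RE_event)%E.
Proof.
move=> gamma gamma_lt1.
have gE : gamma = tail_exp gamma1 (gamma2 / 2) by rewrite /gamma /tail_exp invf_div.
have th0 : 0 < gamma2 / 2 by rewrite divr_gt0.
have gamma_gt0 : 0 < gamma by rewrite gE; exact: scale_gamma_gt0.
pose b : R := expR (- (gamma2 / 2)).
pose m : R := ((8 : R) `^ gamma2^-1) ^+ 8 / (2 `^ (2 / gamma2)) ^+ 4.
have b0 : 0 < b by exact: expR_gt0.
have m0 : 0 <= m by rewrite divr_ge0 // exprn_ge0 // powR_ge0.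
have gl : tail_exp gamma1 (gamma2 / 2) < 1 by rewrite -gE.
have [G [B [G1 B0 tail]]] := stretched_exponential_tail c_gt0 gamma1_gt0 b0 th0 m0 gl.
have [C1 [C2 [C10 C20 consts]]] := sample_size_constants gamma_gt0 gamma_lt1 G1 B0.
exists C1, C2; split => //; split => //.
move=> d Omega P p q X Y K_X K_Y ThetaStar s Z Sigma_X Z_stat _ _ Z_beta X_psi _ Sigma_pd
  theta_risk _ _ lam K T T_ge.
pose ctilde := lam `^ gamma / ((54 * K) `^ gamma * (2 * C1)).
pose alpha_RE := 2^-1 * lam.
pose tau := alpha_RE / (2 * ctilde) * (ln p%:R / T%:R `^ gamma).
pose RE_event := [set w : Omega | forall v : 'cV[R]_p,
  T%:R^-1 * l2norm (design X T w *m v) ^+ 2 >=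
  alpha_RE * l2norm v ^+ 2 - tau * l1norm v ^+ 2].
change (is_true ((1 - 2 * T%:R * expR (- (ctilde * T%:R `^ gamma)))%:E <= P RE_event)%E).
have mRE : measurable RE_event by exact: measurable_re_event.
(* In dimension zero the smallest eigenvalue is the infimum of an empty set, but
both sides of the inequality vanish at the only vector. *)
case: (posnP p) => [p0|p_gt0].
  suff -> : RE_event = setT.
    rewrite probability_setT lee_fin lerBlDr lerDl.
    by rewrite mulr_ge0 ?expR_ge0 // mulr_ge0.
  apply/seteqP; split => // w _ v /=.
  have -> : l2norm v = 0.
    by rewrite /l2norm big1 ?sqrtr0 // => i _; have := ltn_ord i; rewrite {2}p0.
  have -> : l1norm v = 0.
    by rewrite /l1norm big1 // => i _; have := ltn_ord i; rewrite {2}p0.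
  by rewrite expr0n !mulr0 subr0 mulr_ge0 ?invr_ge0 // sqr_ge0.
have [lam0 rayleigh] := lambda_min_rayleigh p_gt0 Sigma_pd.
rewrite -/lam in lam0 rayleigh.
have psi t : (psi_norm_vec P gamma2 (X t) <= K_X%:E)%E by case: (X_psi t).
(* A vanishing psi-norm would make the second moment of every projection vanish,
against positive definiteness. *)
have KX0 : 0 < K_X.
  pose u : 'cV[R]_p := delta_mx (Ordinal p_gt0) 0.
  have un : u != 0.
    by apply/eqP => /matrixP /(_ (Ordinal p_gt0) 0); rewrite !mxE eqxx => /eqP; rewrite oner_eq0.
  have u1 : l2norm u = 1.
    by apply/eqP; rewrite -(@eqrXn2 _ 2) ?sqrtr_ge0 // expr1n -[_ ^+ 2]mul1r -bform_scalar
      bform_delta mxE eqxx.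
  have Ku := psi_norm_proj (psi 0) u1.
  have KX0 := psi_norm_ge0 Ku.
  rewrite lt_def KX0 andbT; apply/eqP => KXE.
  have r1 : 1 <= 2 :> R by lra.
  have := psi_norm_moment Ku r1; rewrite KXE mul0r powR0 ?pnatr_eq0 //.
  rewrite (_ : (\int[P]_w _)%E = (\int[P]_w (Defs.proj u (X 0) w ^+ 2)%:E)%E); last first.
    by apply: eq_integral => w _; rewrite powR_mulrn // -normrX ger0_norm // sqr_ge0.
  rewrite (second_moment_proj (psi 0)) lee_fin leNgt => /negP; apply.
  exact: posdef_bform.
have K0 : 0 < K by rewrite mulr_gt0 ?powR_gt0 ?exprn_gt0.
have lnp0 : 0 <= ln p%:R :> R by rewrite ln_ge0 // ler1n.
move: T_ge; rewrite ge_max => /andP[T_ge1 T_ge2].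
have [T0 x2 Tx [s1 lps] expo] := consts K lam (ln p%:R) T K0 lam0 lnp0 T_ge1 T_ge2.
set x : R := T%:R * lam / (54 * K) in x2 Tx expo.
set sz : R := _ * T%:R `^ gamma in s1 lps expo.
have szE : sz = ctilde * T%:R `^ gamma by [].
pose de : R := lam / 54.
have de0 : 0 < de by rewrite divr_gt0.
(* The quantity [ln p] vanishes for [p = 1]; then [tau] is zero and two summands
suffice, because the two norms agree. *)
pose dd := if p == 1%N then 2%N else (Num.truncn (sz / ln p%:R)).+2.
have dd1 : (1 < dd)%N by rewrite /dd; case: ifP.
have x0 : 0 < x by lra.
(* The free parameter of the tail bound is set to the exponent of its main term. *)
pose z : R := (x / 2) `^ gamma / G.
have z0 : 0 <= z by rewrite divr_ge0 ?powR_ge0 //; lra.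
pose I := (dd.-tuple ('I_p * bool))%type.
pose uv (t : I) : 'cV[R]_p := (l2norm (signed_sum (R := R) t))^-1 *: signed_sum t.
pose F (t : I) : set Omega := if signed_sum (R := R) t == 0 then set0
  else [set w | x <= `|direction_deviation X gamma2 K_X T (uv t) w|].
pose bnd : R := 2 * (B * (T%:R / (x / 2) ^+ 2) * expR (- z)) + T%:R * (2 * expR (- z)).
have bnd0 : 0 <= bnd.
  have e0 := expR_ge0 (- z); have y20 : 0 <= T%:R / (x / 2) ^+ 2.
    by rewrite divr_ge0 ?sqr_ge0.
  by apply: addr_ge0; repeat (apply: mulr_ge0 => //); exact: ltW.
have tail' : forall (W : finType) (mu : W -> R),
  (forall w, 0 <= mu w) -> \sum_w mu w = 1 ->
  forall D, subweibull_mixing c gamma1 b (gamma2 / 2) m mu D ->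
  forall (n : nat) (y : R), 0 < y -> n%:R <= y `^ (2 - tail_exp gamma1 (gamma2 / 2)) ->
  Pr mu (fun w => y <= csum mu D n w) <= B * (n%:R / y ^+ 2) *
    expR (- (y `^ (tail_exp gamma1 (gamma2 / 2)) / G)) by exact: tail.
have FP t : measurable (F t) /\ (P (F t) <= bnd%:E)%E.
  rewrite /F; case: eqVneq => [_|tn]; first by rewrite measure0 lee_fin.
  rewrite gE in Tx.
  have := direction_tail gamma2_gt0 KX0 Z_stat Z_beta psi tail' (l2norm_unit tn) x0 Tx z0.
  by rewrite -gE.
have mF t : measurable (F t) by case: (FP t).
have [mN PN] := measure_bigU_le P (index_enum I) mF.
set N := \big[_/_]_(_ <- _) _ in mN PN.
have NRE : ~` N `<=` RE_event.
  move=> w wN v /=.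
  have notF t : ~ F t w.
    move=> Ft; apply: wN; rewrite /N -bigcup_seq; exists t => //=.
    exact: mem_index_enum.
  pose A := sample_second_moment (design X T w) - Sigma_X.
  have AT : A^T = A.
    rewrite linearB /= sample_second_moment_sym; congr (_ - _).
    by case: Sigma_pd.
  have two_sided (t : I) : `|bform A (signed_sum t) (signed_sum t)| <=
      de * l2norm (signed_sum (R := R) t) ^+ 2.
    have [t0|tn] := eqVneq (signed_sum (R := R) t) 0.
      rewrite t0 -[X in bform A X _](scale0r (0 : 'cV[R]_p)) bformZl mul0r normr0.
      by rewrite mulr_ge0 ?sqr_ge0 // ltW.
    have := notF t; rewrite /F (negPf tn) /= => /negP; rewrite -ltNge => dev.
    have Lz : 0 < l2norm (signed_sum (R := R) t).
      rewrite lt_def sqrtr_ge0 andbT; apply: contra_neq tn => e.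
      by apply: l2norm_eq0; rewrite e expr0n.
    have devE : direction_deviation X gamma2 K_X T (uv t) w =
        T%:R / K * bform A (uv t) (uv t).
      rewrite /direction_deviation sumrB -mulr_suml -design_norm.
      rewrite big_const_nat subn0 iter_addr_0 -[_ *+ T]mulr_natl.
      rewrite bformDA bformNA bform_sample -/K -/Sigma_X.
      by field; rewrite !gt_eqF.
    have Au : `|bform A (uv t) (uv t)| <= de.
      move: dev; rewrite devE normrM (ger0_norm (ltW (divr_gt0 T0 K0))).
      have -> : x = T%:R / K * de by rewrite /x /de; field; rewrite gt_eqF.
      by rewrite ltr_pM2l ?divr_gt0 // => /ltW.
    have -> : signed_sum t = l2norm (signed_sum (R := R) t) *: uv t.
      by rewrite /uv scalerA mulfV ?scale1r // gt_eqF.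
    rewrite bformZl bformZr mulrA -expr2 normrM ger0_norm ?sqr_ge0 //.
    rewrite mulrC -/(uv t).
    have -> : l2norm (l2norm (signed_sum t) *: uv t) = l2norm (signed_sum (R := R) t).
      by rewrite /uv scalerA mulfV ?scale1r // gt_eqF.
    by rewrite ler_wpM2r ?sqr_ge0.
  have diag j : A j j <= de.
    pose t : I := [tuple of nseq dd (j, false)].
    have tE : signed_sum (R := R) t = dd%:R *: delta_mx j 0.
      rewrite /signed_sum /= /sign_vec big_nseq iter_addr_0 expr0 scale1r.
      by rewrite scaler_nat.
    have := le_trans (ler_norm _) (two_sided t).
    have -> : l2norm (signed_sum (R := R) t) ^+ 2 = dd%:R ^+ 2.
      rewrite -[LHS]mul1r -bform_scalar tE bformZl bformZr bform_delta mxE eqxx.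
      by rewrite mulr1 expr2.
    rewrite tE bformZl bformZr bform_delta mulrA -expr2 mulrC ler_pM2r //.
    by rewrite exprn_gt0 // ltr0n; apply: leq_trans dd1.
  have := sparse_to_all v AT dd1 (ltW de0)
     (fun t => _ : - de * l2norm (signed_sum (R := R) t) ^+ 2 <= _) diag.
  have low (t : I) : - de * l2norm (signed_sum (R := R) t) ^+ 2 <=
      bform A (signed_sum t) (signed_sum t).
    by rewrite mulNr; have := two_sided t; rewrite ler_norml => /andP[].
  move=> /(_ low); rewrite /A bformDA bformNA bform_sample.
  have := rayleigh v; rewrite -/Sigma_X => ray.
  set S2 := l2norm v ^+ 2 in ray *; set S1 := l1norm v ^+ 2.
  have S20 : 0 <= S2 by exact: sqr_ge0.
  have S10 : 0 <= S1 by exact: sqr_ge0.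
  have lS : 0 <= lam * S2 by rewrite mulr_ge0 // ltW.
  set Q := T%:R^-1 * _; set W := bform Sigma_X v v in ray *.
  suff pen : 2 * de / (dd%:R - 1) * S1 <= tau * S1 + 4^-1 * (lam * S2).
    have -> : - de * S2 = - (54^-1 * (lam * S2)) by rewrite /de; field.
    rewrite /alpha_RE -[2^-1 * lam * S2]mulrA => low_v.
    clear -pen low_v ray lS; lra.
  have [p1|p1] := eqVneq p 1%N.
    have -> : dd = 2%N by rewrite /dd p1 eqxx.
    have S12 : S1 = S2.
      rewrite /S1 /S2 l2norm_sqrE /l1norm.
      clear -p1; subst p; rewrite !big_ord1.
      by rewrite -normrX ger0_norm // sqr_ge0.
    have tau0 : 0 <= tau.
      rewrite /tau /alpha_RE /ctilde !mulr_ge0 ?invr_ge0 ?mulr_ge0 ?powR_ge0 ?invr_ge0 ?mulr_ge0 ?powR_ge0 ?(ltW lam0) ?(ltW C10) //.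
    have -> : 2 * de / (2%:R - 1) = 2 * de by field.
    have := mulr_ge0 tau0 S10; rewrite S12 /de => tS.
    have -> : 2 * (lam / 54) * S2 = 27^-1 * (lam * S2) by field.
    clear -tS lS; lra.
  have p2 : (1 < p)%N by rewrite ltn_neqAle eq_sym p1.
  have lp : 0 < ln p%:R :> R by rewrite ln_gt0 // ltr1n.
  pose xh := sz / ln p%:R.
  have xh0 : 0 < xh by rewrite divr_gt0 // (lt_le_trans ltr01 s1).
  have ddE : xh <= dd%:R - 1.
    rewrite /dd (negPf p1) -natr1 addrK; apply: ltW; exact: truncnS_gt.
  have tauE : tau = lam / (4 * xh).
    have ct0 : 0 < ctilde.
      by rewrite divr_gt0 ?mulr_gt0 ?powR_gt0 ?mulr_gt0.
    have Tg : 0 < T%:R `^ gamma by rewrite powR_gt0.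
    rewrite /tau /alpha_RE /xh szE.
    by clearbody ctilde; field; rewrite !gt_eqF.
  have : 2 * de / (dd%:R - 1) <= tau.
    rewrite tauE /de ler_pdivrMr; last by apply: lt_le_trans ddE.
    have xh4 : 0 < 4 * xh by rewrite pmulr_rgt0.
    rewrite mulrAC (ler_pdivlMr _ _ xh4).
    have lx := ler_wpM2l (ltW lam0) ddE; have lx0 := mulr_gt0 lam0 xh0.
    clear -lx lx0; lra.
  move=> /(ler_wpM2r S10) pen; apply: le_trans pen _.
  by rewrite lerDl mulr_ge0.
have PNb : (P N <= (2 * T%:R * expR (- sz))%:E)%E.
  apply: le_trans PN _; apply: le_trans (_ : \sum_(t <- index_enum I) bnd%:E <= _)%E.
    by apply: lee_sum => t _; case: (FP t).
  rewrite sumEFin lee_fin big_const_seq count_predT iter_addr_0 -[_ *+ _]mulr_natr.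
  have -> : size (index_enum I) = ((p * 2) ^ dd)%N.
    by rewrite [index_enum I]unlock -enumT -cardT card_tuple card_prod card_ord card_bool.
  have cnt := count_le_exp p_gt0 s1 lps (erefl dd).
  apply: le_trans (ler_wpM2l bnd0 cnt) _.
  have TE : bnd <= 2 * T%:R * ((B + 1) * expR (- z)).
    have Ty : T%:R / (x / 2) ^+ 2 <= T%:R.
      have y1 : 1 <= x / 2 by clear -x2; lra.
      by rewrite ler_pdivrMr ?exprn_gt0 ?(lt_le_trans ltr01 y1) // ler_peMr ?exprn_ege1 // ltW.
    have BT := ler_wpM2r (expR_ge0 (- z)) (ler_wpM2l (ltW B0) Ty).
    have -> : 2 * T%:R * ((B + 1) * expR (- z)) =
      2 * (B * T%:R * expR (- z)) + T%:R * (2 * expR (- z)) by ring.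
    by rewrite /bnd lerD2r ler_pM2l.
  apply: le_trans (ler_wpM2r (expR_ge0 _) TE) _.
  rewrite -[X in X <= _]mulrA; apply: ler_wpM2l; first by rewrite mulr_ge0.
  by rewrite mulrC; exact: expo.
have mNc : measurable (~` N) by exact: measurableC.
have PNRE : (P (~` N) <= P RE_event)%E by apply: le_measure; rewrite ?inE.
apply: le_trans PNRE.
rewrite probability_setC // EFinB; apply: leeB => //.
Qed.
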